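(* Let $V\subseteq\mathbb{A}^n$ be an irreducible $\Delta$-variety over $\mathcal{F}$. Let $\mathbb{L}$ be a quasi-generic $\Delta$-polynomial in $\mathbb{Y}=\{y_1,\ldots,y_n\}$ of order $s$ and let $\mathbf{u}$ be the set of its coefficients. Then: 1) $V\cap\mathbb{V}(\mathbb{L})\neq\emptyset$ (as a $\Delta$-variety over $\mathcal{F}\langle\mathbf{u}\rangle$) if and only if $\Delta\text{-}\dim(V)>0$. 2) If $\Delta\text{-}\dim(V)>0$, then $V\cap\mathbb{V}(\mathbb{L})$ is an irreducible $\Delta$-variety over $\mathcal{F}\langle\mathbf{u}\rangle$ and its Kolchin polynomial is $$\omega_{V\cap\mathbb{V}(\mathbb{L})}(t)=\omega_V(t)-\binom{t+m-s}{m}.$$ In particular, the $\Delta$-dimension of $V\cap\mathbb{V}(\mathbb{L})$ equals $\Delta\text{-}\dim(V)-1$.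
   Context: Setting: $m\ge 2$; $\mathcal{F}$ is a field of characteristic $0$ with commuting derivations $\Delta=\{\delta_1,\ldots,\delta_m\}$ (a $\Delta$-field), and $\mathcal{E}$ is a fixed universal $\Delta$-extension field of $\mathcal{F}$. ''$\Delta$-'' means ''(partial) differential''. $\Theta$ is the free commutative monoid generated by $\delta_1,\ldots,\delta_m$; $\mathrm{ord}(\prod\delta_i^{e_i})=\sum e_i$. $\mathcal{F}\{\mathbb{Y}\}=\mathcal{F}[\theta(y_j):\theta\in\Theta,1\le j\le n]$ is the $\Delta$-polynomial ring in $\Delta$-indeterminates $\mathbb{Y}=\{y_1,\ldots,y_n\}$; the order of a $\Delta$-polynomial is the maximal order of the derivatives $\theta(y_j)$ effectively appearing in it. $\mathbb{A}^n=\mathcal{E}^n$; a $\Delta$-variety over a $\Delta$-field $\mathcal{K}\subseteq\mathcal{E}$ is the zero set $\mathbb{V}(\Sigma)\subseteq\mathcal{E}^n$ of some $\Sigma\subseteq\mathcal{K}\{\mathbb{Y}\}$; it is irreducible over $\mathcal{K}$ iff the $\Delta$-ideal $\mathbb{I}(V)\subseteq\mathcal{K}\{\mathbb{Y}\}$ of all $\Delta$-polynomials vanishing on it is prime. $\mathcal{F}\langle\mathbf{u}\rangle$ is the $\Delta$-field generated by $\mathbf{u}$ over $\mathcal{F}$. Elements are $\Delta$-$\mathcal{F}$-indeterminates if the family of all their derivatives is algebraically independent over $\mathcal{F}$. For an irreducible $V$ over $\mathcal{K}$ with generic point $\eta$, $\Delta\text{-}\dim(V)$ is the $\Delta$-transcendence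 degree of $\mathcal{K}\langle\eta\rangle$ over $\mathcal{K}$, and the Kolchin polynomial $\omega_V(t)$ is the numerical polynomial which for all sufficiently large $t\in\mathbb{N}$ equals the dimension of the prime ideal $\mathbb{I}(V)\cap\mathcal{K}[\theta(y_j):\mathrm{ord}(\theta)\le t,\,1\le j\le n]$. Binomial coefficients are regarded as polynomials in $t$. $\mathrm{supp}(\mathbb{L})$ is the set of $\Delta$-monomials (products of derivatives $\theta(y_j)$) effectively appearing in $\mathbb{L}$. A quasi-generic $\Delta$-polynomial in $\mathbb{Y}$ of order $s$ is a $\Delta$-polynomial of order $s$ of the form $$\mathbb{L}=u_0+\sum_{j=1}^n u_jM_j(y_j)+\sum_{M_\alpha\in\mathrm{supp}(\mathbb{L})\setminus\{1,M_1,\ldots,M_n\}}u_\alpha M_\alpha(\mathbb{Y}),$$ where for each $j$, $M_j(y_j)$ is a (nonconstant) $\Delta$-monomial of order $s$ involving only $y_j$ and its derivatives, $\{1,M_1(y_1),\ldots,M_n(y_n)\}\subseteq\mathrm{supp}(\mathbb{L})$, and the coefficients $u_0,u_j,u_\alpha\in\mathcal{E}$ are (a family of) $\Delta$-$\mathcal{F}$-indeterminates. *)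

(* Defs.v *)
From HB Require Import structures.
From mathcomp Require Import all_boot all_order all_algebra finmap.
From mathcomp Require Import monalg.

Set Implicit Arguments.
Unset Strict Implicit.
Unset Printing Implicit Defensive.

Import GRing.Theory.
Local Open Scope ring_scope.

Structure diffFieldType (m : nat) := DiffField {
  dsort :> fieldType;
  der : 'I_m -> dsort -> dsort;
  derD : forall i x y, der i (x + y) = der i x + der i y;
  derM : forall i x y, der i (x * y) = der i x * y + x * der i y;
  derC : forall i j x, der i (der j x) = der j (der i x)
}.

(* The monoid Theta of derivative operators is {cmonom 'I_m}; the order of
   theta is its degree mdeg theta.  The fold order below is immaterial since
   the derivations commute. *)
Definition dapp m (E : diffFieldType m) (theta : {cmonom 'I_m}) (x : E) : E :=
  foldr (fun i y => iter (theta i) (der i) y) x (enum 'I_m).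

(* A derivative theta(y_j) is the pair (theta, j). *)
Definition deriv_var (m : nat) (I : choiceType) : choiceType :=
  ({cmonom 'I_m} * I)%type.

Definition dmonom (m : nat) (I : choiceType) := {cmonom (deriv_var m I)}.

(* E{y_i : i in I}.  The ring K{y_i : i in I} over a subfield K of E is its
   subring singled out by the predicate [coefs_in K] below. *)
Definition dpoly m (E : diffFieldType m) (I : choiceType) :=
  {malg E[dmonom m I]}.

Definition coefs_in (R : nzRingType) (M : choiceType) (K : R -> Prop)
  (p : {malg R[M]}) : Prop := forall k, K p@_k.

Definition mon_eval (R : comNzRingType) (I : choiceType) (g : I -> R)
  (M : {cmonom I}) : R := \prod_(v <- finsupp M) g v ^+ M v.

Definition dp_eval m (E : diffFieldType m) (I : choiceType)
    (p : dpoly E I) (a : I -> E) : E :=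
  mmap idfun (mon_eval (fun v : deriv_var m I => dapp v.1 (a v.2))) p.

Definition dmon_order m (I : choiceType) (M : dmonom m I) : nat :=
  \max_(v <- finsupp M) mdeg v.1.

(* Constants are given order 0. *)
Definition dp_order m (E : diffFieldType m) (I : choiceType)
  (p : dpoly E I) : nat := \max_(M <- msupp p) dmon_order M.

Section SubfieldsAndIndependence.
Context (m : nat) (E : diffFieldType m).

Record delta_subfield (K : E -> Prop) : Prop := DeltaSubfield {
  dsub1 : K 1;
  dsubB : forall x y, K x -> K y -> K (x - y);
  dsubM : forall x y, K x -> K y -> K (x * y);
  dsubV : forall x, K x -> K x^-1;
  dsub_der : forall i x, K x -> K (der i x)
}.

Definition delta_adjoin (K S : E -> Prop) : E -> Prop := fun x =>
  forall L : E -> Prop, delta_subfield L ->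
    (forall y, K y -> L y) -> (forall y, S y -> L y) -> L x.

Definition range_of (I : Type) (a : I -> E) : E -> Prop :=
  fun x => exists i, x = a i.

Definition delta_indep (K : E -> Prop) (I : choiceType) (a : I -> E) : Prop :=
  forall p : dpoly E I, coefs_in K p -> dp_eval p a = 0 -> p = 0.

(* d is the Delta-transcendence degree of L over K *)
Definition delta_trdeg (K L : E -> Prop) (d : nat) : Prop :=
  (exists a : 'I_d -> E, (forall i, L (a i)) /\ delta_indep K a) /\
  (forall a : 'I_d.+1 -> E, (forall i, L (a i)) -> ~ delta_indep K a).

End SubfieldsAndIndependence.

(* f is a morphism of Delta-rings on the Delta-subfield K; its values outside
   of K are irrelevant. *)
Record delta_hom_on m (E G : diffFieldType m) (K : E -> Prop) (f : E -> G)
  : Prop := DeltaHomOn {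
  dhom1 : f 1 = 1;
  dhomD : forall x y, K x -> K y -> f (x + y) = f x + f y;
  dhomM : forall x y, K x -> K y -> f (x * y) = f x * f y;
  dhom_der : forall i x, K x -> f (der i x) = der i (f x)
}.

(* Kolchin's notion: every finitely generated Delta-extension G of a finitely
   generated Delta-extension F1 of F inside E embeds into E over F1. *)
Definition universal_over m (E : diffFieldType m) (F : E -> Prop) : Prop :=
  forall (k : nat) (a : 'I_k -> E),
  let F1 := delta_adjoin F (range_of a) in
  forall (G : diffFieldType m) (j : E -> G),
  delta_hom_on F1 j ->
  (exists (l : nat) (b : 'I_l -> G), forall x : G,
     delta_adjoin (fun y => exists2 z, F1 z & y = j z) (range_of b) x) ->
  exists2 phi : G -> E, delta_hom_on (fun=> True) phi &
    forall x, F1 x -> phi (j x) = x.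

(* P is a prime ideal of the subring A of R *)
Record prime_ideal (R : comNzRingType) (A P : R -> Prop) : Prop := PrimeIdeal {
  pi_sub : forall p, P p -> A p;
  pi0 : P 0;
  piD : forall p q, P p -> P q -> P (p + q);
  piM : forall p q, A p -> P q -> P (p * q);
  pi_proper : ~ P 1;
  pi_prime : forall p q, A p -> A q -> P (p * q) -> P p \/ P q
}.

Section Varieties.
Context (m n : nat) (E : diffFieldType m).
Implicit Types (K : E -> Prop) (V : ('I_n -> E) -> Prop).

Definition delta_variety K V : Prop :=
  exists2 Sigma : dpoly E 'I_n -> Prop,
    (forall p, Sigma p -> coefs_in K p) &
    (forall a, V a <-> forall p, Sigma p -> dp_eval p a = 0).

Definition vanishing_ideal K V : dpoly E 'I_n -> Prop := fun p =>
  coefs_in K p /\ forall a, V a -> dp_eval p a = 0.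

Definition irreducible_variety K V : Prop :=
  delta_variety K V /\ prime_ideal (coefs_in K) (vanishing_ideal K V).

Definition generic_point K V (eta : 'I_n -> E) : Prop :=
  V eta /\
  forall p, coefs_in K p -> dp_eval p eta = 0 -> vanishing_ideal K V p.

Definition is_delta_dim K V (d : nat) : Prop :=
  exists2 eta : 'I_n -> E, generic_point K V eta &
    delta_trdeg K (delta_adjoin K (range_of eta)) d.

(* For a prime ideal P of a K-subalgebra A of E{Y}, d is the transcendence
   degree over K of the domain A / P, i.e. the dimension of P. *)
Definition is_dim_prime K (A P : dpoly E 'I_n -> Prop) (d : nat) : Prop :=
  let indep_mod k (g : 'I_k -> dpoly E 'I_n) :=
    forall Q : {malg E['X_{1..k}]}, coefs_in K Q ->
      P (mmap (@malgC _ _) (mon_eval g) Q) -> Q = 0 in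
  (exists g : 'I_d -> dpoly E 'I_n, (forall i, A (g i)) /\ indep_mod d g) /\
  (forall g : 'I_d.+1 -> dpoly E 'I_n, (forall i, A (g i)) ->
     ~ indep_mod d.+1 g).

(* K[theta(y_j) : ord theta <= t] *)
Definition trunc_ring K (t : nat) : dpoly E 'I_n -> Prop := fun p =>
  coefs_in K p /\ (dp_order p <= t)%N.

Definition is_kolchin_poly K V (w : {poly rat}) : Prop :=
  exists t0 : nat, forall t : nat, (t0 <= t)%N ->
  exists2 d : nat,
    is_dim_prime K (trunc_ring K t)
      (fun p => vanishing_ideal K V p /\ (dp_order p <= t)%N) d &
    w.[t%:R] = d%:R.

(* The coefficients of L are indexed by its support, so that independence of
   the family forces them to be pairwise distinct. *)
Definition quasi_generic (F : E -> Prop) (s : nat) (L : dpoly E 'I_n) : Prop :=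
  [/\ dp_order L = s,
      (mone : dmonom m 'I_n) \in msupp L,
      (forall j : 'I_n, exists M : dmonom m 'I_n,
         [/\ M != mone, forall v, v \in finsupp M -> v.2 = j,
             dmon_order M = s & M \in msupp L])
    & delta_indep F (fun M : msupp L => L@_(val M))].

Definition coef_set (L : dpoly E 'I_n) : E -> Prop :=
  fun x => exists2 M, M \in msupp L & x = L@_M.

End Varieties.

(* binom(p, k) for a polynomial p *)
Definition poly_binom (p : {poly rat}) (k : nat) : {poly rat} :=
  (k`!%:R)^-1 *: \prod_(i < k) (p - (i : nat)%:R%:P).

(* Main.v *)
From HB Require Import structures.
Require Import Defs.
From mathcomp Require Import all_boot all_order all_algebra finmap.
From mathcomp Require Import monalg.
From mathcomp Require Import boolp.
From mathcomp Require Import zify ring.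

Set Implicit Arguments.
Unset Strict Implicit.
Unset Printing Implicit Defensive.

Import GRing.Theory.
Local Open Scope ring_scope.

(** Let [eta] be a generic point of V and let [u o] be the coefficient in L of
    the monomial 1. A point [a] of V satisfies L = 0 exactly when [u o] equals
    [- \sum_(i | i != o) u i * M i(a)], and this equation is read backwards.
    Start with a generic point of V and with elements [v i], [i != o], that
    are Delta-independent over it, and let zeta be the right hand side at that
    point. If V has positive Delta-dimension, then zeta and the [v i] together
    are Delta-independent over F. So they satisfy the same relations over F as
    [u], namely none, and universality of E moves the whole configuration onto
    [u]: this gives a generic point [eta] of V over F on which L vanishes
    ([generic_position]). Let a Delta-polynomial over F<u> vanish at [eta].
    When [u o] is replaced by its value as a function of the point and
    denominators are cleared, it becomes a polynomial in the derivatives of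
    the independent [v i] whose coefficients are Delta-polynomials over F.
    These vanish at [eta], hence on V. So [eta] is a generic point of the
    section over F<u>, which is therefore irreducible
    ([generic_vanish_section]).

    The Kolchin polynomial counts a rank. Algebraic closure inside E has the
    exchange property ([acl_exchange], [steinitz]), and the dimension of the
    ideal of order t is the size of a maximal independent sequence of
    derivatives of [eta] of order at most t ([dim_primeP]). For an orderly
    ranking the basic derivatives, those that are not algebraic over the lower
    ones, form such a sequence. In characteristic 0 a derivation maps
    derivatives that are not basic to such derivatives ([acl_der],
    [nbasic_shift]). Hence a coordinate either has only basic derivatives (its
    column is full) or has so few of them that their number is of lower
    growth, and the Delta-dimension is the number of full columns
    ([delta_trdegP]).

    The heart of the proof is [indseq_quasi_generic]: for every T, the
    derivatives of zeta of order at least T are independent over the field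
    generated over F by the derivatives of the [v i] and the derivatives of
    [eta] of order less than T + s. For T = 0 this is the independence used
    above. For T = t - s + 1 it says that, among the derivatives of [u o],
    only those of order at most t - s impose a condition on the derivatives of
    [eta] of order at most t. They are 'C(t - s + m, m) in number and
    independent, which is the drop in the Kolchin polynomial ([rank_section]);
    growth in t then gives the Delta-dimension ([cols_section]). To prove it
    one writes zeta = - (v x + c), where x is the value at [eta] of a monomial
    in a coordinate with a full column and v is its coefficient. The
    derivatives of x of order at least T are independent because of their
    leading derivatives ([indseq_monomial]). Divided by v, the derivatives of
    v x + c become theta(v x) / v + v^-1 theta(c), where theta(v x) / v and
    theta(c) belong to a field over which v^-1 is transcendental. Such a
    family on a line is at least as independent as its value at v^-1 = 0
    ([alg_indep_line], [indseq_generic_line]).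

    If V has Delta-dimension 0, the coordinates of every point of V are Delta-
    algebraic over F. A point on the section would then put the Delta-
    independent family [u] into a Delta-field of smaller Delta-transcendence
    degree ([no_algebraic_solution]). *)

(** * Subfields of a field as predicates *)

(** Subfields are predicates, like Delta-subfields, so that several of them
    can be compared inside one field. *)
Record is_subfield (E : fieldType) (K : E -> Prop) : Prop := IsSubfield {
  sf1 : K 1;
  sfB : forall x y, K x -> K y -> K (x - y);
  sfM : forall x y, K x -> K y -> K (x * y);
  sfV : forall x, K x -> K x^-1
}.

Section SubfieldClosure.
Variables (E : fieldType) (K : E -> Prop) (hK : is_subfield K).

Lemma sf0 : K 0. Proof. by rewrite -(subrr 1); apply: sfB hK _ _ (sf1 hK) (sf1 hK). Qed.
Lemma sfN x : K x -> K (- x).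
Proof. by move=> kx; rewrite -sub0r; apply: (sfB hK) => //; apply: sf0. Qed.
Lemma sfD x y : K x -> K y -> K (x + y).
Proof. by move=> kx ky; rewrite -[y]opprK; apply: (sfB hK) => //; apply: sfN. Qed.
Lemma sfX x n : K x -> K (x ^+ n).
Proof.
move=> kx; elim: n => [|n IH]; first exact: sf1 hK.
by rewrite exprS; apply: (sfM hK).
Qed.
Lemma sf_nat n : K n%:R.
Proof. by elim: n => [|n IH]; [apply: sf0 | rewrite -natr1; apply: sfD => //; apply: sf1 hK]. Qed.
Lemma sf_sum (I : Type) (r : seq I) (P : pred I) (f : I -> E) :
  (forall i, P i -> K (f i)) -> K (\sum_(i <- r | P i) f i).
Proof. by move=> kf; apply: big_ind => //; [apply: sf0 | apply: sfD]. Qed.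
Lemma sf_prod (I : Type) (r : seq I) (P : pred I) (f : I -> E) :
  (forall i, P i -> K (f i)) -> K (\prod_(i <- r | P i) f i).
Proof. by move=> kf; apply: big_ind => //; [apply: sf1 hK | apply: (sfM hK)]. Qed.
Lemma sf_horner (p : {poly E}) x : (forall i, K p`_i) -> K x -> K p.[x].
Proof.
move=> kp kx; rewrite horner_coef; apply: sf_sum => i _.
by apply: (sfM hK) => //; apply: sfX.
Qed.

Definition sf_pred of is_subfield K : {pred E} := fun x => `[< K x >].
Fact sf_divring : divring_closed (sf_pred hK).
Proof.
split; first by apply/asboolP; apply: sf1 hK.
  by move=> x y /asboolP kx /asboolP ky; apply/asboolP; apply: (sfB hK).
by move=> x y /asboolP kx /asboolP ky; apply/asboolP; apply: (sfM hK) => //; apply: (sfV hK).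
Qed.
HB.instance Definition _ := GRing.isDivringClosed.Build E (sf_pred hK) sf_divring.

(** The subfield as a type, to serve as the base ring of integral elements. *)
Record sf_type := SF { sf_val : E; sf_valP : sf_val \in sf_pred hK }.
HB.instance Definition _ := [isSub for sf_val].
HB.instance Definition _ := [Choice of sf_type by <:].
HB.instance Definition _ := [SubChoice_isSubComUnitRing of sf_type by <:].
HB.instance Definition _ := [SubComUnitRing_isSubIntegralDomain of sf_type by <:].
HB.instance Definition _ := [SubIntegralDomain_isSubField of sf_type by <:].

Lemma sf_typeP (x : sf_type) : K (val x).
Proof. exact/asboolP/(valP x). Qed.

Definition sf_of x (kx : K x) : sf_type := SF (introT (asboolP _) kx : x \in sf_pred hK).

Lemma sf_lift_poly (p : {poly E}) : (forall i, K p`_i) ->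
  exists q : {poly sf_type}, map_poly val q = p.
Proof.
move=> kp; exists (\poly_(i < size p) sf_of (kp i)).
apply/polyP => i; rewrite coef_map coef_poly.
by case: ltnP => //= hi; rewrite nth_default.
Qed.

End SubfieldClosure.

(** * Algebraic closure inside a field *)

Section Acl.
Variable E : fieldType.
Implicit Types (A B : E -> Prop) (s t : seq E) (x y : E) (p : {poly E}).

Inductive fgen A : E -> Prop :=
| fgen_in x : A x -> fgen A x
| fgen1 : fgen A 1
| fgenB x y : fgen A x -> fgen A y -> fgen A (x - y)
| fgenM x y : fgen A x -> fgen A y -> fgen A (x * y)
| fgenV x : fgen A x -> fgen A x^-1.

Lemma fgen_subfield A : is_subfield (fgen A).
Proof. by split; [apply: fgen1|apply: fgenB|apply: fgenM|apply: fgenV]. Qed.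

Lemma fgen_min A K : is_subfield K -> (forall x, A x -> K x) ->
  forall x, fgen A x -> K x.
Proof.
move=> hK AK x; elim=> {x} [x /AK //||x y _ kx _ ky|x y _ kx _ ky|x _ kx].
- exact: sf1 hK.
- exact: (sfB hK).
- exact: (sfM hK).
- exact: (sfV hK).
Qed.

Lemma fgen_sub A B : (forall x, A x -> fgen B x) -> forall x, fgen A x -> fgen B x.
Proof. by move=> AB; apply: fgen_min AB; apply: fgen_subfield. Qed.

Lemma fgen_mono A B : (forall x, A x -> B x) -> forall x, fgen A x -> fgen B x.
Proof. by move=> AB; apply: fgen_sub => x /AB; apply: fgen_in. Qed.

Definition adj A s : E -> Prop := fun x => A x \/ x \in s.

Lemma fgen_finitary A B x : fgen (fun z => A z \/ B z) x ->
  exists2 s, (forall z, z \in s -> B z) & fgen (adj A s) x.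
Proof.
elim=> {x} [x [Ax|Bx]||x y _ [s sB sx] _ [t tB ty]|x y _ [s sB sx] _ [t tB ty]|x _ [s sB sx]].
- by exists [::] => //; apply: fgen_in; left.
- exists [:: x]; first by move=> z; rewrite inE => /eqP->.
  by apply: fgen_in; right; rewrite inE.
- by exists [::] => //; apply: fgen1.
- exists (s ++ t); first by move=> z; rewrite mem_cat => /orP[/sB|/tB].
  apply: fgenB; [apply: fgen_mono sx|apply: fgen_mono ty] => z [Az|zs];
    by [left | right; rewrite mem_cat zs ?orbT].
- exists (s ++ t); first by move=> z; rewrite mem_cat => /orP[/sB|/tB].
  apply: fgenM; [apply: fgen_mono sx|apply: fgen_mono ty] => z [Az|zs];
    by [left | right; rewrite mem_cat zs ?orbT].
- by exists s => //; apply: fgenV.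
Qed.

(** The parameters that suffice for the single coefficients are collected into
    one list; [Q s x] is to be read: the parameters [s] suffice for [x]. *)
Lemma poly_finitary (Q : seq E -> E -> Prop) (C : seq E -> Prop) p :
  (forall s t x, C s -> C t -> Q s x -> Q (s ++ t) x /\ Q (t ++ s) x) ->
  (forall s t, C s -> C t -> C (s ++ t)) ->
  (forall s, C s -> Q s 0) ->
  C [::] -> (forall i, exists2 s, C s & Q s p`_i) ->
  exists2 s, C s & forall i, Q s p`_i.
Proof.
move=> mono Ccat Q0 C0 fp.
have : exists2 s, C s & forall i, (i < size p)%N -> Q s p`_i.
  elim: (size p) => [|n [s Cs IH]]; first by exists [::].
  have [t Ct ht] := fp n; exists (s ++ t); first exact: Ccat.
  move=> i; rewrite ltnS leq_eqVlt => /orP[/eqP->|/IH hi].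
    by case: (mono t s _ Ct Cs ht).
  by case: (mono s t _ Cs Ct hi).
case=> s Cs hs; exists s => // i.
by case: (ltnP i (size p)) => [/hs //|hi]; rewrite nth_default //; apply: Q0.
Qed.

Definition acl A x := exists p, [/\ p != 0, forall i, fgen A p`_i & root p x].

(** Integral elements form a ring and are closed under iteration; this yields
    the two closure properties [acl_subfield] and [acl_trans]. *)
Lemma acl_integral A x :
  acl A x <-> integralOver (val : sf_type (fgen_subfield A) -> E) x.
Proof.
rewrite -(integral_algebraic (val : sf_type (fgen_subfield A) -> E)); split.
  case=> p [p0 /(sf_lift_poly (fgen_subfield A))[q qp] px].
  exists q; last by rewrite qp.
  by apply: contraNneq p0 => q0; rewrite -qp q0 map_poly0.
case=> q q0 qx; exists (map_poly val q); split => //.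
  by rewrite map_poly_eq0.
by move=> i; rewrite coef_map; apply: sf_typeP.
Qed.

Lemma fgen_acl A x : fgen A x -> acl A x.
Proof.
move=> Ax; exists ('X - x%:P); split; rewrite ?polyXsubC_eq0 ?root_XsubC //.
move=> i; rewrite coefB coefX coefC; have hF := fgen_subfield A.
by apply: fgenB; [apply: sf_nat | case: eqP => _ //; apply: sf0].
Qed.

Lemma acl_in A x : A x -> acl A x.
Proof. by move=> /(@fgen_in A); apply: fgen_acl. Qed.

Lemma acl_fmono A B : (forall x, A x -> fgen B x) -> forall x, acl A x -> acl B x.
Proof.
move=> AB x [p [p0 pA px]]; exists p; split => // i.
exact: fgen_sub AB _ (pA i).
Qed.

Lemma acl_mono A B : (forall x, A x -> B x) -> forall x, acl A x -> acl B x.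
Proof. by move=> AB; apply: acl_fmono => x /AB; apply: fgen_in. Qed.

Lemma acl_subfield A : is_subfield (acl A).
Proof.
split.
- by apply: fgen_acl; apply: fgen1.
- by move=> x y /acl_integral ix /acl_integral iy; apply/acl_integral/integral_sub.
- by move=> x y /acl_integral ix /acl_integral iy; apply/acl_integral/integral_mul.
- by move=> x /acl_integral ix; apply/acl_integral/integral_inv.
Qed.

Lemma acl_trans A B : (forall x, A x -> acl B x) -> forall x, acl A x -> acl B x.
Proof.
move=> AB x [p [p0 pA px]]; apply/acl_integral; apply: integral_root p0 px _.
apply/integral_poly => i; apply/acl_integral.
exact: fgen_min (acl_subfield B) AB _ (pA i).
Qed.

Lemma acl_finitary A B x : acl (fun z => A z \/ B z) x ->
  exists2 s, (forall z, z \in s -> B z) & acl (adj A s) x.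
Proof.
case=> p [p0 pA px].
have [|||||s sB sp] := @poly_finitary (fun s x => fgen (adj A s) x)
    (fun s => forall z, z \in s -> B z) p; last by exists s => //; exists p.
- move=> s t z _ _ zs; split; apply: fgen_mono zs => w [Aw|ws];
    by [left | right; rewrite mem_cat ws ?orbT].
- by move=> s t sB tB z; rewrite mem_cat => /orP[/sB|/tB].
- by move=> s _; exact: (sf0 (fgen_subfield _)).
- by [].
- by move=> i; apply: fgen_finitary.
Qed.

Definition pcoef A p := forall i, fgen A p`_i.

Lemma pcoefC A c : fgen A c -> pcoef A c%:P.
Proof. by move=> Ac i; rewrite coefC; case: eqP => // _; exact: (sf0 (fgen_subfield _)). Qed.

Lemma pcoef1 A : pcoef A 1. Proof. by apply: pcoefC; apply: fgen1. Qed.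

Lemma pcoefX A : pcoef A 'X.
Proof. by move=> i; rewrite coefX; exact: (sf_nat (fgen_subfield _)). Qed.

Lemma pcoefM A p q : pcoef A p -> pcoef A q -> pcoef A (p * q).
Proof.
move=> hp hq i; rewrite coefM; apply: (sf_sum (fgen_subfield A)) => j _.
exact: fgenM.
Qed.

(** The quotients of elements of a subring form a field. Elements of a
    generated field are put in this form several times, with [R] as a ring of
    values of some kind of polynomials. *)
Lemma fgen_fractions A (R : E -> Prop) : R 1 ->
  (forall x y, R x -> R y -> R (x - y)) -> (forall x y, R x -> R y -> R (x * y)) ->
  (forall x, A x -> R x) ->
  forall x, fgen A x -> exists a b, [/\ R a, R b, b != 0 & x = a / b].
Proof.
move=> R1 RB RM AR; apply: fgen_min => [|x /AR Rx]; last first.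
  by exists x, 1; split; rewrite ?divr1 ?oner_eq0.
split=> [|_ _ [a [b [Ra Rb b0 ->]]] [c [d [Rc Rd d0 ->]]]
  |_ _ [a [b [Ra Rb b0 ->]]] [c [d [Rc Rd d0 ->]]]|_ [a [b [Ra Rb b0 ->]]]].
- by exists 1, 1; split; rewrite ?divr1 ?oner_eq0.
- exists (a * d - c * b), (b * d); split; [|exact: RM|exact: mulf_neq0|].
    by apply: RB; apply: RM.
  by field; rewrite b0 d0.
- by exists (a * c), (b * d); split; rewrite ?mulf_neq0 ?mulf_div //; apply: RM.
- case: (eqVneq a 0) => [->|a0]; last by exists b, a; rewrite invf_div.
  exists (1 - 1), 1; split; rewrite ?oner_eq0 //; first exact: RB.
  by rewrite subrr !mul0r invr0.
Qed.

Lemma fgen_frac A y x : fgen (adj A [:: y]) x ->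
  exists a b : {poly E}, [/\ pcoef A a, pcoef A b, b.[y] != 0 & x = a.[y] / b.[y]].
Proof.
pose R z := exists2 a, pcoef A a & z = a.[y].
case/(@fgen_fractions _ R) => [||||_ [_ [[a ha ->] [b hb ->] b0 ->]]]; last by exists a, b.
- by exists 1; [apply: pcoef1 | rewrite hornerC].
- move=> _ _ [p hp ->] [q hq ->]; exists (p - q); last by rewrite hornerD hornerN.
  by move=> i; rewrite coefB; apply: fgenB.
- by move=> _ _ [p hp ->] [q hq ->]; exists (p * q); [apply: pcoefM | rewrite hornerM].
- move=> z [Az|]; first by exists z%:P; [apply/pcoefC/fgen_in | rewrite hornerC].
  by rewrite inE => /eqP->; exists 'X; [apply: pcoefX | rewrite hornerX].
Qed.

(** Clearing denominators turns a polynomial over A(y) into a polynomial in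
    two variables over A, evaluated at [y] in one of them. *)
Lemma poly_frac A y p : pcoef (adj A [:: y]) p ->
  exists (P : {poly {poly E}}) (b : {poly E}), [/\ b.[y] != 0, pcoef A b,
     forall i, pcoef A P`_i & forall i, (P`_i).[y] = b.[y] * p`_i].
Proof.
elim/poly_ind: p => [|p c IH] hp.
  exists 0, 1; split; rewrite ?hornerE ?oner_eq0 // => i.
  - exact: pcoef1.
  - by rewrite coef0 -polyC0; exact: (pcoefC (sf0 (fgen_subfield _))).
  by rewrite !coef0 mulr0 horner0.
have [|P [b [bn hb hP eP]]] := IH.
  by move=> i; have := hp i.+1; rewrite coefD coefMX coefC /= addr0.
have := hp 0%N; rewrite coefD coefMX coefC /= add0r => /fgen_frac.
case=> a' [b' [ha' hb' bn' ec]].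
exists (b' *: (P * 'X) + (a' * b)%:P), (b * b'); split.
- by rewrite hornerM mulf_neq0.
- exact: pcoefM.
- move=> i; rewrite coefD coefZ coefMX coefC.
  case: i => [|i] /=; first by rewrite mulr0 add0r; apply: pcoefM.
  by rewrite addr0; apply: pcoefM.
move=> i; rewrite coefD coefZ coefMX coefC [(p * _ + _)`_i]coefD coefMX coefC.
case: i => [|i] /=; rewrite !hornerE; first by rewrite ec; field.
by rewrite eP; ring.
Qed.

(** A relation of [x] over A(y) becomes, without denominators, a nonzero
    polynomial over A that vanishes at (x, y). As [x] is transcendental over
    A, it remains nonzero when [x] is substituted alone, and then it is a
    relation of [y] over A(x). *)
Lemma acl_exchange A x y :
  acl (adj A [:: y]) x -> ~ acl A x -> acl (adj A [:: x]) y.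
Proof.
case=> p [p0 /poly_frac[P [b [bn hb hP eP]]] px] nx; apply: contrapT => ny.
have P0 : P = 0.
  (* R is P read as a polynomial in y with coefficients in A[x] *)
  pose R := swapXY P.
  have cR i j : R`_i`_j = P`_j`_i by rewrite coef_swapXY.
  have hR i : pcoef A R`_i by move=> j; rewrite cR; apply: hP.
  pose q := map_poly (horner_eval x) R.
  have cq i : q`_i = (R`_i).[x] by rewrite coef_map.
  have hq : forall i, fgen (adj A [:: x]) q`_i.
    move=> i; rewrite cq; apply: (sf_horner (fgen_subfield _)).
      by move=> j; apply: fgen_mono (hR i j) => z; left.
    by apply: fgen_in; right; rewrite inE.
  have q0 : q = 0.
    apply: contrapT => /eqP qn; apply: ny; exists q; split => //.
    have pP : map_poly (horner_eval y) P = b.[y] *: p.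
      by apply/polyP => i; rewrite coef_map coefZ /= /horner_eval eP.
    rewrite rootE /q -horner_swapXY swapXYK.
    rewrite -[_.[y]]/(horner_eval y P.[x%:P]) -horner_map pP.
    by rewrite /= /horner_eval hornerC hornerZ (rootP px) mulr0.
  have R0 : R = 0.
    apply/polyP => i; rewrite coef0; apply: contrapT => /eqP Rn; apply: nx.
    by exists R`_i; split => //; [exact: hR|]; rewrite rootE -cq q0 coef0.
  by rewrite -[P]swapXYK -/R R0 rmorph0.
move: p0 => /eqP; apply; apply/polyP => i; rewrite coef0.
have := eP i; rewrite P0 coef0 horner0 => /esym/eqP.
by rewrite mulf_eq0 (negPf bn) => /eqP.
Qed.
End Acl.

(** * Independent sequences and exchange *)

Section Independence.
Variable E : fieldType.
Implicit Types (A B : E -> Prop) (s t b : seq E) (x y : E).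

(** Sequences, rather than sets, make ranks into sizes; by [indseq_perm] the
    order of the members does not matter. *)
Fixpoint indseq A s : Prop :=
  if s is x :: s' then ~ acl (adj A s') x /\ indseq A s' else True.

Lemma adj_cat A s t x : adj A (s ++ t) x <-> adj (adj A t) s x.
Proof.
rewrite /adj mem_cat; split.
  by case=> [|/orP[]]; tauto.
by case=> [[|->]|->]; rewrite ?orbT; [left|right|right].
Qed.

Lemma adj_sub A B s t : (forall x, A x -> B x) -> {subset s <= t} ->
  forall x, adj A s x -> adj B t x.
Proof. by move=> AB st x [/AB|/st]; [left|right]. Qed.

Lemma acl_adj_sub A s t x : {subset s <= t} -> acl (adj A s) x -> acl (adj A t) x.
Proof. by move=> st; apply: acl_mono; apply: adj_sub. Qed.

Lemma acl_adj_cons A s x y : acl (adj A s) x -> acl (adj A (y :: s)) x.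
Proof. by apply: acl_adj_sub => z zs; rewrite inE zs orbT. Qed.

Lemma acl_adj_self A s x : x \in s -> acl (adj A s) x.
Proof. by move=> xs; apply: acl_in; right. Qed.

Lemma acl_adj_cat A s t x : acl (adj A (s ++ t)) x <-> acl (adj (adj A t) s) x.
Proof. by split; apply: acl_mono => z /adj_cat. Qed.

Lemma indseq_cat A s t : indseq A (s ++ t) <-> indseq (adj A t) s /\ indseq A t.
Proof.
elim: s => [|x s IH] /=; first by tauto.
by rewrite IH acl_adj_cat; tauto.
Qed.

Lemma indseq_mono A B s : (forall x, A x -> acl B x) -> indseq B s -> indseq A s.
Proof.
move=> AB; elim: s => [//|x s IH] /= [nx /IH hs]; split=> // xs; apply: nx.
apply: acl_trans xs => z [/AB|zs]; last exact: acl_adj_self.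
by apply: acl_mono => w; left.
Qed.

Lemma indseq_swap A x y s : indseq A (x :: y :: s) -> indseq A (y :: x :: s).
Proof.
move=> /= [nx [ny hs]]; split; last first.
  by split=> // xs; apply: nx; apply: acl_adj_cons.
move=> hy; apply: nx.
have e (z w : E) : forall u, adj (adj A s) [:: z] u -> adj A (z :: s) u.
  move=> u [[Au|us]|]; [by left | by right; rewrite inE us orbT|].
  by rewrite inE => uz; right; rewrite inE uz.
have e' (z w : E) : forall u, adj A (z :: s) u -> adj (adj A s) [:: z] u.
  move=> u [Au|]; [by left; left | rewrite inE => /orP[uz|us]].
    by right; rewrite inE.
  by left; right.
apply: acl_mono (e y y) _ _; apply: acl_exchange ny.
exact: acl_mono (e' x x) _ hy.
Qed.

Lemma indseq_rot A x s t : indseq A (x :: s ++ t) -> indseq A (s ++ x :: t).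
Proof.
elim: s => [//|y s IH] /indseq_swap /=; rewrite -/(cat _ _) => -[ny hs]; split.
  move=> hy; apply: ny; apply: acl_adj_sub hy => z.
  by rewrite !(inE, mem_cat); case: (z \in s); case: (z == x); case: (z \in t).
exact: IH.
Qed.

Lemma indseq_perm A s t : perm_eq s t -> indseq A s -> indseq A t.
Proof.
elim: s t => [|x s IH] t pst.
  by case: t pst => [//|y t /perm_size].
have xt : x \in t by rewrite -(perm_mem pst) mem_head.
case/splitPr: xt pst => t1 t2 pst /= [nx hs]; apply: indseq_rot.
have pst' : perm_eq s (t1 ++ t2).
  by rewrite -(perm_cons x) (perm_trans pst) // perm_catC /= perm_cons perm_catC.
split; last exact: IH pst' hs.
by move=> hx; apply: nx; apply: acl_adj_sub hx => z; rewrite (perm_mem pst').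
Qed.

Lemma indseq_sub A s t : uniq t -> {subset t <= s} -> indseq A s -> indseq A t.
Proof.
elim: t s => [//|x t IH] s /= /andP[xt ut] ts hs.
have xs : x \in s by apply: ts; rewrite mem_head.
have /= [nx hs'] := indseq_perm (perm_to_rem xs) hs.
have sub : {subset t <= rem x s}.
  move=> z zt; have zx : z != x by apply: contraNneq xt => <-.
  have : z \in s by apply: ts; rewrite inE zt orbT.
  by rewrite (perm_mem (perm_to_rem xs)) inE (negPf zx).
split; last exact: IH ut sub hs'.
by move=> hx; apply: nx; apply: acl_adj_sub hx.
Qed.

Lemma indseq_uniq A s : indseq A s -> uniq s.
Proof.
elim: s => [//|x s IH] /= [nx /IH ->]; rewrite andbT.
by apply/negP => xs; apply: nx; apply: acl_adj_self.
Qed.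

(** The exchange step: adding [y] to the base costs an independent sequence at
    most one member. *)
Lemma indseq_adj1 A y s : indseq A s -> indseq (adj A [:: y]) s \/
  exists x s', [/\ perm_eq s (x :: s'), indseq (adj A [:: y]) s' &
    acl (adj (adj A [:: y]) s') x].
Proof.
elim: s => [|x s IH] /=; first by left.
case=> nx hs; case: (IH hs) => [hy|[x' [s' [ps hy xy]]]].
  case: (pselect (acl (adj (adj A [:: y]) s) x)) => hx; last by left.
  by right; exists x, s.
right; exists x', (x :: s'); split.
- apply: (@perm_trans _ (x :: x' :: s')); first by rewrite perm_cons.
  by rewrite (perm_catCA [:: x] [:: x'] s').
- split=> // xs.
  have ps2 : perm_eq (x :: s) (x :: x' :: s') by rewrite perm_cons.
  have /= [nx' [nxs _]] : indseq A (x' :: x :: s').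
    by apply: indseq_swap; apply: indseq_perm ps2 _.
  have hyx : acl (adj (adj A s') [:: x]) y.
    apply: acl_exchange nxs; apply: acl_mono xs => z.
    by case=> [[|]|]; rewrite /adj; tauto.
  apply: nx'; apply: acl_trans xy => z [[Az|]|zs].
  + by apply: acl_in; left.
  + rewrite inE => /eqP->; apply: acl_mono hyx => w.
    case=> [[|ws]|]; [by left | by right; rewrite inE ws orbT|].
    by rewrite inE => wx; right; rewrite inE wx.
  + by apply: acl_adj_self; rewrite inE zs orbT.
by apply: acl_adj_cons.
Qed.

Lemma steinitz A s t : indseq A s -> (forall x, x \in s -> acl (adj A t) x) ->
  (size s <= size t)%N.
Proof.
elim: t A s => [|y t IH] A s hs st.
  case: s hs st => [//|x s] /= [nx _] st; case: nx.
  by apply: acl_adj_sub (st x (mem_head _ _)).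
have sp x : x \in s -> acl (adj (adj A [:: y]) t) x.
  move=> /st; apply: acl_mono => z [Az|]; first by left; left.
  by rewrite inE => /orP[zy|zt]; [left; right; rewrite inE | right].
case: (indseq_adj1 y hs) => [hy|[x [s' [ps hy _]]]].
  exact: leq_trans (IH _ _ hy sp) _.
rewrite (perm_size ps) /= ltnS; apply: IH hy _ => z zs; apply: sp.
by rewrite (perm_mem ps) inE zs orbT.
Qed.

Lemma basis_exists A t : exists b, [/\ indseq A b, {subset b <= t} &
  forall x, x \in t -> acl (adj A b) x].
Proof.
elim: t => [|x t [b [hb bt tb]]]; first by exists [::].
case: (pselect (acl (adj A b) x)) => hx.
  exists b; split=> // z; rewrite !inE; first by move=> /bt ->; rewrite orbT.
  by case/orP => [/eqP->|/tb].
exists (x :: b); split=> // z; rewrite !inE.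
  by case/orP => [->|/bt ->]; rewrite ?orbT.
by case/orP => [/eqP->|/tb /(@acl_adj_cons _ _ _ x) //]; apply: acl_adj_self (mem_head _ _).
Qed.

Lemma indseq_exch A s t : indseq A s -> indseq (adj A s) t -> indseq (adj A t) s.
Proof.
move=> hs ht; have pst : perm_eq (t ++ s) (s ++ t) by rewrite perm_catC.
by have /indseq_cat[] := indseq_perm pst ((indseq_cat A t s).2 (conj ht hs)).
Qed.

(** By [steinitz] no member of [t] can be redundant. Independence is carried
    from one set of generators to another in this way. *)
Lemma indseq_span A s t : indseq A s -> (forall x, x \in s -> acl (adj A t) x) ->
  (size t <= size s)%N -> indseq A t.
Proof.
elim: t A s => [//|y t IH] A s hs st le.
have sp x : x \in s -> acl (adj (adj A [:: y]) t) x.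
  move=> /st; apply: acl_mono => z [Az|]; first by left; left.
  by rewrite inE => /orP[zy|zt]; [left; right; rewrite inE | right].
have cy : ~ acl (adj A t) y.
  move=> yt; suff : (size s <= size t)%N by rewrite leqNgt le.
  apply: steinitz hs _ => x /st; apply: acl_trans => z [Az|].
    by apply: acl_in; left.
  by rewrite inE => /orP[/eqP->//|zt]; apply: acl_adj_self.
split=> //.
case: (indseq_adj1 y hs) => [hy|[x [s' [ps hy _]]]].
  have := steinitz hy sp => /(leq_trans le); by rewrite ltnn.
apply: (@indseq_mono _ (adj A [:: y])); first by move=> z Az; apply: acl_in; left.
apply: IH hy _ _ => [z zs|].
  by apply: sp; rewrite (perm_mem ps) inE zs orbT.
by move: le; rewrite (perm_size ps).
Qed.

(** An algebraic relation involves finitely many elements of the base only. *)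
Lemma indseq_finitary A B s :
  (forall t, (forall x, x \in t -> B x) -> indseq (adj A t) s) ->
  indseq (fun x => A x \/ B x) s.
Proof.
elim: s => [//|x s IH] h; split; last first.
  by apply: IH => t /h /= [].
move=> hx.
have : acl (fun z => adj A s z \/ B z) x.
  by apply: acl_mono hx => z [[|]|]; rewrite /adj; tauto.
case/acl_finitary => t tB ht; have /= [nx _] := h t tB; apply: nx.
by apply: acl_mono ht => z [[|]|]; rewrite /adj; tauto.
Qed.

End Independence.

(** * Values of polynomials *)

Section MonEval.
Variables (R : comNzRingType) (J : choiceType).
Implicit Types (g : J -> R) (M : {cmonom J}).

Lemma mon_evalEw g M (d : seq J) : uniq d -> {subset finsupp M <= d} ->
  mon_eval g M = \prod_(v <- d) g v ^+ M v.
Proof.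
move=> ud sd; rewrite /mon_eval [RHS](bigID (fun v => v \in finsupp M)) /=.
rewrite [X in _ * X]big1 ?mulr1; last first.
  by move=> v; rewrite -cmE_eq0 => /eqP->; rewrite expr0.
rewrite -[RHS]big_filter; apply: perm_big; apply: uniq_perm.
- exact: fset_uniq.
- exact: filter_uniq.
by move=> v; rewrite mem_filter; case: (boolP (v \in finsupp M)) => //= /sd.
Qed.

Fact mon_eval_mul g : mmorphism (mon_eval g).
Proof.
split; last by rewrite /mon_eval mdom1 big_seq_fset0.
move=> M N; set d := (finsupp M `|` finsupp N)%fset.
have ud : uniq d by exact: fset_uniq.
rewrite !(@mon_evalEw _ _ d) //.
- by rewrite -big_split; apply: eq_bigr => v _; rewrite cmM exprD.
- by move=> v hv; rewrite in_fsetU hv orbT.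
- by move=> v hv; rewrite in_fsetU hv.
- by move=> v; rewrite mdomD.
Qed.
HB.instance Definition _ g :=
  monalg.isMultiplicative.Build _ _ (mon_eval g) (mon_eval_mul g).

Lemma mon_eval_ext g g' M : (forall v, v \in finsupp M -> g v = g' v) ->
  mon_eval g M = mon_eval g' M.
Proof. by move=> h; apply: eq_big_seq => v /h->. Qed.

Lemma mon_evalU g v : mon_eval g (ucm v) = g v.
Proof. by rewrite /mon_eval mdomU big_seq_fset1 cmUU expr1. Qed.
End MonEval.

Section PolyEval.
Variables (R S : comNzRingType) (J : choiceType) (f : {rmorphism R -> S}).
Implicit Types (g : J -> S) (p : {malg R[{cmonom J}]}).

Lemma mevalD g : {morph mmap f (mon_eval g) : p q / p + q}.
Proof. by move=> p q; rewrite rmorphD. Qed.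
Lemma mevalM g : {morph mmap f (mon_eval g) : p q / p * q}.
Proof. by move=> p q; rewrite rmorphM. Qed.
Lemma mevalC g c : mmap f (mon_eval g) c%:MP = f c.
Proof. by rewrite mmapC. Qed.
Lemma mevalV g v : mmap f (mon_eval g) << ucm v >> = g v.
Proof. by rewrite mmapU /= rmorph1 mul1r mon_evalU. Qed.
End PolyEval.

Lemma mcoeff_sum_formal (R : nzRingType) (M : choiceType) (s : seq M) (c : M -> R) k :
  uniq s -> (\sum_(l <- s) << c l *g l >>)@_k = if k \in s then c k else 0.
Proof.
move=> us; rewrite raddf_sum /=; case: ifPn => ks; last first.
  rewrite big1_seq // => l /andP[_ ls]; rewrite mcoeffU.
  by case: eqP => [e|_]; [rewrite -e ls in ks | rewrite mulr0n].
rewrite (bigD1_seq k) //= big1 ?addr0 ?mcoeffU ?eqxx ?mulr1n // => l lk.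
by rewrite mcoeffU (negPf lk) mulr0n.
Qed.

Lemma mcoeff_sum_vars (R : nzRingType) (J : choiceType) (p : {malg R[{cmonom J}]})
    (X : seq J) M0 : (forall M, M \in msupp p -> {subset finsupp M <= X}) ->
  M0 \in msupp p -> \sum_(M <- msupp p | all (fun v => M v == M0 v) X) p@_M = p@_M0.
Proof.
move=> sX hM0; rewrite big_mkcond (bigD1_seq M0) //= ?fset_uniq //.
have -> : all (fun v => M0 v == M0 v) X by apply/allP => v _ /=.
rewrite big1_seq ?addr0 // => M /andP[MM hM]; case: ifP => // /allP hall.
case/negP: MM; apply/cmP => v; case: (boolP (v \in X)) => [/hall/eqP//|hv].
have := contra (sX _ hM v) hv; have := contra (sX _ hM0 v) hv.
by rewrite -!cmE_eq0 => /eqP-> /eqP->.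
Qed.

Section CoefsIn.
Variables (E : fieldType) (K : E -> Prop) (hK : is_subfield K) (M : conomType).
Implicit Types p q : {malg E[M]}.

Lemma coefs_in_C c : K c -> coefs_in K (c%:MP : {malg E[M]}).
Proof.
by move=> Kc k; rewrite mcoeffC; case: eqP => _ //; rewrite mulr0n; apply: sf0.
Qed.
Lemma coefs_in_U k : coefs_in K (<< k >> : {malg E[M]}).
Proof. by move=> l; rewrite mcoeffU1; apply: sf_nat. Qed.
Lemma coefs_in0 : coefs_in K (0 : {malg E[M]}).
Proof. by move=> k; rewrite mcoeff0; apply: sf0. Qed.
Lemma coefs_in1 : coefs_in K (1 : {malg E[M]}).
Proof. exact: coefs_in_U. Qed.
Lemma coefs_inD p q : coefs_in K p -> coefs_in K q -> coefs_in K (p + q).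
Proof. by move=> hp hq k; rewrite mcoeffD; apply: sfD. Qed.
Lemma coefs_inN p : coefs_in K p -> coefs_in K (- p).
Proof. by move=> hp k; rewrite mcoeffN; apply: sfN. Qed.
Lemma coefs_inM p q : coefs_in K p -> coefs_in K q -> coefs_in K (p * q).
Proof.
move=> hp hq k; rewrite mcoeffMl; apply: sf_sum => // i _; apply: sf_sum => // j _.
case: eqP => _; last by rewrite mulr0n; apply: sf0.
by rewrite mulr1n; apply: (sfM hK).
Qed.
Lemma coefs_in_sum (I : Type) (r : seq I) (P : pred I) (F : I -> {malg E[M]}) :
  (forall i, P i -> coefs_in K (F i)) -> coefs_in K (\sum_(i <- r | P i) F i).
Proof. by move=> h; apply: big_ind => //; [apply: coefs_in0|apply: coefs_inD]. Qed.
Lemma coefs_inX p n : coefs_in K p -> coefs_in K (p ^+ n).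
Proof.
move=> hp; elim: n => [|n IH]; first exact: coefs_in1.
by rewrite exprS; apply: coefs_inM.
Qed.
Lemma coefs_in_prod (I : Type) (r : seq I) (P : pred I) (F : I -> {malg E[M]}) :
  (forall i, P i -> coefs_in K (F i)) -> coefs_in K (\prod_(i <- r | P i) F i).
Proof. by move=> h; apply: big_ind => //; [apply: coefs_in1|apply: coefs_inM]. Qed.
End CoefsIn.

Section Charac0.
Variables (E : fieldType) (charE : [pchar E] =i pred0).

(** This is where characteristic 0 provides the infinitely many elements on
    which a nonzero polynomial cannot vanish. *)
Lemma nat_inj0 : injective (fun n : nat => n%:R : E).
Proof.
have h := (pcharf0P E).1 charE; suff le (a b : nat) : (a <= b)%N -> a%:R = b%:R :> E -> a = b.
  by move=> a b /= e; case/orP: (leq_total a b) => le1; [apply: le | apply/esym/le].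
move=> ab e; apply/eqP; rewrite eqn_leq ab /= -subn_eq0 -h natrB // e subrr //.
Qed.

Lemma poly_nonroot (p : {poly E}) : p != 0 -> exists e, p.[e] != 0.
Proof.
move=> p0; apply: contrapT => hn.
pose s := [seq (n%:R : E) | n <- iota 0 (size p)].
have : (size s < size p)%N.
  apply: max_poly_roots => //.
    apply/allP => x _; apply: contrapT => /negP; rewrite rootE => xn.
    by apply: hn; exists x.
  by rewrite map_inj_uniq ?iota_uniq //; apply: nat_inj0.
by rewrite size_map size_iota ltnn.
Qed.
End Charac0.

(** * Algebraic independence in terms of independent sequences *)

Definition alg_indep (E : fieldType) (K : E -> Prop) (J : choiceType) (g : J -> E) :=
  forall p : {malg E[{cmonom J}]}, coefs_in K p ->
    mmap idfun (mon_eval g) p = 0 -> p = 0.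

Section IndseqSums.
Variables (E : fieldType) (charE : [pchar E] =i pred0).
Variables (J : choiceType).
Implicit Types (K : E -> Prop) (g : J -> E) (X : seq J).

Lemma fgen_id K x : is_subfield K -> fgen K x -> K x.
Proof. by move=> hK; apply: fgen_min. Qed.

(** The polynomial is a formal sum over an index list [ts] with exponents [k].
    In this form the induction on [X] is easy: taking the coefficient of a
    power of the first variable selects a part of the list. *)
Lemma indseq_sum0 K g X : is_subfield K -> indseq K (map g X) ->
  forall (T : Type) (ts : seq T) (c : T -> E) (k : T -> J -> nat) (e : J -> nat),
  (forall t, K (c t)) ->
  \sum_(t <- ts) c t * \prod_(v <- X) g v ^+ k t v = 0 ->
  \sum_(t <- ts | all (fun v => k t v == e v) X) c t = 0.
Proof.
move=> hK; elim: X => [|v X IH] hX T ts c k e hc.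
  by move=> h0; rewrite -[RHS]h0; apply: eq_big => // t _; rewrite big_nil mulr1.
case: hX => nv hX h0.
pose a t := c t * \prod_(w <- X) g w ^+ k t w.
pose q : {poly E} := \sum_(t <- ts) a t *: 'X^(k t v).
have qv : q.[g v] = 0.
  rewrite horner_sum -[RHS]h0; apply: eq_bigr => t _.
  by rewrite hornerZ hornerXn /a big_cons; ring.
have cq i : q`_i = \sum_(t <- ts | k t v == i) a t.
  rewrite coef_sum [RHS]big_mkcond; apply: eq_bigr => t _.
  by rewrite coefZ coefXn eq_sym; case: eqP; rewrite ?mulr1 ?mulr0.
have q0 : q = 0.
  apply: contrapT => /eqP qn; apply: nv; exists q; split=> //; last by rewrite rootE qv.
  move=> i; rewrite cq; apply: (sf_sum (fgen_subfield _)) => t _.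
  apply: fgenM; first by apply: fgen_in; left.
  rewrite big_seq; apply: (sf_prod (fgen_subfield _)) => w wX.
  by apply: (sfX (fgen_subfield _)); apply: fgen_in; right; apply: map_f.
have := cq (e v); rewrite q0 coef0 -big_filter => /esym /(IH hX _ _ _ _ e) h.
by rewrite big_filter_cond in h; exact: h.
Qed.

Lemma alg_indep_of_indseq K g : is_subfield K ->
  (forall X, uniq X -> indseq K (map g X)) -> alg_indep K g.
Proof.
move=> hK hX p hp p0.
pose X := undup (flatten [seq (finsupp M : seq J) | M : {cmonom J} <- msupp p]).
have uX : uniq X by apply: undup_uniq.
have sX M : M \in msupp p -> {subset finsupp M <= X}.
  move=> hM v hv; rewrite mem_undup; apply/flatten_mapP; by exists M.
apply/malgP => M; rewrite mcoeff0.
case: (boolP (M \in msupp p)) => [hM|/mcoeff_outdom//].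
have := @indseq_sum0 K g X hK (hX _ uX) _ (msupp p : seq _) (fun M => p@_M)
  (fun M v => M v) M hp.
case: (pselect (\sum_(N <- msupp p) p@_N * \prod_(v <- X) g v ^+ N v = 0)); last first.
  case; rewrite -[RHS]p0 /mmap; apply: eq_big_seq => N hN; by rewrite (mon_evalEw _ uX (sX _ hN)).
move=> h0 /(_ h0) h.
by rewrite -[RHS]h (mcoeff_sum_vars sX hM).
Qed.

End IndseqSums.

Section AlgIndep.
Variables (E : fieldType) (charE : [pchar E] =i pred0).
Variables (J : choiceType) (K : E -> Prop) (hK : is_subfield K).
Implicit Types (g : J -> E) (X : seq J).

(** Polynomials over [K] are handled through the functions that they define,
    which avoids computing their coefficients. *)
Definition polyfun (f : (J -> E) -> E) :=
  exists2 p : {malg E[{cmonom J}]}, coefs_in K p &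
    forall g, f g = mmap idfun (mon_eval g) p.

Lemma polyfunC c : K c -> polyfun (fun=> c).
Proof.
by move=> Kc; exists c%:MP => [|g]; [apply: coefs_in_C | rewrite mevalC].
Qed.
Lemma polyfunV v : polyfun (fun g => g v).
Proof.
by exists << ucm v >> => [|g]; [apply: coefs_in_U | rewrite mevalV].
Qed.
Lemma polyfunD f1 f2 : polyfun f1 -> polyfun f2 -> polyfun (fun g => f1 g + f2 g).
Proof.
move=> [p hp ep] [q hq eq]; exists (p + q) => [|g]; first exact: coefs_inD.
by rewrite mevalD ep eq.
Qed.
Lemma polyfunM f1 f2 : polyfun f1 -> polyfun f2 -> polyfun (fun g => f1 g * f2 g).
Proof.
move=> [p hp ep] [q hq eq]; exists (p * q) => [|g]; first exact: coefs_inM.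
by rewrite mevalM ep eq.
Qed.
Lemma polyfunN f : polyfun f -> polyfun (fun g => - f g).
Proof.
move=> [p hp ep]; exists (- p) => [|g]; first exact: coefs_inN.
by rewrite rmorphN ep.
Qed.

(** The last clause says that only the variables in [X] matter; it leaves the
    others free to be moved in [indseq_of_alg_indep]. *)
Lemma frac_rep g X x : fgen (adj K (map g X)) x ->
  exists a b, [/\ polyfun a, polyfun b, b g != 0, x = a g / b g &
    forall g', {in X, g' =1 g} -> a g' = a g /\ b g' = b g].
Proof.
pose R z := exists f, [/\ polyfun f, z = f g & forall g', {in X, g' =1 g} -> f g' = f g].
case/(@fgen_fractions _ _ R) => [||||_ [_ [[a [ha -> sa]] [b [hb -> sb]] b0 ->]]].
- by exists (fun=> 1); split=> //; apply: polyfunC (sf1 hK).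
- move=> _ _ [p [hp -> sp]] [q [hq -> sq]]; exists (fun h => p h - q h).
  split=> // [|g' e]; last by rewrite sp // sq.
  by apply: polyfunD; [|apply: polyfunN].
- move=> _ _ [p [hp -> sp]] [q [hq -> sq]]; exists (fun h => p h * q h).
  by split=> // [|g' e]; [apply: polyfunM | rewrite sp // sq].
- move=> z [Kz|/mapP[v vX ->]]; first by exists (fun=> z); split=> //; apply: polyfunC.
  by exists (fun h => h v); split=> // [|g' ->]; first exact: polyfunV.
by exists a, b; split=> // g' e; rewrite sa // sb.
Qed.

Lemma fracs_rep g X (c : nat -> E) n :
  (forall i, fgen (adj K (map g X)) (c i)) ->
  exists (a : nat -> (J -> E) -> E) b,
  [/\ forall i, polyfun (a i), polyfun b, b g != 0,
    forall i, (i < n)%N -> b g * c i = a i g &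
    forall g', {in X, g' =1 g} -> (forall i, a i g' = a i g) /\ b g' = b g].
Proof.
move=> hc; elim: n => [|n [a [b [ha hb bn e s]]]].
  have p1 := polyfunC (sf1 hK).
  by exists (fun _ _ => 1), (fun=> 1); split; rewrite ?oner_eq0.
have [a' [b' [ha' hb' bn' e' s']]] := frac_rep (hc n).
exists (fun i h => if i == n then a' h * b h else a i h * b' h), (fun h => b h * b' h).
split.
- by move=> i; case: eqP => _; apply: polyfunM.
- exact: polyfunM.
- by rewrite mulf_neq0.
- move=> i; rewrite ltnS leq_eqVlt; case: eqP => [->|_] /= hi.
    by rewrite e'; field.
  by rewrite -e // mulrAC.
- move=> g' h; have [h1 h2] := s g' h; have [h3 h4] := s' g' h.
  split=> [i|]; last by rewrite h2 h4.
  by case: eqP => _; rewrite ?h1 ?h2 ?h3 ?h4.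
Qed.

Lemma polyfun_sum (T : Type) (r : seq T) (F : T -> (J -> E) -> E) :
  (forall i, polyfun (F i)) -> polyfun (fun g => \sum_(i <- r) F i g).
Proof.
move=> hF; elim: r => [|i r [p hp ep]].
  have [p hp ep] := polyfunC (sf0 hK).
  by exists p => // g; rewrite big_nil -(ep g).
have [q hq eq] := polyfunD (hF i) (ex_intro2 _ _ p hp ep).
by exists q => // g; rewrite big_cons eq.
Qed.

Lemma polyfunX f n : polyfun f -> polyfun (fun g => f g ^+ n).
Proof.
move=> hf; elim: n => [|n [p hp ep]].
  have [p hp ep] := polyfunC (sf1 hK).
  by exists p => // g; rewrite expr0 -(ep g).
have [q hq eq] := polyfunM hf (ex_intro2 _ _ p hp ep).
by exists q => // g; rewrite exprS eq.
Qed.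

(** A relation of [g v] over the other members gives, without denominators, a
    polynomial [Q] that vanishes at [g], so that [Q] = 0. But [Q] does not
    vanish if the value of [v] is moved to a point that is not a root of the
    relation. *)
Lemma indseq_of_alg_indep g : alg_indep K g ->
  forall X, uniq X -> indseq K (map g X).
Proof.
move=> hg; elim=> [//|v X IH] /= /andP[vX uX]; split; last exact: IH.
case=> p [p0 hp pv].
have [a [b [ha hb bn e s]]] := @fracs_rep g X (fun i => p`_i) (size p) hp.
have [Q hQ eQ] : polyfun (fun h => \sum_(i <- iota 0 (size p)) a i h * h v ^+ i).
  by apply: polyfun_sum => i; apply: polyfunM => //; apply/polyfunX/polyfunV.
pose g' z := fun w => if w == v then z else g w.
have evQ z : mmap idfun (mon_eval (g' z)) Q = b g * p.[z].
  rewrite -eQ horner_coef mulr_sumr -(big_mkord xpredT (fun i => b g * (p`_i * z ^+ i))).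
  rewrite /index_iota subn0; apply: eq_big_seq => i; rewrite mem_iota add0n => /= hi.
  have gg : {in X, g' z =1 g}.
    by move=> w wX; rewrite /g'; case: eqP => // wv; rewrite -wv wX in vX.
  have [h1 h2] := s _ gg.
  by rewrite h1 -e // /g' eqxx mulrA.
have gg : g' (g v) = g by apply/funext => w; rewrite /g'; case: eqP => [->|].
have Q0 : Q = 0.
  by apply: hg => //; have := evQ (g v); rewrite gg (rootP pv) mulr0.
have [z hz] := poly_nonroot charE p0.
have := evQ z; rewrite Q0 rmorph0 => /esym/eqP.
by rewrite mulf_eq0 (negPf bn) (negPf hz).
Qed.

Lemma alg_indepP g : alg_indep K g <-> forall X, uniq X -> indseq K (map g X).
Proof.
by split; [apply: indseq_of_alg_indep | apply: alg_indep_of_indseq].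
Qed.
End AlgIndep.

(** * Specialization along a line *)

Section Specialization.
Variables (E : fieldType) (charE : [pchar E] =i pred0).
Variables (J : choiceType) (K H : E -> Prop).
Hypotheses (hK : is_subfield K) (hH : is_subfield H) (KH : forall x, K x -> H x).

(** A relation over K(y) may be taken with coefficients in K[y]. As [y] is
    transcendental over [H], it is an identity between polynomials in y, and
    its value at y = 0 is a relation between the [l j]. So all coefficients
    vanish at 0; dividing them by y gives a relation of smaller degree. *)
Lemma alg_indep_line (l c : J -> E) (y : E) :
  (forall j, H (l j)) -> (forall j, H (c j)) -> ~ acl H y ->
  alg_indep K l -> alg_indep (fgen (adj K [:: y])) (fun j => l j + y * c j).
Proof.
move=> Hl Hc ny hl.
have key n : forall (s : seq {cmonom J}) (a : {cmonom J} -> {poly E}), uniq s ->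
    (forall k, (size (a k) <= n)%N) -> (forall k i, K (a k)`_i) ->
    \sum_(k <- s) (a k) * mon_eval (fun j => (l j)%:P + 'X * (c j)%:P) k = 0 ->
    forall k, k \in s -> a k = 0.
  elim: n => [|n IH] s a us sa Ka h0 k ks.
    by apply/eqP; rewrite -size_poly_leq0.
  have a0 k' : k' \in s -> (a k').[0] = 0.
    move=> ks'.
    pose P : {malg E[{cmonom J}]} := \sum_(k <- s) << (a k).[0] *g k >>.
    have P0 : P = 0.
      apply: hl.
        move=> u; rewrite mcoeff_sum_formal //; case: ifP => _; last exact: sf0.
        by rewrite horner_coef0.
      rewrite /P rmorph_sum /=.
      transitivity ((\sum_(k <- s) a k *
          mon_eval (fun j => (l j)%:P + 'X * (c j)%:P) k).[0]).
        2: by rewrite h0 horner0.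
      rewrite horner_sum.
      apply: eq_bigr => t _; rewrite mmapU hornerM; congr (_ * _).
      rewrite /mon_eval horner_prod; apply: eq_bigr => v _.
      by rewrite horner_exp !hornerE.
    have : P@_k' = 0 by rewrite P0 mcoeff0.
    by rewrite mcoeff_sum_formal // ks'.
  (* a' k is a k divided by 'X *)
  pose a' k := \poly_(i < n) (a k)`_i.+1.
  have aX k' : k' \in s -> a k' = 'X * a' k'.
    move=> /a0; rewrite horner_coef0 => e; apply/polyP => -[|i].
      by rewrite e coefXM.
    rewrite coefXM /= coef_poly; case: ltnP => // hi.
    by rewrite nth_default // (leq_trans (sa k')) // ltnS.
  rewrite (aX k ks) (IH s a') ?mulr0 // => [k'|k' i|].
  - exact: size_poly.
  - by rewrite coef_poly; case: ifP => // _; apply: sf0.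
  have X0 : ('X : {poly E}) != 0 by rewrite polyX_eq0.
  apply: (mulfI X0); rewrite mulr0 mulr_sumr -[RHS]h0.
  by apply: eq_big_seq => t ts; rewrite mulrA -aX.
move=> p hp p0; apply/malgP => k0; rewrite mcoeff0.
case: (boolP (k0 \in msupp p)) => [hk0|/mcoeff_outdom//].
pose s : seq {cmonom J} := msupp p.
have [a [b [hb bn ha]]] : exists (a : {cmonom J} -> {poly E}) (b : {poly E}),
    [/\ pcoef K b, b.[y] != 0 & forall k, k \in s ->
       pcoef K (a k) /\ (a k).[y] = b.[y] * p@_k].
  elim: (s) => [|k t [a [b [hb bn ha]]]].
    exists (fun=> 0), 1; split=> //; first exact: pcoef1.
    by rewrite hornerE oner_eq0.
  have [a' [b' [ha' hb' bn' e]]] := fgen_frac (hp k).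
  exists (fun u => if u == k then a' * b else a u * b'), (b * b'); split.
  - exact: pcoefM.
  - by rewrite hornerM mulf_neq0.
  move=> u; rewrite inE; case: eqP => [-> _|_ /= /ha[h1 h2]].
    by split; [apply: pcoefM | rewrite e !hornerM; field].
  by split; [apply: pcoefM | rewrite !hornerM h2; ring].
pose a1 k := if k \in s then a k else 0.
have Ka1 k i : K (a1 k)`_i.
  rewrite /a1; case: ifP => [ks|_]; last by rewrite coef0; apply: sf0.
  by apply: (fgen_id hK); have [h _] := ha k ks; apply: h.
pose Q := \sum_(k <- s) (a1 k) * mon_eval (fun j => (l j)%:P + 'X * (c j)%:P) k.
have HM (q r : {poly E}) : (forall i, H q`_i) -> (forall i, H r`_i) ->
    forall i, H (q * r)`_i.
  move=> hq hr i; rewrite coefM; apply: sf_sum => // j _; exact: (sfM hH).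
have HQ i : H Q`_i.
  rewrite coef_sum; apply: sf_sum => // k _; apply: (HM _ _) => {i} i; first exact/KH.
  rewrite /mon_eval; elim/big_ind: _ i => [i|q r hq hr|j _ i].
  - by rewrite coef1; apply: sf_nat.
  - exact: HM.
  elim: (k j) i => [|u IH] i; first by rewrite expr0 coef1; apply: sf_nat.
  rewrite exprS; apply: (HM _ _) => // {}i.
  rewrite coefD coefC coefXM coefC; apply: sfD => //.
    by case: eqP => // _; apply: sf0.
  by case: i => [|[|i]] //=; apply: sf0.
have Q0 : Q = 0.
  apply: contrapT => /eqP Qn; apply: ny; exists Q; split=> //.
    by move=> i; apply: fgen_in.
  rewrite rootE /Q horner_sum; apply/eqP.
  transitivity (b.[y] * mmap idfun (mon_eval (fun j => l j + y * c j)) p).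
    2: by rewrite p0 mulr0.
  rewrite /mmap mulr_sumr; apply: eq_big_seq => k ks; rewrite /a1 ks hornerM.
  have [_ ->] := ha k ks; rewrite -mulrA; congr (_ * (_ * _)).
  rewrite /mon_eval horner_prod; apply: eq_bigr => v _.
  by rewrite horner_exp !hornerE.
have us : uniq s by exact: fset_uniq.
have := key (\max_(k <- s) size (a1 k)) s a1 us _ Ka1 Q0 k0 hk0.
rewrite /a1 hk0 => h; have {}h := h _.
have [_] := ha k0 hk0; rewrite h ?horner0.
  by move/esym/eqP; rewrite mulf_eq0 (negPf bn) => /eqP.
move=> k; case: ifP => ks; last by rewrite size_poly0.
by rewrite (big_rem k) //= ks leq_maxl.
Qed.
End Specialization.

(** * Derivations and algebraic closure *)

Lemma cmonom_ind (J : choiceType) (P : {cmonom J} -> Prop) : P mone ->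
  (forall i th, P th -> P (mmul (ucm i) th)) -> forall th, P th.
Proof.
move=> P1 PU th; elim: (mdeg th) {-2}th (erefl (mdeg th)) => {th} [|d IH] th hd.
  by rewrite (mdeg_eq0I hd).
have [i hi] : exists i, th i != 0%N.
  apply: contrapT => hn; have th1 : th = mone.
    apply/eqP/cmP => i; rewrite cm1; apply/eqP; apply: contrapT => /negP hi.
    by apply: hn; exists i.
  by rewrite th1 mdeg1 in hd.
have e : th = mmul (ucm i) (divcm th (ucm i)).
  apply/eqP/cmP => j; rewrite cmM divcmE cmU subnKC //.
  by case: eqP => // <-; rewrite lt0n.
rewrite e; apply/PU/IH; move: hd; rewrite [in X in X -> _]e mdegM mdegU; lia.
Qed.

Section Derivations.
Variables (m : nat) (E : diffFieldType m).
Implicit Types (x y : E) (i : 'I_m).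

Lemma der0 i : der i (0 : E) = 0.
Proof.
have := derD i (0 : E) 0; rewrite addr0 => /(congr1 (fun z => z - der i 0)).
by rewrite subrr addrK => <-.
Qed.
Lemma derN i x : der i (- x) = - der i x.
Proof. by apply/eqP; rewrite -addr_eq0 -derD addNr der0. Qed.
Lemma derB i x y : der i (x - y) = der i x - der i y.
Proof. by rewrite derD derN. Qed.
Lemma der1 i : der i (1 : E) = 0.
Proof.
have := derM i (1 : E) 1; rewrite !mulr1 mul1r => /(congr1 (fun z => z - der i 1)).
by rewrite subrr addrK => <-.
Qed.
Lemma der_sum i (T : Type) (r : seq T) (P : pred T) (F : T -> E) :
  der i (\sum_(t <- r | P t) F t) = \sum_(t <- r | P t) der i (F t).
Proof. by apply: big_morph; [apply: derD | apply: der0]. Qed.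
Lemma derX i x n : der i (x ^+ n) = n%:R * x ^+ n.-1 * der i x.
Proof.
elim: n => [|n IH]; first by rewrite expr0 der1 !mul0r.
rewrite exprS derM IH /=; case: n {IH} => [|n]; first by rewrite expr0; ring.
by rewrite -[n.+1.-1]/n exprS -[in RHS]natr1; ring.
Qed.
Lemma derV i x : der i x^-1 = - der i x / x ^+ 2.
Proof.
case: (eqVneq x 0) => [->|x0]; first by rewrite invr0 der0 oppr0 mul0r.
have := der1 i; rewrite -[1](mulfV x0) derM => /eqP; rewrite addrC addr_eq0 => /eqP e.
by apply: (mulfI x0); rewrite e; field.
Qed.

Lemma der_iter i j x n : der i (iter n (der j) x) = iter n (der j) (der i x).
Proof. by elim: n => //= n IH; rewrite derC IH. Qed.

Implicit Types (th : {cmonom 'I_m}).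

(** [dapp] applies the derivations in a fixed order; moving [der i] to the
    front uses that they commute. *)
Lemma dappU i th x : dapp (mmul (ucm i) th) x = der i (dapp th x).
Proof.
rewrite /dapp; have := mem_enum 'I_m i; rewrite inE.
elim: (enum 'I_m) (enum_uniq 'I_m) => [//|j s IH] /= /andP[js us].
rewrite inE cmM cmU; case: (eqVneq i j) => [ij|ij] /= is1.
  rewrite ij add0n; congr (der j _); congr (iter _ _ _).
  elim: (s) js => [//|k r IHr]; rewrite inE negb_or => /andP[jk jr] /=.
  by rewrite IHr // cmM cmU (negPf jk).
by rewrite add0n der_iter IH.
Qed.

Lemma dapp1 x : dapp mone x = x.
Proof.
by rewrite /dapp; elim: (enum 'I_m) => //= j s ->; rewrite cm1.
Qed.

Lemma dapp_ucm i x : dapp (ucm i) x = der i x.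
Proof. by rewrite -[ucm i]mulm1 dappU dapp1. Qed.

Lemma dappM th1 th2 x : dapp (mmul th1 th2) x = dapp th1 (dapp th2 x).
Proof.
elim/cmonom_ind: th1 => [|i th IH]; first by rewrite mul1m dapp1.
by rewrite -mulmA !dappU IH.
Qed.

Lemma dappN th x : dapp th (- x) = - dapp th x.
Proof. by elim/cmonom_ind: th => [|i th IH]; rewrite ?dapp1 ?dappU // IH derN. Qed.
Lemma dappD th x y : dapp th (x + y) = dapp th x + dapp th y.
Proof. by elim/cmonom_ind: th => [|i th IH]; rewrite ?dapp1 ?dappU // IH derD. Qed.

Definition dclosed (A : E -> Prop) := forall i x, A x -> A (der i x).

Lemma dapp_closed A : dclosed A -> forall th x, A x -> A (dapp th x).
Proof.
move=> hA th x Ax; elim/cmonom_ind: th => [|i th IH]; rewrite ?dapp1 ?dappU //.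
exact: hA.
Qed.

Definition derivs (S : E -> Prop) : E -> Prop :=
  fun x => exists th y, S y /\ x = dapp th y.

Lemma derivs_dclosed S : dclosed (derivs S).
Proof.
by move=> i x [th [y [Sy ->]]]; exists (mmul (ucm i) th), y; rewrite dappU.
Qed.
Lemma derivs_in (S : E -> Prop) x : S x -> derivs S x.
Proof. by move=> Sx; exists mone, x; rewrite dapp1. Qed.

Lemma dclosedU A B : dclosed A -> dclosed B -> dclosed (fun x => A x \/ B x).
Proof. by move=> hA hB i x [/hA|/hB]; [left|right]. Qed.

Lemma fgen_der A B i : (forall x, A x -> fgen B x) ->
  (forall x, A x -> fgen B (der i x)) -> forall x, fgen A x -> fgen B (der i x).
Proof.
move=> AB AdB; have hB := fgen_subfield B.
have AB' := fgen_sub AB.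
move=> x; elim=> {x} [x /AdB //||x y hx ix hy iy|x y hx ix hy iy|x hx ix].
- by rewrite der1; exact: (sf0 hB).
- by rewrite derB; apply: fgenB.
- by rewrite derM; apply: (sfD hB); apply: fgenM => //; exact: AB'.
- by rewrite derV; apply: fgenM; [exact: (sfN hB)|apply/fgenV/(sfX hB); exact: AB'].
Qed.

(** A derivation raises the order in the generators, counted by the index of
    [Q], by at most one, whatever rational expression it is applied to. *)
Lemma fgen_dapp (Q : nat -> E -> Prop) : (forall k y, Q k y -> Q k.+1 y) ->
  (forall k i y, Q k y -> Q k.+1 (der i y)) ->
  forall k th x, fgen (Q k) x -> fgen (Q (mdeg th + k)%N) (dapp th x).
Proof.
move=> Qs Qd k th x hx; elim/cmonom_ind: th => [|i th IH].
  by rewrite mdeg1 add0n dapp1.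
rewrite dappU mdegM mdegU; apply: fgen_der IH => y hy; apply: fgen_in.
  exact: Qs.
exact: Qd.
Qed.

Lemma fgen_dclosed A : dclosed A -> dclosed (fgen A).
Proof. by move=> hA i x; apply: fgen_der => y Ay; apply: fgen_in => //; apply: hA. Qed.

Lemma delta_subfield_sf K : delta_subfield K -> is_subfield (K : E -> Prop).
Proof. by case. Qed.

Lemma delta_subfieldP K :
  delta_subfield K <-> is_subfield (K : E -> Prop) /\ dclosed K.
Proof. by split=> [[]//|[[? ? ? ?] ?]]; split. Qed.

(** The rules for sums, products and inverses show that the field generated by
    a set closed under derivation is itself closed under derivation. *)
Lemma delta_adjoinE (K S : E -> Prop) x : dclosed K ->
  delta_adjoin K S x <-> fgen (fun y => K y \/ derivs S y) x.
Proof.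
move=> hK; split.
  apply; first (apply/delta_subfieldP; split; first exact: fgen_subfield).
  - exact/fgen_dclosed/dclosedU/derivs_dclosed.
  - by move=> y Ky; apply: fgen_in; left.
  - by move=> y Sy; apply: fgen_in; right; apply: derivs_in.
move=> hx L /delta_subfieldP[sL dL] KL SL; apply: fgen_min hx => // y [/KL//|].
by case=> th [z [/SL Lz ->]]; apply: dapp_closed.
Qed.

Lemma delta_adjoin_subfield (K S : E -> Prop) : delta_subfield (delta_adjoin K S).
Proof.
split.
- by move=> L hL _ _; apply: dsub1 hL.
- by move=> x y hx hy L hL KL SL; apply: (dsubB hL); [apply: hx|apply: hy].
- by move=> x y hx hy L hL KL SL; apply: (dsubM hL); [apply: hx|apply: hy].
- by move=> x hx L hL KL SL; apply: (dsubV hL); apply: hx.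
- by move=> i x hx L hL KL SL; apply: (dsub_der hL); apply: hx.
Qed.

Lemma delta_adjoin_in (K S : E -> Prop) x :
  K x -> delta_adjoin K S x.
Proof. by move=> Kx L _ KL _; apply: KL. Qed.

Lemma delta_adjoin_gen (K S : E -> Prop) x :
  S x -> delta_adjoin K S x.
Proof. by move=> Sx L _ _; apply. Qed.

Section AclDer.
Hypothesis charE : [pchar E] =i pred0.

Lemma der_horner i (p : {poly E}) x : der i p.[x] =
  (\poly_(j < size p) der i p`_j).[x] + (p^`()).[x] * der i x.
Proof.
rewrite horner_poly horner_coef der_sum.
transitivity (\sum_(j < size p) (der i p`_j * x ^+ j +
    (p`_j *+ j * x ^+ j.-1) * der i x)).
  by apply: eq_bigr => j _; rewrite derM derX; ring.
rewrite big_split -mulr_suml /=; congr (_ + _ * _).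
rewrite /deriv horner_poly; case: (size p) => [|n]; first by rewrite !big_ord0.
by rewrite big_ord_recl /= mulr0n mul0r add0r.
Qed.

(** In characteristic 0 a polynomial of least degree that vanishes at [x] has
    a derivative that does not. *)
Lemma acl_sep A x : acl A x -> exists p : {poly E},
  [/\ pcoef A p, p.[x] = 0 & (p^`()).[x] != 0].
Proof.
case=> p [p0 hp px].
elim: (size p) {-2}p (leqnn (size p)) p0 hp px => {p} [|n IH] p.
  by rewrite leqn0 size_poly_eq0 => /eqP->; rewrite eqxx.
move=> sp p0 hp px; case: (eqVneq (p^`()).[x] 0) => [dx|dn]; last first.
  by exists p; split=> //; apply/rootP.
have hA := fgen_subfield A.
apply: (IH p^`()).
- by rewrite -ltnS; apply: leq_trans sp; apply: lt_size_deriv.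
- apply: contraL px => /eqP dp.
  have /size1_polyC e : (size p <= 1)%N.
    rewrite leqNgt; apply/negP => sp1; have : (p^`())`_(size p).-2 = 0 by rewrite dp coef0.
    rewrite coef_deriv => /eqP; rewrite -mulr_natr mulf_eq0.
    have -> : (size p).-2.+1 = (size p).-1 by case: (size p) sp1 => [|[]].
    rewrite -/(lead_coef p) lead_coef_eq0 (negPf p0) /= ((pcharf0P E).1 charE).
    by case: (size p) sp1 => [|[]].
  by rewrite e rootC; apply: contraNneq p0 => c0; rewrite e c0.
- by move=> j; rewrite coef_deriv -mulr_natr; apply: fgenM => //; apply: sf_nat.
- exact/rootP.
Qed.

(** Deriving p(x) = 0 gives p'(x) x' = - q(x), where q has the derivatives of
    the coefficients of p as coefficients, and [acl_sep] allows the division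
    by p'(x). *)
Lemma acl_der A B i x : (forall y, A y -> acl B y) ->
  (forall y, A y -> acl B (der i y)) -> acl A x -> acl B (der i x).
Proof.
move=> AB AdB hx; have hB := acl_subfield B.
have Bx := acl_trans AB hx.
have [p [hp px dn]] := acl_sep hx.
have FA y : fgen A y -> acl B y by apply: fgen_min hB AB _.
have FdA y : fgen A y -> acl B (der i y).
  elim=> {y} [y /AdB //||y z hy iy hz iz|y z hy iy hz iz|y hy iy].
  - by rewrite der1; exact: (sf0 hB).
  - by rewrite derB; apply: (sfB hB).
  - by rewrite derM; apply: (sfD hB); apply: (sfM hB) => //; exact: FA.
  - rewrite derV; apply: (sfM hB); first exact: (sfN hB).
    by apply/(sfV hB)/(sfX hB); exact: FA.
have := der_horner i p x; rewrite px der0 => /esym/eqP.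
rewrite addrC addr_eq0 => /eqP e.
have -> : der i x = - (\poly_(j < size p) der i p`_j).[x] / (p^`()).[x].
  by rewrite -e mulrAC mulfV ?mul1r.
apply: (sfM hB).
  apply: (sfN hB); apply: (sf_horner hB) => // j; rewrite coef_poly.
  by case: ifP => _; [exact/FdA/hp | exact: (sf0 hB)].
apply: (sfV hB); apply: (sf_horner hB) => // j; rewrite coef_deriv -mulr_natr.
by apply: (sfM hB); [exact/FA/hp | exact: (sf_nat hB)].
Qed.
End AclDer.
End Derivations.

(** * The number of derivatives of bounded order *)

Section Counting.
Variable m : nat.
Implicit Types (th : {cmonom 'I_m}).

Lemma mdeg_sum th : mdeg th = (\sum_(i < m) th i)%N.
Proof.
elim/cmonom_ind: th => [|i th IH].
  by rewrite mdeg1 big1 // => i _; rewrite cm1.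
rewrite mdegM mdegU IH; under [RHS]eq_bigr => j _ do rewrite cmM cmU.
rewrite big_split /=; congr (_ + _)%N.
by rewrite (bigD1 i) //= eqxx big1 // => j /negPf; rewrite eq_sym => ->.
Qed.

Definition cm_of (f : 'I_m -> nat) : {cmonom 'I_m} :=
  mkcmonom [fsfun i in seq_fset tt (enum 'I_m) => f i].

Lemma cm_ofE f i : cm_of f i = f i.
Proof. by rewrite cmE fsfun_fun seq_fsetE mem_enum inE. Qed.

Definition monos t : seq {cmonom 'I_m} :=
  [seq cm_of (fun i => tnth tp i) | tp : m.-tuple 'I_t.+1 <-
     enum [set tp : m.-tuple 'I_t.+1 | (\sum_(i <- tp) i <= t)%N]].

Lemma monos_uniq t : uniq (monos t).
Proof.
rewrite map_inj_uniq ?enum_uniq // => tp1 tp2 /eqP/cmP h.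
by apply: eq_from_tnth => i; apply: val_inj; have := h i; rewrite !cm_ofE.
Qed.

Lemma mem_monos t th : (th \in monos t) = (mdeg th <= t)%N.
Proof.
apply/mapP/idP => [[tp]|ht].
  rewrite mem_enum inE => hs ->; rewrite mdeg_sum.
  by under eq_bigr => i _ do rewrite cm_ofE; rewrite -(big_tuple _ _ tp xpredT).
have hi i : (th i < t.+1)%N.
  by rewrite ltnS; apply: leq_trans ht; rewrite mdeg_sum (bigD1 i) //= leq_addr.
exists [tuple Ordinal (hi i) | i < m]; last first.
  by apply/eqP/cmP => i; rewrite cm_ofE tnth_mktuple.
rewrite mem_enum inE big_tuple; under eq_bigr => i _ do rewrite tnth_mktuple.
by rewrite -mdeg_sum.
Qed.

Definition nmono t := 'C(t + m, m).

Lemma size_monos t : size (monos t) = nmono t.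
Proof. by rewrite size_map -cardE card_partial_ord_partitions addnC. Qed.

Lemma nmono_le t t' : (t <= t')%N -> (nmono t <= nmono t')%N.
Proof. by move=> tt'; apply: leq_bin2l; rewrite leq_add2r. Qed.

End Counting.

Section Growth.

Lemma bin_double t r : ('C(t.*2 + r, r) <= 2 ^ r * 'C(t + r, r))%N.
Proof.
elim: r => [|r IH]; first by rewrite !bin0.
rewrite -(leq_pmul2l (ltn0Sn r)) -mul_bin_diag.
rewrite [X in (_ <= X)%N]mulnCA -mul_bin_diag !addnS -!pred_Sn expnS.
apply: (@leq_trans ((t + r).+1.*2 * (2 ^ r * 'C(t + r, r)))); last by rewrite -mul2n; lia.
apply: leq_mul => //; lia.
Qed.

Lemma nmono_diff r t h :
  (nmono r.+1 (t + h) - nmono r.+1 t <= h * 'C(t + h + r, r))%N.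
Proof.
elim: h => [|h IH]; first by rewrite addn0 subnn.
have e : nmono r.+1 (t + h.+1) = (nmono r.+1 (t + h) + 'C(t + h.+1 + r, r))%N.
  rewrite /nmono; have -> : (t + h.+1 + r.+1 = (t + h + r.+1).+1)%N by lia.
  by rewrite binS; have -> : (t + h + r.+1 = t + h.+1 + r)%N by lia.
have le : ('C(t + h + r, r) <= 'C(t + h.+1 + r, r))%N by apply: leq_bin2l; lia.
have : (h * 'C(t + h + r, r) <= h * 'C(t + h.+1 + r, r))%N by apply: leq_mul.
move: IH; rewrite e mulSn; set a := nmono _ _; set b := nmono _ _.
by set c := 'C(_, _); set d := 'C(_, _); lia.
Qed.

(** [nmono m] is a polynomial of degree [m] in t, so that its differences have
    lower degree. *)
Lemma nmono_growth m c h : (0 < m)%N ->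
  exists t0, forall t, (t0 <= t)%N ->
    (c * (nmono m (t + h) - nmono m t) < nmono m t)%N.
Proof.
case: m => [//|r] _; exists (h + r.+1 * (c * h * 2 ^ r))%N => t ht.
have le1 : ('C(t + h + r, r) <= 2 ^ r * 'C(t + r, r))%N.
  apply: leq_trans (bin_double t r); apply: leq_bin2l; rewrite -mul2n; lia.
have le2 := nmono_diff r t h.
have b0 : (0 < 'C(t + r, r))%N by rewrite bin_gt0 leq_addl.
have e : (r.+1 * nmono r.+1 t = (t + r).+1 * 'C(t + r, r))%N.
  by rewrite /nmono -mul_bin_diag addnS -pred_Sn.
rewrite -(ltn_pmul2l (ltn0Sn r)) e.
apply: (@leq_ltn_trans (r.+1 * (c * (h * (2 ^ r * 'C(t + r, r)))))).
  apply: leq_mul => //; apply: leq_mul => //; apply: leq_trans le2 _.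
  exact: leq_mul.
have -> : (r.+1 * (c * (h * (2 ^ r * 'C(t + r, r)))) =
   (r.+1 * (c * h * 2 ^ r)) * 'C(t + r, r))%N by rewrite !mulnA.
rewrite ltn_pmul2r //; lia.
Qed.
End Growth.

(** * An orderly ranking of the derivatives *)

Section Ranking.
Variables (m : nat) (J : finType).
Implicit Types (a b c : {cmonom 'I_m}) (v w : {cmonom 'I_m} * J).

Definition lexlt a b : bool :=
  [exists i : 'I_m, (a i < b i)%N && [forall k : 'I_m, (k < i)%N ==> (a k == b k)]].

Lemma lexltP a b :
  reflect (exists2 i : 'I_m, (a i < b i)%N & forall k : 'I_m, (k < i)%N -> a k = b k)
    (lexlt a b).
Proof.
apply: (iffP existsP) => [[i /andP[h1 /forallP h2]]|[i h1 h2]]; exists i => //.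
  by move=> k ki; apply/eqP; apply: (implyP (h2 k)).
by rewrite h1; apply/forallP => k; apply/implyP => /h2 ->.
Qed.

Lemma lexlt_irr a : lexlt a a = false.
Proof. by apply/lexltP => -[i]; rewrite ltnn. Qed.

Lemma lexlt_trans : transitive lexlt.
Proof.
move=> b a c /lexltP[i ai hi] /lexltP[j bj hj]; apply/lexltP.
case: (ltngtP i j) => ij.
- exists i => [|k ki]; first by rewrite -(hj _ ij).
  by rewrite (hi _ ki) (hj _ (ltn_trans ki ij)).
- exists j => [|k kj]; first by rewrite (hi _ ij).
  by rewrite (hi _ (ltn_trans kj ij)) (hj _ kj).
- have {}ij : i = j by apply: val_inj.
  by subst j; exists i => [|k ki]; [apply: ltn_trans bj | rewrite hi // hj].
Qed.

Lemma lexlt_total a b : a != b -> lexlt a b || lexlt b a.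
Proof.
move=> ab; have [i0 hi0] : exists i, a i != b i.
  apply: contrapT => h; case/negP: ab; apply/cmP => i; apply/eqP.
  by apply: contrapT => /negP n; apply: h; exists i.
have [i hi mini] := @arg_minnP _ i0 (fun i => a i != b i) (fun i : 'I_m => i : nat) hi0.
have eqk (k : 'I_m) : (k < i)%N -> a k = b k.
  move=> ki; apply/eqP; apply: contrapT => /negP /mini; rewrite leqNgt ki //.
move: hi; rewrite neq_ltn => /orP[h|h]; apply/orP; [left|right]; apply/lexltP;
  by exists i => // k /eqk.
Qed.

Lemma lexltM c a b : lexlt (mmul c a) (mmul c b) = lexlt a b.
Proof.
apply/lexltP/lexltP => -[i]; rewrite ?cmM => h1 h2; exists i; rewrite ?cmM.
- by move: h1; rewrite ltn_add2l.
- by move=> k /h2; rewrite !cmM => /addnI.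
- by rewrite ltn_add2l.
- by move=> k /h2; rewrite !cmM => ->.
Qed.

(** An orderly ranking in the sense of Ritt and Kolchin: compatible with the
    derivations, and with finitely many derivatives below any given one. *)
Definition vlt v w : bool :=
  (mdeg v.1 < mdeg w.1)%N || (mdeg v.1 == mdeg w.1) &&
    (lexlt v.1 w.1 || (v.1 == w.1) && (enum_rank v.2 < enum_rank w.2)%N).

Definition shift c v := (mmul c v.1, v.2).

Lemma vlt_irr v : vlt v v = false.
Proof. by rewrite /vlt ltnn eqxx lexlt_irr eqxx ltnn. Qed.

Lemma vlt_deg v w : (mdeg v.1 < mdeg w.1)%N -> vlt v w.
Proof. by rewrite /vlt => ->. Qed.

Lemma vlt_le v w : vlt v w -> (mdeg v.1 <= mdeg w.1)%N.
Proof. by case/orP => [/ltnW//|/andP[/eqP->]]. Qed.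

Lemma vlt_trans : transitive vlt.
Proof.
move=> v u w; rewrite /vlt => /orP[h1|/andP[/eqP e1 h1]] /orP[h2|/andP[/eqP e2 h2]].
- by rewrite (ltn_trans h1 h2).
- by rewrite -e2 h1.
- by rewrite e1 h2.
- rewrite e1 e2 eqxx ltnn /=.
  case/orP: h1 => [h1|/andP[/eqP f1 h1]]; case/orP: h2 => [h2|/andP[/eqP f2 h2]].
  + by rewrite (lexlt_trans h1 h2).
  + by rewrite -f2 h1.
  + by rewrite f1 h2.
  + by rewrite f1 f2 eqxx (ltn_trans h1 h2) orbT.
Qed.

Lemma vlt_total v w : v != w -> vlt v w || vlt w v.
Proof.
rewrite /vlt => vw; case: (ltngtP (mdeg v.1) (mdeg w.1)) => //= _.
case: (eqVneq v.1 w.1) => [e1|/lexlt_total/orP[->|->]]; rewrite ?orbT //.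
have n2 : v.2 != w.2.
  by apply: contraNneq vw => e2; rewrite [v]surjective_pairing e1 e2 -surjective_pairing.
have : enum_rank v.2 != enum_rank w.2 :> nat.
  by apply: contraNneq n2 => /val_inj/enum_rank_inj ->.
by rewrite neq_ltn e1 ?eqxx /= => /orP[->|->]; rewrite ?orbT.
Qed.

Lemma vlt_shift c v w : vlt (shift c v) (shift c w) = vlt v w.
Proof.
rewrite /vlt /= !mdegM ltn_add2l eqn_add2l lexltM.
suff -> : (mmul c v.1 == mmul c w.1) = (v.1 == w.1) by [].
apply/cmP/eqP => [h|->//]; apply/eqP/cmP => i.
by have := h i; rewrite !cmM => /addnI.
Qed.

Lemma vlt_shiftU i v : vlt v (shift (ucm i) v).
Proof. by apply: vlt_deg; rewrite /= mdegM mdegU. Qed.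

Definition allv t : seq ({cmonom 'I_m} * J) := [seq (th, j) | th <- monos m t, j <- enum J].

Lemma mem_allv t v : (v \in allv t) = (mdeg v.1 <= t)%N.
Proof.
rewrite -mem_monos; apply/allpairsP/idP => [[[th j] [h1 _ ->]] //|h].
by exists v; rewrite h mem_enum -surjective_pairing.
Qed.

Lemma allv_uniq t : uniq (allv t).
Proof. by apply: allpairs_uniq; [apply: monos_uniq | apply: enum_uniq | case=> ? ? []]. Qed.

Lemma size_allv t : size (allv t) = (nmono m t * #|J|)%N.
Proof. by rewrite size_allpairs size_monos -cardE. Qed.

(** The number [mu v] of derivatives below [v] is finite and increases with
    [v]. *)
Lemma vlt_ind (P : {cmonom 'I_m} * J -> Prop) :
  (forall v, (forall w, vlt w v -> P w) -> P v) -> forall v, P v.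
Proof.
move=> H v; pose mu v := size [seq w <- allv (mdeg v.1) | vlt w v].
have dec w u : vlt w u -> (mu w < mu u)%N.
  move=> wu; apply: (@uniq_leq_size _ (w :: [seq x <- allv (mdeg w.1) | vlt x w])).
    by rewrite /= mem_filter vlt_irr filter_uniq ?allv_uniq.
  move=> x; rewrite inE mem_filter !mem_filter !mem_allv.
  case/orP => [/eqP->|/andP[xw hx]]; first by rewrite wu vlt_le.
  by rewrite (vlt_trans xw wu) (leq_trans hx) ?vlt_le.
have [n] := ubnP (mu v); elim: n v => // n IH v; rewrite ltnS => hv.
by apply: H => w /dec wv; apply: IH; apply: leq_trans wv hv.
Qed.

Lemma vlt_max (X : seq ({cmonom 'I_m} * J)) : X != [::] ->
  exists2 v, v \in X & forall w, w \in X -> w != v -> vlt w v.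
Proof.
elim: X => [//|x X IH] _; case: (eqVneq X [::]) => [->|/IH[v vX hv]].
  by exists x => [|w]; rewrite inE // => ->.
case: (eqVneq x v) => [xv|/vlt_total/orP[lt|lt]].
- exists v => [|w]; rewrite inE ?vX ?orbT //.
  by case/orP => [/eqP->|/hv//]; rewrite xv eqxx.
- exists v => [|w]; rewrite inE ?vX ?orbT //.
  by case/orP => [/eqP->|/hv//].
- exists x => [|w]; rewrite inE ?eqxx //.
  case/orP => [/eqP->|wX wx]; first by rewrite eqxx.
  by case: (eqVneq w v) => [->//|/(hv _ wX)/vlt_trans]; apply.
Qed.

Variable E : fieldType.

(** The member of highest rank is split off first, all others being lower. *)
Lemma indseq_vlt (A : E -> Prop) (h : {cmonom 'I_m} * J -> E) X : uniq X ->
  (forall v, v \in X ->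
     ~ acl (fun x => A x \/ exists w, [/\ w \in X, vlt w v & x = h w]) (h v)) ->
  indseq A (map h X).
Proof.
have [n] := ubnP (size X); elim: n X => // n IH X; rewrite ltnS => sX uX hX.
case: (eqVneq X [::]) => [->//|/vlt_max[v vX hv]].
have pX := perm_to_rem vX.
apply: (@indseq_perm _ _ (map h (v :: rem v X))).
  by apply: perm_map; rewrite perm_sym.
have memr w : w \in rem v X -> w \in X by apply: mem_rem.
split.
  move=> hd; apply: (hX v vX); apply: acl_mono hd => x [Ax|/mapP[w wr ->]].
    by left.
  right; exists w; split=> //; first exact: memr.
  by apply: hv; [exact: memr | move: wr; rewrite mem_rem_uniq // inE => /andP[]].
apply: IH; first by rewrite size_rem //; case: (X) vX sX => //= ? ? _; rewrite ltnS.
  exact: rem_uniq.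
move=> w wr hd; apply: (hX w (memr w wr)); apply: acl_mono hd => x [Ax|[u [ur uw ->]]].
  by left.
by right; exists u; split=> //; apply: memr.
Qed.
End Ranking.

(** * Basic derivatives and full columns *)

Section GreedyBasis.
Variables (m : nat) (E : diffFieldType m) (charE : [pchar E] =i pred0).
Variables (J : finType) (A : E -> Prop) (hA : dclosed A) (eta : J -> E).
Implicit Types (v w : {cmonom 'I_m} * J).

Definition dv v : E := dapp v.1 (eta v.2).

Lemma dv_shift c v : dv (shift c v) = dapp c (dv v).
Proof. by rewrite /dv dappM. Qed.

Definition low v : E -> Prop := fun x => A x \/ exists w, vlt w v /\ x = dv w.

(** The basic derivatives are those that a greedy algorithm keeps when it runs
    through all derivatives by increasing rank. *)
Definition basic v := ~ acl (low v) (dv v).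

(** Derivations respect the ranking and raise the rank, so a derived relation
    over lower derivatives is again a relation over lower derivatives. *)
Lemma nbasic_shift c v : ~ basic v -> ~ basic (shift c v).
Proof.
move=> /contrapT h; elim/cmonom_ind: c => [|i c IH].
  by rewrite /shift mul1m -surjective_pairing => /(_ h).
have -> : shift (mmul (ucm i) c) v = shift (ucm i) (shift c v).
  by rewrite /shift /= mulmA.
move: IH => /contrapT hc; apply; rewrite dv_shift dapp_ucm.
apply: (acl_der charE _ _ hc) => y [Ay|[w [wv ->]]].
- by apply: acl_in; left.
- by apply: acl_in; right; exists w; split; first exact: (vlt_trans wv (vlt_shiftU _ _)).
- by apply: acl_in; left; apply: hA.
- apply: acl_in; right; exists (shift (ucm i) w); split; first by rewrite vlt_shift.
  by rewrite dv_shift dapp_ucm.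
Qed.

Lemma basic_span v :
  acl (fun x => A x \/ exists w, [/\ basic w, (mdeg w.1 <= mdeg v.1)%N & x = dv w]) (dv v).
Proof.
elim/vlt_ind: v => v IH; case: (pselect (basic v)) => [bv|/contrapT nv].
  by apply: acl_in; right; exists v.
apply: acl_trans nv => x [Ax|[w [wv ->]]]; first by apply: acl_in; left.
apply: acl_mono (IH w wv) => y [Ay|[u [bu uw ->]]]; first by left.
by right; exists u; split=> //; apply: leq_trans uw (vlt_le wv).
Qed.

Definition basics t := [seq v <- allv m J t | `[< basic v >]].

Lemma mem_basics t v : v \in basics t <-> basic v /\ (mdeg v.1 <= t)%N.
Proof.
rewrite mem_filter mem_allv; split; first by case/andP => /asboolP.
by case=> h ->; rewrite andbT; apply/asboolP.
Qed.

Lemma basics_uniq t : uniq (basics t).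
Proof. by rewrite filter_uniq ?allv_uniq. Qed.

Lemma basic_indseq X : uniq X -> (forall v, v \in X -> basic v) -> indseq A (map dv X).
Proof.
move=> uX bX; apply: indseq_vlt => // v vX hd; apply: (bX v vX).
apply: acl_mono hd => x [Ax|[w [_ wv ->]]]; [by left | by right; exists w].
Qed.

Lemma basics_indseq t : indseq A (map dv (basics t)).
Proof. by apply: basic_indseq (basics_uniq t) _ => v /mem_basics[]. Qed.

Lemma basics_span t v : (mdeg v.1 <= t)%N -> acl (adj A (map dv (basics t))) (dv v).
Proof.
move=> vt; apply: acl_mono (basic_span v) => x [Ax|[w [bw wv ->]]]; first by left.
by right; apply: map_f; apply/mem_basics; split=> //; apply: leq_trans vt.
Qed.

(** The coordinates with full columns form a Delta-transcendence basis of the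
    field generated by [eta] over [A]. *)
Definition full j := forall th, basic (th, j).
Definition cols : {set J} := [set j | `[< full j >]].

Lemma colsP j : j \in cols <-> full j.
Proof. by rewrite inE; split=> /asboolP. Qed.

Lemma cols_indseq X : uniq X -> (forall v, v \in X -> v.2 \in cols) ->
  indseq A (map dv X).
Proof.
move=> uX hX; apply: basic_indseq uX _ => v /hX /colsP.
by rewrite [X in _ -> basic X]surjective_pairing; apply.
Qed.

Let colcount j t := count (fun th => `[< basic (th, j) >]) (monos m t).

Let size_basics t : size (basics t) = (\sum_(j : J) colcount j t)%N.
Proof.
rewrite size_filter /allv count_flatten sumnE big_map big_map.
under eq_bigr => th _ do rewrite count_map -sum1_count big_enum_cond /=.
rewrite (exchange_big_dep xpredT) //=; apply: eq_bigr => j _.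
by rewrite /colcount -sum1_count.
Qed.

Let colcount_le j t : (colcount j t <= nmono m t)%N.
Proof. by rewrite -size_monos count_size. Qed.

Let colcount_full j t : full j -> colcount j t = nmono m t.
Proof.
move=> fj; rewrite -size_monos; apply/eqP; rewrite -all_count.
by apply/allP => th _ /=; apply/asboolP.
Qed.

(** If (c, j) is not basic, then none of the derivatives (c th, j) is, and
    there are [nmono m t] of them of order at most [t + mdeg c]. *)
Let colcount_nfull j : ~ full j -> exists e, forall t,
  (colcount j (t + e) <= nmono m (t + e) - nmono m t)%N.
Proof.
move=> nf; have [c nc] : exists c, ~ basic (c, j).
  by apply: contrapT => h; apply: nf => c; apply: contrapT => n; apply: h; exists c.
exists (mdeg c) => t; rewrite leq_subRL; last by apply: nmono_le; lia.
rewrite -(size_monos m (t + mdeg c)).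
rewrite -(count_predC (fun th => `[< basic (th, j) >]) (monos m (t + mdeg c))).
rewrite addnC leq_add2l -size_filter -(size_monos m t) -(size_map (mmul c)).
apply: uniq_leq_size.
  rewrite map_inj_uniq ?monos_uniq // => x y /eqP/cmP h; apply/eqP/cmP => i.
  by have := h i; rewrite !cmM => /addnI.
move=> x /mapP[th]; rewrite mem_monos => hth ->.
rewrite mem_filter mem_monos mdegM /= addnC leq_add2r hth andbT.
apply/negP => /asboolP; have := @nbasic_shift th _ nc.
by rewrite /shift /= mulmC.
Qed.

Lemma size_basics_ge t : (#|cols| * nmono m t <= size (basics t))%N.
Proof.
rewrite size_basics -sum_nat_const [X in (_ <= X)%N](bigID (mem cols)) /=.
apply: leq_trans (leq_addr _ _); apply: leq_sum => j /colsP fj.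
by rewrite colcount_full.
Qed.

Lemma size_basics_le : exists e, forall t,
  (size (basics (t + e)) <= #|cols| * nmono m (t + e) +
     #|J| * (nmono m (t + e) - nmono m t))%N.
Proof.
have he j : exists e, j \notin cols -> forall t,
    (colcount j (t + e) <= nmono m (t + e) - nmono m t)%N.
  case: (boolP (j \in cols)) => [_|hj]; first by exists 0%N.
  by have [|e he] := @colcount_nfull j; [move/colsP; apply/negP | exists e].
have [e {}he] := choice he; exists (\max_j e j)%N => t.
rewrite size_basics [X in (X <= _)%N](bigID (mem cols)) /=; apply: leq_add.
  by rewrite -sum_nat_const; apply: leq_sum => j _; apply: colcount_le.
apply: (@leq_trans (\sum_(j in ~: cols) (nmono m (t + \max_j e j) - nmono m t)))%N.
  under [X in (_ <= X)%N]eq_bigl => j do rewrite inE.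
  apply: leq_sum => j hj; have le : (e j <= \max_j e j)%N by apply: leq_bigmax.
  have := he j hj (t + (\max_j e j - e j))%N.
  have -> : (t + (\max_j e j - e j) + e j = t + \max_j e j)%N by lia.
  move/leq_trans; apply; apply: leq_sub2l; apply: nmono_le; lia.
by rewrite sum_nat_const leq_mul2r max_card orbT.
Qed.

End GreedyBasis.

Section ColumnCount.
Variables (m : nat) (hm : (0 < m)%N).

(** The leading terms of the two bounds can be compared although they are
    taken at different orders, because a shift of [t] changes [nmono m t] by a
    term of lower growth. *)
Lemma growth_le (f : nat -> nat) c c' k e h t1 :
  (forall t, f (t + e) <= c' * nmono m (t + e) + k * (nmono m (t + e) - nmono m t))%N ->
  (forall t, t1 <= t -> c * nmono m t <= f (t + h))%N -> (c <= c')%N.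
Proof.
move=> hf hc; rewrite leqNgt; apply/negP => cc.
have [t0 ht0] := nmono_growth (c' + k) (e + h) hm.
pose t := (t0 + t1)%N.
have h1 := hc (t + e)%N ltac:(lia); have h2 := hf (t + h)%N.
have e1 : (t + h + e = t + e + h)%N by lia.
have e2 : (t + (e + h) = t + e + h)%N by lia.
have h3 := ht0 t ltac:(lia); rewrite e1 in h2; rewrite e2 in h3.
have m1 : (nmono m t <= nmono m (t + e))%N by apply: nmono_le; lia.
have m2 : (nmono m (t + e) <= nmono m (t + e + h))%N by apply: nmono_le; lia.
have m3 : (nmono m t <= nmono m (t + h))%N by apply: nmono_le; lia.
move: h1 h2 h3 m1 m2 m3.
set a := nmono m t; set b := nmono m (t + e); set d := nmono m (t + e + h).
set g := nmono m (t + h) => h1 h2 h3 m1 m2 m3.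
have h4 : ((c'.+1) * b <= c' * d + k * (d - g))%N.
  apply: leq_trans (leq_trans h1 h2); by rewrite leq_mul2r cc orbT.
have h5 : (c' * d = c' * (d - b) + c' * b)%N by rewrite -mulnDr subnK.
have h6 : (c' * (d - b) <= c' * (d - a))%N by rewrite leq_mul2l leq_sub2l ?orbT.
have h7 : (k * (d - g) <= k * (d - a))%N by rewrite leq_mul2l leq_sub2l ?orbT.
move: h4 h3; rewrite mulSn h5 mulnDl; move: h6 h7.
by set x1 := (c' * (d - b))%N; set x2 := (c' * (d - a))%N; set x3 := (k * (d - g))%N;
  set x4 := (k * (d - a))%N; set x5 := (c' * b)%N; clearbody x1 x2 x3 x4 x5; lia.
Qed.

End ColumnCount.

(** * Transport along homomorphisms of subfields *)

Section HomTransfer.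
Variables (E E' : fieldType).
Implicit Types (D A : E -> Prop) (f : E -> E').

(** Homomorphisms are relative to a subfield [D]; outside of [D] the values
    are arbitrary. *)
Record is_hom D f : Prop := IsHom {
  hom1 : f 1 = 1;
  homD : forall x y, D x -> D y -> f (x + y) = f x + f y;
  homM : forall x y, D x -> D y -> f (x * y) = f x * f y
}.

Definition img f A : E' -> Prop := fun y => exists2 x, A x & y = f x.

Lemma imgP f A x : A x -> img f A (f x). Proof. by exists x. Qed.

Section Hom.
Variables (D : E -> Prop) (f : E -> E') (hD : is_subfield D) (hf : is_hom D f).

Lemma hom0 : f 0 = 0.
Proof.
have := homD hf (sf0 hD) (sf0 hD); rewrite addr0 => /(congr1 (fun z => z - f 0)).
by rewrite subrr addrK => <-.
Qed.
Lemma homN x : D x -> f (- x) = - f x.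
Proof.
move=> Dx; apply/eqP; rewrite -addr_eq0 -(homD hf) ?addNr ?hom0 //.
exact: sfN.
Qed.
Lemma homB x y : D x -> D y -> f (x - y) = f x - f y.
Proof. by move=> Dx Dy; rewrite (homD hf) ?homN //; apply: sfN. Qed.
Lemma hom_eq0 x : D x -> f x = 0 -> x = 0.
Proof.
move=> Dx fx; apply/eqP; apply: contrapT => /negP xn.
have := homM hf Dx (sfV hD Dx); rewrite mulfV // (hom1 hf) fx mul0r => /eqP.
by rewrite oner_eq0.
Qed.
Lemma hom_inj x y : D x -> D y -> f x = f y -> x = y.
Proof.
move=> Dx Dy /eqP; rewrite -subr_eq0 -homB // => /eqP /hom_eq0 e.
by apply/eqP; rewrite -subr_eq0 e //; apply: (sfB hD).
Qed.
Lemma homV x : D x -> f x^-1 = (f x)^-1.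
Proof.
move=> Dx; case: (eqVneq x 0) => [->|xn]; first by rewrite !(invr0, hom0).
have fn : f x != 0 by apply: contraNneq xn => /(hom_eq0 Dx) ->.
by apply: (mulfI fn); rewrite -(homM hf) ?(hom1 hf) ?mulfV ?(hom1 hf) //; apply: (sfV hD).
Qed.
Lemma hom_sum (I : eqType) (r : seq I) (F : I -> E) : (forall i, i \in r -> D (F i)) ->
  f (\sum_(i <- r) F i) = \sum_(i <- r) f (F i).
Proof.
elim: r => [|i r IH] h; first by rewrite !big_nil hom0.
have h' j : j \in r -> D (F j) by move=> jr; apply: h; rewrite inE jr orbT.
rewrite !big_cons (homD hf) ?IH //; first by apply: h; rewrite mem_head.
by rewrite big_seq; apply: sf_sum.
Qed.
Lemma homX x n : D x -> f (x ^+ n) = f x ^+ n.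
Proof.
move=> Dx; elim: n => [|n IH]; first by rewrite !expr0 (hom1 hf).
by rewrite !exprS (homM hf) ?IH //; apply: sfX.
Qed.
Lemma hom_prod (I : eqType) (r : seq I) (F : I -> E) : (forall i, i \in r -> D (F i)) ->
  f (\prod_(i <- r) F i) = \prod_(i <- r) f (F i).
Proof.
elim: r => [|i r IH] h; first by rewrite !big_nil (hom1 hf).
have h' j : j \in r -> D (F j) by move=> jr; apply: h; rewrite inE jr orbT.
rewrite !big_cons (homM hf) ?IH //; first by apply: h; rewrite mem_head.
by rewrite big_seq; apply: sf_prod.
Qed.

Lemma img_subfield : is_subfield (img f D).
Proof.
split.
- by exists 1; [apply: sf1 hD | rewrite (hom1 hf)].
- by move=> _ _ [x Dx ->] [y Dy ->]; exists (x - y); [apply: (sfB hD)|rewrite homB].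
- by move=> _ _ [x Dx ->] [y Dy ->]; exists (x * y); [apply: (sfM hD)|rewrite (homM hf)].
- by move=> _ [x Dx ->]; exists x^-1; [apply: (sfV hD)|rewrite homV].
Qed.

Lemma fgen_hom A x : (forall y, A y -> D y) -> fgen A x -> fgen (img f A) (f x).
Proof.
move=> AD; have FD y : fgen A y -> D y by apply: fgen_min hD AD _.
elim=> {x} [x Ax||x y hx ix hy iy|x y hx ix hy iy|x hx ix].
- by apply: fgen_in; apply: imgP.
- by rewrite (hom1 hf); apply: fgen1.
- by rewrite homB; [apply: fgenB|apply: FD|apply: FD].
- by rewrite (homM hf); [apply: fgenM|apply: FD|apply: FD].
- by rewrite homV; [apply: fgenV|apply: FD].
Qed.

Lemma acl_hom A x : (forall y, A y -> D y) -> D x -> acl A x -> acl (img f A) (f x).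
Proof.
move=> AD Dx [p [p0 hp px]]; have FD y : fgen A y -> D y by apply: fgen_min hD AD _.
have cq i : (\poly_(i < size p) f p`_i)`_i = f p`_i.
  by rewrite coef_poly; case: ltnP => // hi; rewrite nth_default ?hom0.
exists (\poly_(i < size p) f p`_i); split.
- apply: contraNneq p0 => q0; apply/eqP/polyP => i; rewrite coef0.
  by apply: (@hom_eq0 p`_i); [apply: FD | rewrite -cq q0 coef0].
- by move=> i; rewrite cq; apply: fgen_hom.
rewrite rootE horner_poly -(big_mkord xpredT (fun i => f p`_i * f x ^+ i)).
have e : f p.[x] = \sum_(0 <= i < size p) f p`_i * f x ^+ i.
  rewrite horner_coef -(big_mkord xpredT (fun i => p`_i * x ^+ i)) hom_sum.
    apply: eq_bigr => i _; rewrite (homM hf) ?homX //; first exact: FD.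
    exact: sfX.
  by move=> i _; apply: (sfM hD); [apply: FD | apply: sfX].
by rewrite -e (rootP px) hom0.
Qed.
End Hom.
End HomTransfer.

Lemma hom_inverse (E E' : fieldType) (D : E -> Prop) (f : E -> E') :
  is_subfield D -> is_hom D f ->
  exists2 g : E' -> E, is_hom (img f D) g & forall x, D x -> g (f x) = x.
Proof.
move=> hD hf.
have /choice[g hg] : forall y, exists x, img f D y -> D x /\ f x = y.
  move=> y; case: (pselect (img f D y)) => [[x Dx ->]|n]; first by exists x.
  by exists 0.
have gf x : D x -> g (f x) = x.
  by move=> Dx; have [] := hg (f x) (imgP f Dx); move=> D1 /(hom_inj hD hf D1 Dx).
exists g => //; split.
- by rewrite -(hom1 hf) gf //; apply: sf1.
- move=> _ _ [x Dx ->] [y Dy ->]; rewrite -(homD hf) // !gf //; exact: sfD.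
- move=> _ _ [x Dx ->] [y Dy ->]; rewrite -(homM hf) // !gf //; exact: (sfM hD).
Qed.

Section HomClosure.
Variables (E E' : fieldType) (D : E -> Prop) (f : E -> E').
Hypotheses (hD : is_subfield D) (hf : is_hom D f).
Variables (A : E -> Prop) (AD : forall y, A y -> D y).

(** Homomorphisms of fields are injective, so that relations can be carried
    back by the inverse on the image. *)
Lemma acl_homE x : D x -> acl A x <-> acl (img f A) (f x).
Proof.
move=> Dx; split; first exact: (acl_hom hD hf).
have [g hg gf] := hom_inverse hD hf.
move=> /(acl_hom (img_subfield hD hf) hg); rewrite gf // => h.
apply: acl_mono (h _ (imgP f Dx)); last by move=> _ [y Ay ->]; apply/imgP/AD.
by move=> _ [_ [y Ay ->] ->]; rewrite gf //; apply: AD.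
Qed.
End HomClosure.

Lemma indseq_hom (E E' : fieldType) (D : E -> Prop) (f : E -> E') A s :
  is_subfield D -> is_hom D f -> (forall y, A y -> D y) ->
  (forall y, y \in s -> D y) -> indseq A s <-> indseq (img f A) (map f s).
Proof.
move=> hD hf AD; elim: s => [//|x s IH] hs /=.
have hs' y : y \in s -> D y by move=> ys; apply: hs; rewrite inE ys orbT.
have Dx : D x by apply: hs; rewrite mem_head.
have AD' y : adj A s y -> D y by case=> [/AD|/hs'].
rewrite IH // (acl_homE hD hf AD' Dx).
suff -> : img f (adj A s) = adj (img f A) (map f s) by [].
apply/funext => y; apply/propext; split.
  by case=> z [Az|zs] ->; [left; apply: imgP | right; apply: map_f].
case=> [[z Az ->]|/mapP[z zs ->]]; first by exists z => //; left.
by exists z => //; right.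
Qed.

(** * The Delta-transcendence degree *)

Section DeltaTrdeg.
Variables (m : nat) (hm : (0 < m)%N) (E : diffFieldType m) (charE : [pchar E] =i pred0).
Variables (K : E -> Prop) (hK : delta_subfield K).
Let sK : is_subfield K := delta_subfield_sf hK.
Let dK : dclosed K := proj2 ((delta_subfieldP K).1 hK).

Lemma delta_indepP (J : finType) (a : J -> E) :
  delta_indep K a <-> forall X, uniq X -> indseq K (map (dv a) X).
Proof. exact: (@alg_indepP E charE (deriv_var m J) K sK (dv a)). Qed.

Variables (J : finType) (eta : J -> E).

Lemma delta_adjoin_dv x : delta_adjoin K (range_of eta) x <->
  fgen (fun y => K y \/ exists v, y = dv eta v) x.
Proof.
rewrite delta_adjoinE //; split; apply: fgen_mono => y [Ky|]; try by left.
  by case=> th [_ [[j ->] ->]]; right; exists (th, j).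
by case=> -[th j] ->; right; exists th, (eta j); split=> //; exists j.
Qed.

Definition upto t : E -> Prop :=
  fun y => K y \/ exists v, (mdeg v.1 <= t)%N /\ y = dv eta v.

Lemma upto_mono t t' x : (t <= t')%N -> upto t x -> upto t' x.
Proof.
by move=> tt' [|[v [h ->]]]; [left | right; exists v; split=> //; apply: leq_trans tt'].
Qed.

Lemma fgen_upto x : fgen (fun y => K y \/ exists v, y = dv eta v) x ->
  exists t, fgen (upto t) x.
Proof.
have up t t' y : (t <= t')%N -> fgen (upto t) y -> fgen (upto t') y.
  by move=> tt'; apply: fgen_mono => z; apply: upto_mono.
elim=> {x} [x [Kx|[v ->]]||x y _ [t ht] _ [u hu]|x y _ [t ht] _ [u hu]|x _ [t ht]].
- by exists 0%N; apply: fgen_in; left.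
- by exists (mdeg v.1); apply: fgen_in; right; exists v.
- by exists 0%N; apply: fgen1.
- exists (maxn t u); apply: fgenB; [apply: up ht | apply: up hu].
    exact: leq_maxl.
  exact: leq_maxr.
- exists (maxn t u); apply: fgenM; [apply: up ht | apply: up hu].
    exact: leq_maxl.
  exact: leq_maxr.
- by exists t; apply: fgenV.
Qed.

Lemma upto_dapp t th x : fgen (upto t) x -> fgen (upto (t + mdeg th)) (dapp th x).
Proof.
clear hm; rewrite addnC; apply: fgen_dapp => [k y|k i y]; first exact: upto_mono.
case=> [Ky|[v [hv ->]]]; first by left; apply: dK.
right; exists (shift (ucm i) v); rewrite dv_shift dapp_ucm; split=> //=.
by rewrite mdegM mdegU.
Qed.

Lemma upto_acl t x : acl (upto t) x -> acl (adj K (map (dv eta) (basics K eta t))) x.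
Proof.
apply: acl_trans => y [Ky|[v [hv ->]]]; first by apply: acl_in; left.
exact: basics_span.
Qed.

(** The derivatives of order at most t of the [b i] are independent, [k *
    nmono m t] in number, and algebraic over the derivatives of [eta] of order
    at most t + h for a fixed h. The rank of these grows like [#|cols K eta| *
    nmono m t]. *)
Lemma indep_le_cols k (b : 'I_k -> E) :
  (forall i, delta_adjoin K (range_of eta) (b i)) -> delta_indep K b ->
  (k <= #|cols K eta|)%N.
Proof.
move=> hb /delta_indepP ib.
have [h hh] : exists h : nat, forall i, fgen (upto h) (b i).
  have /choice[h hh] : forall i, exists h, fgen (upto h) (b i).
    by move=> i; apply/fgen_upto/delta_adjoin_dv.
  exists (\max_i h i)%N => i; apply: fgen_mono (hh i) => x; apply: upto_mono.
  exact: leq_bigmax.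
have [e he] := size_basics_le charE dK eta.
apply: (@growth_le m hm (fun t => size (basics K eta t)) _ _ _ _ h 0 he) => t _ /=.
have st := @steinitz _ _ _ (map (dv eta) (basics K eta (t + h))) (ib _ (allv_uniq m _ t)).
move: st; rewrite !size_map size_allv card_ord mulnC; apply.
move=> x /mapP[v]; rewrite mem_allv => hv ->.
apply: upto_acl; apply: acl_fmono (fgen_acl (upto_dapp v.1 (hh v.2))) => y hy.
by apply/fgen_in/upto_mono/hy; rewrite addnC leq_add2r.
Qed.

Lemma cols_indep k : (k <= #|cols K eta|)%N -> exists a : 'I_k -> E,
  (forall i, delta_adjoin K (range_of eta) (a i)) /\ delta_indep K a.
Proof.
move=> hk; pose c (i : 'I_k) := enum_val (widen_ord hk i).
exists (fun i => eta (c i)); split.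
  move=> i; apply/delta_adjoin_dv/fgen_in; right; exists (mone, c i).
  by rewrite /dv dapp1.
apply/delta_indepP => X uX.
pose X' := [seq (v.1, c v.2) | v <- X].
have -> : map (dv (fun i => eta (c i))) X = map (dv eta) X' by rewrite -map_comp.
apply: cols_indseq.
  rewrite map_inj_uniq // => -[t1 i1] [t2 i2] /= [-> /enum_val_inj h].
  by congr (_, _); apply: val_inj; apply: (congr1 val h).
by move=> _ /mapP[v _ ->]; apply: enum_valP.
Qed.

Lemma delta_trdegP d :
  delta_trdeg K (delta_adjoin K (range_of eta)) d <-> d = #|cols K eta|.
Proof.
split=> [[[a [La ia]] h]|->].
  apply/eqP; rewrite eqn_leq (indep_le_cols La ia) leqNgt; apply/negP => /cols_indep.
  by case=> b [Lb ib]; apply: h Lb ib.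
split; first exact: cols_indep.
by move=> a La /(indep_le_cols La); rewrite ltnn.
Qed.

End DeltaTrdeg.

(** * The dimension of a truncated prime ideal *)

Section Orders.
Variables (m : nat) (I : choiceType) (E : diffFieldType m).
Implicit Types (p q : dpoly E I).

Lemma dp_orderP p t : (dp_order p <= t)%N <->
  forall M, M \in msupp p -> forall v, v \in finsupp M -> (mdeg v.1 <= t)%N.
Proof.
split=> [h M hM v hv|h].
  have h1 : (dmon_order M <= dp_order p)%N.
    by rewrite /dp_order (big_rem M) //= leq_maxl.
  apply: leq_trans (leq_trans h1 h); by rewrite /dmon_order (big_rem v) //= leq_maxl.
rewrite /dp_order big_seq; apply: (big_ind (fun k => (k <= t)%N)) => // [k l|M hM].
  by rewrite geq_max => -> ->.
rewrite /dmon_order big_seq; apply: (big_ind (fun k => (k <= t)%N)) => // [k l|v hv].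
  by rewrite geq_max => -> ->.
exact: h hM v hv.
Qed.

Lemma order_leC c t : (dp_order (c%:MP : dpoly E I) <= t)%N.
Proof.
apply/dp_orderP => M hM; have /fsubsetP/(_ _ hM) := msuppC_le (K := dmonom m I) c.
by rewrite in_fset1 => /eqP-> v; rewrite mdom1 in_fset0.
Qed.

Lemma order_leD p q t : (dp_order p <= t)%N -> (dp_order q <= t)%N ->
  (dp_order (p + q)%R <= t)%N.
Proof.
move=> /dp_orderP hp /dp_orderP hq; apply/dp_orderP => M hM.
have /fsubsetP/(_ _ hM) := msuppD_le p q; rewrite in_fsetU => /orP[/hp|/hq]; exact.
Qed.

Lemma order_leM p q t : (dp_order p <= t)%N -> (dp_order q <= t)%N ->
  (dp_order (p * q)%R <= t)%N.
Proof.
move=> /dp_orderP hp /dp_orderP hq; apply/dp_orderP => M /msuppM_le.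
case=> M1 [M2] [h1 h2 ->] v.
by rewrite mdomD in_fsetU => /orP[/(hp _ h1)|/(hq _ h2)].
Qed.

Lemma order_leX p k t : (dp_order p <= t)%N -> (dp_order (p ^+ k)%R <= t)%N.
Proof.
move=> hp; elim: k => [|k IH]; first exact: (order_leC 1%R).
by rewrite exprS; apply: order_leM.
Qed.

Lemma order_leV v t : (mdeg v.1 <= t)%N ->
  (dp_order (<< ucm v >> : dpoly E I) <= t)%N.
Proof.
move=> hv; apply/dp_orderP => M; rewrite msuppU1 in_fset1 => /eqP-> w.
by rewrite mdomU in_fset1 => /eqP->.
Qed.

Lemma order_le_subst k (g : 'I_k -> dpoly E I) (Q : {malg E['X_{1..k}]}) t :
  (forall i, (dp_order (g i) <= t)%N) ->
  (dp_order (mmap (@malgC _ _) (mon_eval g) Q) <= t)%N.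
Proof.
move=> hg; have h0 : (dp_order (0%R : dpoly E I) <= t)%N.
  by rewrite -malgC0E; apply: order_leC.
apply: (big_ind (fun p => dp_order p <= t)%N) => // [p q|M _]; first exact: order_leD.
apply: order_leM; first exact: order_leC.
apply: (big_ind (fun p => dp_order p <= t)%N) => [|p q|i _]; last exact: order_leX.
  exact: (order_leC 1%R).
exact: order_leM.
Qed.

Lemma dp_eval_subst (T : choiceType) (g : T -> dpoly E I) (Q : {malg E[{cmonom T}]}) a :
  dp_eval (mmap (@malgC _ _) (mon_eval g) Q) a =
  mmap idfun (mon_eval (fun i => dp_eval (g i) a)) Q.
Proof.
rewrite /dp_eval rmorph_sum; apply: eq_bigr => M _.
by rewrite rmorphM rmorph_prod /= mevalC; congr (_ * _); apply: eq_bigr => i _; rewrite rmorphXn.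
Qed.

Lemma coefs_in_subst K (T : choiceType) (g : T -> dpoly E I) (Q : {malg E[{cmonom T}]}) :
  is_subfield K -> coefs_in K Q -> (forall i, coefs_in K (g i)) ->
  coefs_in K (mmap (@malgC _ _) (mon_eval g) Q).
Proof.
move=> hK hQ hg; apply: coefs_in_sum => // M _; apply: coefs_inM => //.
  by apply: coefs_in_C => //; apply: hQ.
by apply: coefs_in_prod => // i _; apply: coefs_inX.
Qed.

End Orders.

Section DimPrime.
Variables (m n : nat) (E : diffFieldType m) (charE : [pchar E] =i pred0).
Variables (K : E -> Prop) (hK : delta_subfield K) (V : ('I_n -> E) -> Prop).
Variables (eta : 'I_n -> E) (heta : generic_point K V eta).
Let sK : is_subfield K := delta_subfield_sf hK.

Lemma generic_vanish p : coefs_in K p -> vanishing_ideal K V p <-> dp_eval p eta = 0.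
Proof. by case: heta => Ve h hp; split=> [[_]|/(h p hp)]; first exact. Qed.

Variables (t : nat) (b : seq E).
Hypotheses (ib : indseq K b)
  (bt : forall x, x \in b -> exists v, (mdeg v.1 <= t)%N /\ x = dv eta v)
  (bspan : forall v, (mdeg v.1 <= t)%N -> acl (adj K b) (dv eta v)).

(** Evaluation at the generic point identifies the quotient of the truncated
    ring by the ideal with the ring generated by the derivatives of [eta] of
    order at most [t]. Its transcendence degree is the size of any basis [b]
    taken among these derivatives. *)
Lemma dim_primeP d : is_dim_prime K (trunc_ring K t)
    (fun p => vanishing_ideal K V p /\ (dp_order p <= t)%N) d <-> d = size b.
Proof.
have evg k (g : 'I_k -> dpoly E 'I_n) (Q : {malg E['X_{1..k}]}) :
    (forall i, trunc_ring K t (g i)) -> coefs_in K Q ->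
    (vanishing_ideal K V (mmap (@malgC _ _) (mon_eval g) Q) /\
       (dp_order (mmap (@malgC _ _) (mon_eval g) Q) <= t)%N) <->
    mmap idfun (mon_eval (fun i => dp_eval (g i) eta)) Q = 0.
  move=> hg hQ; have cQ := coefs_in_subst sK hQ (fun i => proj1 (hg i)).
  rewrite -dp_eval_subst generic_vanish //; split=> [[]//|h]; split=> //.
  by apply: order_le_subst => i; have [] := hg i.
have indg k (g : 'I_k -> dpoly E 'I_n) : (forall i, trunc_ring K t (g i)) ->
    (forall Q : {malg E['X_{1..k}]}, coefs_in K Q ->
      vanishing_ideal K V (mmap (@malgC _ _) (mon_eval g) Q) /\
       (dp_order (mmap (@malgC _ _) (mon_eval g) Q) <= t)%N -> Q = 0) <->
    alg_indep K (fun i => dp_eval (g i) eta).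
  by move=> hg; split=> h Q hQ /(evg k g Q hg hQ); apply: h.
have up k (g : 'I_k -> dpoly E 'I_n) : (forall i, trunc_ring K t (g i)) ->
    alg_indep K (fun i => dp_eval (g i) eta) -> (k <= size b)%N.
  move=> hg /(alg_indepP charE sK)/(_ (enum 'I_k) (enum_uniq _)) ig.
  have := steinitz (t := b) ig; rewrite size_map size_enum_ord; apply.
  move=> _ /mapP[i _ ->]; have [cg og] := hg i; have hB := acl_subfield (adj K b).
  have KB x : K x -> acl (adj K b) x by move=> Kx; apply: acl_in; left.
  rewrite /dp_eval /mmap big_seq; apply: sf_sum => // M hM.
  apply: (sfM hB); first exact/KB/cg.
  rewrite /mon_eval big_seq; apply: sf_prod => // v hv; apply: sfX => //.
  by apply: bspan; apply: (dp_orderP _ _).1 og M hM v hv.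
have low : exists g : 'I_(size b) -> dpoly E 'I_n, (forall i, trunc_ring K t (g i)) /\
    alg_indep K (fun i => dp_eval (g i) eta).
  have /choice[v hv] := fun i : 'I_(size b) => bt (mem_nth 0 (ltn_ord i)).
  exists (fun i => << ucm (v i) >>); split.
    by move=> i; have [h1 _] := hv i; split; [apply: coefs_in_U | apply: order_leV].
  have -> : (fun i => dp_eval << ucm (v i) >> eta) = (fun i : 'I_(size b) => b`_i).
    apply/funext => i; rewrite /dp_eval mevalV -/(dv eta (v i)).
    by have [_ <-] := hv i.
  apply/(alg_indepP charE sK) => Y uY.
  have uB : uniq [seq b`_(nat_of_ord i) | i <- Y].
    rewrite map_inj_in_uniq; first exact: uY.
    by move=> i j _ _ /eqP; rewrite nth_uniq ?(indseq_uniq ib) // => /eqP/val_inj.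
  apply: indseq_sub uB _ ib.
  by move=> _ /mapP[i _ ->]; apply: mem_nth.
split=> [[[g [hg /(indg _ _ hg) ig]] h]|->].
  apply/eqP; rewrite eqn_leq (up _ _ hg ig) leqNgt; apply/negP => lt.
  have [g' [hg' ig']] := low; pose w := widen_ord lt.
  apply: (h (fun i => g' (w i))); first by move=> i; apply: hg'.
  apply/indg; first by move=> i; apply: hg'.
  apply/(alg_indepP charE sK) => Y uY; move/(alg_indepP charE sK): ig' => ig'.
  have := ig' (map w Y); rewrite -map_comp; apply.
  by rewrite map_inj_uniq // => i j /(congr1 val) /= /val_inj.
split; first by have [g [hg /(indg _ _ hg) ig]] := low; exists g.
by move=> g hg /(indg _ _ hg) /(up _ _ hg); rewrite ltnn.
Qed.
End DimPrime.

(** * Independent families *)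

Lemma uniq_map_inj (T U : eqType) (f : T -> U) (s : seq T) :
  uniq (map f s) -> {in s &, injective f}.
Proof.
elim: s => [//|x s IH] /= /andP[nx us] a b; rewrite !inE.
case/orP => [/eqP->|ha]; case/orP => [/eqP->|hb] // e; last exact: IH.
- by case/negP: nx; rewrite e; apply: map_f.
- by case/negP: nx; rewrite -e; apply: map_f.
Qed.

Section Families.
Variables (E : fieldType) (T : eqType).
Implicit Types (A B : E -> Prop) (u : T -> E).

Lemma preimage_seq u (P : T -> Prop) (s : seq E) :
  (forall y, y \in s -> exists t, P t /\ y = u t) ->
  exists X, [/\ uniq X, forall t, t \in X -> P t & {subset s <= map u X}].
Proof.
elim: s => [|y s IH] h; first by exists [::].
have [X [uX PX sX]] := IH (fun z zs => h z (mem_behead (s := y :: s) zs)).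
have [t [Pt ->]] := h y (mem_head _ _).
exists (undup (t :: X)); split; first exact: undup_uniq.
  by move=> w; rewrite mem_undup inE => /orP[/eqP->|/PX].
move=> z; rewrite inE => /orP[/eqP->|/sX/mapP[w wX ->]]; apply: map_f;
  by rewrite mem_undup inE ?eqxx ?wX ?orbT.
Qed.

Lemma indseq_family_split A u (P : T -> Prop) Y :
  (forall X, uniq X -> indseq A (map u X)) -> uniq Y -> (forall t, t \in Y -> ~ P t) ->
  indseq (fun x => A x \/ exists t, P t /\ x = u t) (map u Y).
Proof.
move=> hu uY nP; apply: indseq_finitary => s /preimage_seq[X [uX PX sX]].
apply: (@indseq_mono _ _ (adj A (map u X))).
  by move=> x [Ax|/sX xX]; apply: acl_in; [left|right].
have : uniq (Y ++ X).
  rewrite cat_uniq uY uX andbT /=; apply/hasPn => t tX; apply/negP => tY.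
  exact: nP t tY (PX t tX).
by move/hu; rewrite map_cat => /indseq_cat[].
Qed.

(** The [u t] are independent over [B], hence over [A] and [s] together;
    exchanging the two families moves the [u t] into the base. *)
Lemma indseq_over A B u (P : T -> Prop) s :
  (forall x, A x -> acl B x) -> (forall x, x \in s -> acl B x) -> indseq A s ->
  (forall X, uniq X -> (forall t, t \in X -> P t) -> indseq B (map u X)) ->
  indseq (fun x => A x \/ exists t, P t /\ x = u t) s.
Proof.
move=> AB sB hs hu; apply: indseq_finitary => r /preimage_seq[X [uX PX sX]].
apply: (@indseq_mono _ _ (adj A (map u X))).
  by move=> x [Ax|/sX xX]; apply: acl_in; [left|right].
apply: indseq_exch hs _; apply: indseq_mono (hu X uX PX) => x [/AB//|/sB//].
Qed.

Lemma indseq_line (charE : [pchar E] =i pred0) (K H : E -> Prop) (l c : T -> E) y Y :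
  is_subfield K -> is_subfield H -> (forall x, K x -> H x) ->
  (forall t, H (l t)) -> (forall t, H (c t)) -> ~ acl H y ->
  indseq K (map l Y) -> indseq (adj K [:: y]) (map (fun t => l t + y * c t) Y).
Proof.
move=> hK hH KH Hl Hc ny iY; have uY := indseq_uniq iY.
pose k := size Y; pose f := tnth (in_tuple Y).
have eY (A : Type) (h : T -> A) : map h Y = map (h \o f) (enum 'I_k).
  by rewrite map_comp map_tnth_enum.
have al : alg_indep K (l \o f).
  apply/(alg_indepP charE hK) => X uX; apply: indseq_sub iY.
    rewrite map_inj_uniq // => i j /=.
    move=> e; have x0 : T := f i; apply: val_inj => /=.
    have li (k0 : 'I_k) : (k0 < size Y)%N by apply: ltn_ord.
    have e' : l (nth x0 Y i) = l (nth x0 Y j).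
      by move: e; rewrite /f !(tnth_nth x0).
    apply/eqP; have lm (k0 : 'I_k) : (k0 < size (map l Y))%N by rewrite size_map li.
    by rewrite -(nth_uniq 0 (lm i) (lm j) uY) !(nth_map x0) ?li // e'.
  by move=> _ /mapP[i _ ->] /=; apply/map_f/mem_tnth.
have := alg_indep_line hK hH KH (fun i => Hl (f i)) (fun i => Hc (f i)) ny al.
move/(alg_indepP charE (fgen_subfield _))/(_ _ (enum_uniq _)).
move=> h; rewrite eY; apply: indseq_mono (h 'I_k) => x hx; apply: acl_in; exact: fgen_in.
Qed.
End Families.

(** * Derivatives of v x + c for a generic v *)

Section GenericLine.
Variables (m : nat) (E : diffFieldType m) (charE : [pchar E] =i pred0).
Variables (H H0 : E -> Prop) (v x c : E) (T : nat).
Hypotheses (dH : dclosed H) (H0H : forall y, H0 y -> H y).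
Hypotheses (Hx : H x) (Hc : H c).
Hypothesis iv : forall X : seq {cmonom 'I_m}, uniq X ->
  indseq H (map (fun th => dapp th v) X).
Hypothesis ix : forall X : seq {cmonom 'I_m}, uniq X ->
  (forall th, th \in X -> (T <= mdeg th)%N) -> indseq H0 (map (fun th => dapp th x) X).
Hypothesis lowx : forall th, (mdeg th < T)%N -> fgen H0 (dapp th x).

Let v0 : v != 0.
Proof.
have /= [nv _] := iv (X := [:: mone]) isT; apply/eqP => v0; apply: nv.
by rewrite dapp1 v0; exact: (fgen_acl (sf0 (fgen_subfield _))).
Qed.

Let w th := dapp th v / v.
Let H1 := fgen (fun y => H y \/ exists th, y = w th).
Let V : E -> Prop := fun y => H0 y \/ exists th, y = dapp th v.
Let sH1 : is_subfield H1 := fgen_subfield _.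

Let HH1 y : H y -> H1 y. Proof. by move=> Hy; apply: fgen_in; left. Qed.

Let w1 : w mone = 1. Proof. by rewrite /w dapp1 mulfV. Qed.

(** The elements v and theta(v) / v, for theta of positive order, generate the
    same field over [H] as the independent derivatives of [v], hence are
    independent as well. *)
Let v_transc : ~ acl H1 v^-1.
Proof.
move=> /(sfV (acl_subfield _)); rewrite invrK => hv.
have {hv} : acl (fun y => H y \/ exists th, y = w th) v.
  by apply: acl_trans hv => y hy; apply: fgen_acl.
case/acl_finitary => s hs hv.
have [|X [uX _ sX]] := @preimage_seq _ _ w (fun=> True) s.
  by move=> y /hs[th ->]; exists th.
pose Y := [seq th <- X | th != mone].
have uY : uniq (mone :: Y) by rewrite /= mem_filter eqxx filter_uniq.
have : indseq H (v :: map w Y).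
  apply: indseq_span (iv uY) _ _; last by rewrite /= !size_map.
  have hB := acl_subfield (adj H (v :: map w Y)).
  have vB : acl (adj H (v :: map w Y)) v by apply: acl_adj_self; apply: mem_head.
  move=> _ /mapP[th hth ->]; have -> : dapp th v = w th * v by rewrite /w divfK.
  apply: (sfM hB) => //; move: hth; rewrite inE => /orP[/eqP->|thY].
    by rewrite w1; apply: sf1 hB.
  by apply: acl_adj_self; rewrite inE (map_f w thY) orbT.
case=> nv _; apply: nv; apply: acl_trans hv => y [Hy|/sX/mapP[th thX ->]].
  by apply: acl_in; left.
case: (eqVneq th mone) => [->|th1].
  by rewrite w1; apply: (sf1 (acl_subfield _)).
by apply: acl_adj_self; apply: map_f; rewrite mem_filter th1.
Qed.

(** Linear forms in the derivatives of [v] with coefficients in [H]. By the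
    product rule theta(v x) is one of them, so that theta(v x) / v lies in
    [H1]. *)
Let lin_der (f : E) :
  (exists ts : seq (E * {cmonom 'I_m}), (forall t, t \in ts -> H t.1) /\
     f = \sum_(t <- ts) t.1 * dapp t.2 v) -> forall i,
  (exists ts : seq (E * {cmonom 'I_m}), (forall t, t \in ts -> H t.1) /\
     der i f = \sum_(t <- ts) t.1 * dapp t.2 v).
Proof.
move=> [ts [hts ->]] i.
exists ([seq (der i t.1, t.2) | t <- ts] ++ [seq (t.1, mmul (ucm i) t.2) | t <- ts]).
split.
  by move=> t; rewrite mem_cat => /orP[] /mapP[u /hts Hu ->] //=; apply: dH.
rewrite der_sum big_cat !big_map /= -big_split; apply: eq_bigr => t _ /=.
by rewrite derM dappU.
Qed.

Let l th := dapp th (v * x) / v.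

Let Hl th : H1 (l th).
Proof.
have [ts [hts e]] : exists ts : seq (E * {cmonom 'I_m}), (forall t, t \in ts -> H t.1) /\
     dapp th (v * x) = \sum_(t <- ts) t.1 * dapp t.2 v.
  elim/cmonom_ind: th => [|i th IH]; last by rewrite dappU; apply: lin_der.
  exists [:: (x, mone)]; split; last by rewrite big_seq1 /= !dapp1 mulrC.
  by move=> t; rewrite inE => /eqP->.
rewrite /l e mulr_suml big_seq; apply: (sf_sum sH1) => t /hts Ht.
rewrite -mulrA; apply: (sfM sH1); first exact: HH1.
by apply: fgen_in; right; exists t.2.
Qed.

Let Hc' th : H1 (dapp th c).
Proof. exact: (HH1 (dapp_closed dH th Hc)). Qed.

Let Q k : E -> Prop := fun y => (exists th, y = dapp th v) \/
  exists th, (mdeg th <= k)%N /\ y = dapp th (v * x).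

(** [x] is the quotient of v x by [v]. The bound on the orders makes a
    comparison of ranks possible in [iVl]. *)
Let xQ th : fgen (Q (mdeg th)) (dapp th x).
Proof.
have base : fgen (Q 0) x.
  have -> : x = (v * x) * v^-1 by rewrite mulrC mulKf.
  apply: fgenM; first by apply: fgen_in; right; exists mone; rewrite dapp1 mdeg1.
  by apply: fgenV; apply: fgen_in; left; exists mone; rewrite dapp1.
rewrite -[mdeg th]addn0; apply: fgen_dapp base => [k y|k i y] [[u ->]|[u [hu ->]]].
- by left; exists u.
- by right; exists u; split=> //; apply: leqW.
- by left; exists (mmul (ucm i) u); rewrite dappU.
- by right; exists (mmul (ucm i) u); rewrite dappU mdegM mdegU; split.
Qed.

Let vx_low th : (mdeg th < T)%N -> fgen V (dapp th (v * x)).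
Proof.
move=> hth.
pose P k : E -> Prop := fun y => (exists u, y = dapp u v) \/
  exists u, (mdeg u <= k)%N /\ y = dapp u x.
have base : fgen (P 0) (v * x).
  by apply: fgenM; apply: fgen_in; [left|right]; exists mone; rewrite dapp1 ?mdeg1.
have : fgen (P (mdeg th + 0)%N) (dapp th (v * x)).
  apply: fgen_dapp base => [k y|k i y] [[u ->]|[u [hu ->]]].
  - by left; exists u.
  - by right; exists u; split=> //; apply: leqW.
  - by left; exists (mmul (ucm i) u); rewrite dappU.
  - by right; exists (mmul (ucm i) u); rewrite dappU mdegM mdegU; split.
rewrite addn0; apply: fgen_sub => y [[u ->]|[u [hu ->]]].
  by apply: fgen_in; right; exists u.
by apply: fgen_mono (lowx (leq_ltn_trans hu hth)) => z; left.
Qed.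

Let iVx X : uniq X -> (forall th, th \in X -> (T <= mdeg th)%N) ->
  indseq V (map (fun th => dapp th x) X).
Proof.
move=> uX hX.
have := @indseq_over _ _ H0 H (fun th => dapp th v) (fun=> True)
  (map (fun th => dapp th x) X).
have h1 y : H0 y -> acl H y by move=> /H0H; apply: acl_in.
have h2 y : y \in map (fun th => dapp th x) X -> acl H y.
  by move=> /mapP[th _ ->]; apply: acl_in; apply: dapp_closed.
move=> /(_ h1 h2 (ix uX hX)) h.
apply: indseq_mono (h (fun X uX _ => iv uX)) => y [H0y|[th ->]]; apply: acl_in.
  by left.
by right; exists th.
Qed.

(** Over the derivatives of [v] and the low derivatives of [x], the elements
    theta(v x) / v with theta of order between T and k generate the
    derivatives of [x] of the same orders. These are independent, and the two
    families have the same size. *)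
Let iVl Y : uniq Y -> (forall th, th \in Y -> (T <= mdeg th)%N) ->
  indseq V (map l Y).
Proof.
move=> uY hY; pose k := (\max_(th <- Y) mdeg th)%N.
pose X := [seq th <- monos m k | (T <= mdeg th)%N].
have uX : uniq X by rewrite filter_uniq ?monos_uniq.
have hX th : th \in X -> (T <= mdeg th)%N by rewrite mem_filter => /andP[].
have iX : indseq V (map l X).
  apply: indseq_span (iVx uX hX) _ _; last by rewrite !size_map.
  move=> z /mapP[th]; rewrite mem_filter mem_monos => /andP[_ hk] -> {z}.
  apply: fgen_acl; apply: fgen_sub (xQ th) => y [[u ->]|[u [hu ->]]].
    by apply: fgen_in; left; right; exists u.
  case: (ltnP (mdeg u) T) => hT.
    by apply: fgen_mono (vx_low hT) => z; left.
  have -> : dapp u (v * x) = l u * v by rewrite /l divfK.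
  apply: fgenM; apply: fgen_in.
    by right; apply: map_f; rewrite mem_filter hT mem_monos (leq_trans hu).
  by left; right; exists mone; rewrite dapp1.
have sub : {subset Y <= X}.
  move=> th thY; rewrite mem_filter hY // mem_monos /k (big_rem th) //=.
  exact: leq_maxl.
have linj : {in X &, injective l} := uniq_map_inj (indseq_uniq iX).
apply: indseq_sub iX.
  by rewrite map_inj_in_uniq // => a b /sub aX /sub bX; apply: linj.
by move=> _ /mapP[th /sub thX ->]; apply: map_f.
Qed.

(** Over the derivatives of [v], the elements theta(v x + c) and their
    quotients by [v] generate the same field. The quotients are l_theta + v^-1
    theta(c), to which [indseq_line] applies with y = v^-1. *)
Lemma indseq_generic_line Y : uniq Y -> (forall th, th \in Y -> (T <= mdeg th)%N) ->
  indseq (fun y => H0 y \/ exists th, y = dapp th v)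
    (map (fun th => dapp th (v * x + c)) Y).
Proof.
move=> uY hY; rewrite -/V.
pose K0 := fgen (fun y => H0 y \/ exists th, y = w th).
have K0H1 y : K0 y -> H1 y.
  by apply: fgen_mono => z [/H0H|]; [left|right].
have K0V y : K0 y -> acl V y.
  move=> hy; apply: fgen_acl; apply: fgen_sub hy => z [H0z|[th ->]].
    by apply: fgen_in; left.
  rewrite /w; apply: fgenM; first by apply: fgen_in; right; exists th.
  by apply: fgenV; apply: fgen_in; right; exists mone; rewrite dapp1.
have iK : indseq K0 (map l Y) := indseq_mono K0V (iVl uY hY).
have := indseq_line charE (fgen_subfield _) sH1 K0H1 Hl Hc' v_transc iK.
set s := map _ Y => hs.
have : indseq V s.
  apply: indseq_mono hs => y; set B := adj _ _; have hB := acl_subfield B.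
  have vB : acl B v.
    rewrite -[v]invrK; apply: (sfV hB); apply: acl_in; right; exact: mem_head.
  case=> [H0y|[th ->]]; first by apply: acl_in; left; apply: fgen_in; left.
  have -> : dapp th v = w th * v by rewrite /w divfK.
  apply: (sfM hB) => //; apply: acl_in; left; apply: fgen_in; right; by exists th.
move/indseq_span; apply; last by rewrite !size_map.
move=> _ /mapP[th thY ->]; set B := adj _ _; have hB := acl_subfield B.
have -> : l th + v^-1 * dapp th c = dapp th (v * x + c) / v.
  by rewrite /l dappD; field.
apply: (sfM hB); first by apply: acl_adj_self; apply: map_f.
by apply: (sfV hB); apply: acl_in; left; right; exists mone; rewrite dapp1.
Qed.
End GenericLine.

Lemma indseq_opp (E : fieldType) (T : eqType) (A : E -> Prop) (f : T -> E) X :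
  indseq A (map f X) -> indseq A (map (fun t => - f t) X).
Proof.
move=> h; apply: indseq_span h _ _; last by rewrite !size_map.
move=> _ /mapP[t tX ->]; rewrite -[f t]opprK; apply: (sfN (acl_subfield _)).
by apply: acl_adj_self; apply: (map_f (fun t => - f t)).
Qed.

(** * Derivatives of a monomial in a full column *)

Section Leader.
Variables (m : nat) (E : diffFieldType m) (charE : [pchar E] =i pred0).
Variables (F : E -> Prop) (dF : dclosed F).
Variables (J : finType) (eta : J -> E) (j0 : J) (hj0 : full F eta j0).
Variables (M : dmonom m J) (M1 : M != mone) (Mj : forall v, v \in finsupp M -> v.2 = j0).

Let x := mon_eval (fun v : deriv_var m J => dv eta v) M.

Let dv_neq0 th : dv eta (th, j0) != 0.
Proof.
apply/eqP => e; apply: (hj0 (th := th)); rewrite e.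
exact: (fgen_acl (sf0 (fgen_subfield _))).
Qed.

Let leader_ex : exists2 v : {cmonom 'I_m} * J, v \in finsupp M &
  forall w, w \in finsupp M -> w != v -> vlt w v.
Proof.
apply: (@vlt_max m J (finsupp M : seq _)); apply: contraNneq M1 => e.
apply/cmP => v; rewrite cm1; apply/eqP; rewrite cmE_eq0.
by apply/negP => hv; have : v \in (finsupp M : seq _) by []; rewrite e.
Qed.

Lemma leader_order (v : {cmonom 'I_m} * J) : v \in finsupp M ->
  (forall w, w \in finsupp M -> w != v -> vlt w v) -> mdeg v.1 = dmon_order M.
Proof.
move=> vM hv; apply/eqP; rewrite eqn_leq; apply/andP; split.
  by rewrite /dmon_order (big_rem v) //= leq_maxl.
rewrite /dmon_order big_seq; apply: (big_ind (fun k => (k <= mdeg v.1)%N)) => // [k l|w wM].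
  by rewrite geq_max => -> ->.
by case: (eqVneq w v) => [->//|/(hv w wM)/vlt_le].
Qed.

Let upTo (v : {cmonom 'I_m} * J) : E -> Prop :=
  fun y => exists w, (w = v \/ vlt w v) /\ y = dv eta w.

Let upTo_shift v i y : upTo v y -> upTo (shift (ucm i) v) y /\
  upTo (shift (ucm i) v) (der i y).
Proof.
case=> w [hw ->]; split.
  exists w; split=> //; right; case: hw => [->|wv]; first exact: vlt_shiftU.
  exact: (vlt_trans wv (vlt_shiftU _ _)).
exists (shift (ucm i) w); rewrite dv_shift dapp_ucm; split=> //.
by case: hw => [->|wv]; [left | right; rewrite vlt_shift].
Qed.

(** Let z be the derivative of highest rank in M. Then theta(x) involves no
    derivative above theta(z), and theta(z) is algebraic over theta(x) and
    lower derivatives. As theta(z) is basic, theta(x) is not algebraic over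
    the derivatives below theta(z); these include all derivatives of order
    less than T + ord M, and they generate the theta'(x) with theta' below
    theta. *)
Lemma indseq_monomial T (X : seq {cmonom 'I_m}) : uniq X ->
  (forall th, th \in X -> (T <= mdeg th)%N) ->
  indseq (fun y => F y \/ exists w, (mdeg w.1 < T + dmon_order M)%N /\ y = dv eta w)
    (map (fun th => dapp th x) X).
Proof.
move=> uX hX; have [v vM hv] := leader_ex; have vj : v.2 = j0 := Mj vM.
have ov := leader_order vM hv.
have upx th : fgen (upTo (shift th v)) (dapp th x).
  elim/cmonom_ind: th => [|i th IH].
    rewrite dapp1 /shift mul1m -surjective_pairing /x /mon_eval big_seq.
    apply: (sf_prod (fgen_subfield _)) => w wM; apply: (sfX (fgen_subfield _)).
    apply: fgen_in; exists w; split; last by [].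
    by case: (eqVneq w v) => [->|/(hv w wM)]; [left|right].
  have -> : shift (mmul (ucm i) th) v = shift (ucm i) (shift th v).
    by rewrite /shift /= mulmA.
  by rewrite dappU; apply: fgen_der IH => y /(upTo_shift i)[h1 h2]; apply: fgen_in.
pose B th : E -> Prop := fun y => low F eta (shift th v) y \/ y = dapp th x.
have zB th : acl (B th) (dv eta (shift th v)).
  elim/cmonom_ind: th => [|i th IH].
    have -> : shift mone v = v by rewrite /shift mul1m -surjective_pairing.
    pose N := \prod_(w <- rem v (finsupp M)) dv eta w ^+ M w.
    have xN : x = dv eta v ^+ M v * N by rewrite /x /mon_eval (big_rem v).
    have wN w : w \in rem v (finsupp M) -> w \in finsupp M /\ w != v.
      by rewrite mem_rem_uniq ?fset_uniq // inE => /andP[].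
    have N0 : N != 0.
      rewrite /N big_seq prodf_seq_neq0; apply/allP => w _; apply/implyP => /wN[wM _].
      by apply: expf_neq0; rewrite [w]surjective_pairing (Mj wM); apply: dv_neq0.
    have hB := fgen_subfield (B mone).
    have NB : fgen (B mone) N.
      rewrite /N big_seq; apply: (sf_prod hB) => w /wN[wM wv]; apply: (sfX hB).
      apply: fgen_in; left; right; exists w; split; last by [].
      by rewrite /shift mul1m -surjective_pairing; apply: hv.
    have e0 : (0 < M v)%N by rewrite lt0n cmE_neq0.
    (* x = z^e N, where N is a product of lower derivatives *)
    exists ('X^(M v) - (x / N)%:P); split.
    - by rewrite -size_poly_gt0 size_XnsubC.
    - move=> i; rewrite coefB coefXn coefC; apply: (sfB hB); first exact: sf_nat.
      case: eqP => _; last exact: sf0.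
      apply: fgenM; last exact: fgenV.
      by apply: fgen_in; right; rewrite dapp1.
    by rewrite rootE !hornerE xN mulfK // subrr.
  have -> : shift (mmul (ucm i) th) v = shift (ucm i) (shift th v).
    by rewrite /shift /= mulmA.
  rewrite dv_shift dapp_ucm; apply: (acl_der charE _ _ IH) => y.
    case=> [[Fy|[w [wv ->]]]|->].
    - by apply: acl_in; left; left.
    - apply: acl_in; left; right; exists w; split; last by [].
      by rewrite /shift /= -mulmA; apply: (vlt_trans wv (vlt_shiftU _ _)).
    apply: fgen_acl; apply: fgen_mono (upx th) => z [w [hw ->]].
    left; right; exists w; split; last by [].
  rewrite /shift /= -mulmA.
    case: hw => [->|wv]; first exact: vlt_shiftU.
    exact: (vlt_trans wv (vlt_shiftU _ _)).
  case=> [[Fy|[w [wv ->]]]|->].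
  - by apply: acl_in; left; left; apply: dF.
  - apply: acl_in; left; right; exists (shift (ucm i) w).
    rewrite dv_shift dapp_ucm; split; last by [].
    by rewrite /shift /= -mulmA -/(shift (ucm i) (shift th v)) -/(shift _ w) vlt_shift.
  by apply: acl_in; right; rewrite dappU.
pose h (w : {cmonom 'I_m} * J) := dapp w.1 x.
pose X' := [seq (th, j0) | th <- X].
have -> : map (fun th => dapp th x) X = map h X' by rewrite -map_comp.
apply: indseq_vlt; first by rewrite map_inj_uniq // => a b [].
move=> _ /mapP[th thX ->] hd.
have sv : shift th v = (mmul th v.1, j0) by rewrite /shift vj.
apply: (hj0 (th := mmul th v.1)); rewrite -sv; apply: acl_trans (zB th) => y [hy|->].
  exact: acl_in.
apply: acl_trans hd => z [[Fz|[w [hw ->]]]|[w [/mapP[th' _ ->] lt ->]]].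
- by apply: acl_in; left.
- apply: acl_in; right; exists w; split; last by [].
  apply: vlt_deg.
  rewrite /= mdegM ov; apply: leq_trans hw _; rewrite leq_add2r; exact: hX.
rewrite /h /=; apply: fgen_acl; apply: fgen_mono (upx th') => u [w' [hw' ->]].
right; exists w'; split; last by [].
have lt' : vlt (shift th' v) (shift th v).
  rewrite /shift vj ![mmul _ v.1]mulmC.
  by rewrite -[(_, j0)]/(shift v.1 (th', j0)) -[X in vlt _ X]/(shift v.1 (th, j0)) vlt_shift.
by case: hw' => [->//|/vlt_trans]; apply.
Qed.

End Leader.

(** * Derivatives of the value of a quasi-generic polynomial *)

Section QuasiGenericValue.
Variables (m : nat) (E : diffFieldType m) (charE : [pchar E] =i pred0).
Variables (F : E -> Prop) (hF : delta_subfield F).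
Variables (J I : finType) (eta : J -> E) (v : I -> E) (o i0 : I) (i0o : i0 != o).
Variables (M : I -> dmonom m J) (s : nat) (Ms : forall i, (dmon_order (M i) <= s)%N).
Variables (j0 : J) (hj0 : full F eta j0) (M1 : M i0 != mone)
  (Mj : forall v, v \in finsupp (M i0) -> v.2 = j0) (Mo : dmon_order (M i0) = s).
Hypothesis hv : forall X, uniq X ->
  indseq (fun y => F y \/ exists w, y = dv eta w) (map (dv v) X).
Let dF : dclosed F := proj2 ((delta_subfieldP F).1 hF).

Let ev i := mon_eval (fun w : deriv_var m J => dv eta w) (M i).

Lemma mon_eval_upto i : fgen (upto F eta s) (ev i).
Proof.
rewrite /ev /mon_eval big_seq; apply: (sf_prod (fgen_subfield _)) => w wM.
apply: (sfX (fgen_subfield _)); apply: fgen_in; right; exists w; split=> //.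
apply: leq_trans (Ms i); by rewrite /dmon_order (big_rem w) //= leq_maxl.
Qed.

(** [indseq_generic_line] for v = [v i0] and x = [M i0] at [eta], with all
    other terms collected in c. The other [v i] and the derivatives of [eta]
    belong to the field [H], over which [v i0] is Delta-independent. *)
Lemma indseq_quasi_generic T (Y : seq {cmonom 'I_m}) : uniq Y ->
  (forall th, th \in Y -> (T <= mdeg th)%N) ->
  indseq (fun y => [\/ F y, exists u, u.2 <> o /\ y = dv v u
             | exists w, (mdeg w.1 < T + s)%N /\ y = dv eta w])
    (map (fun th => dapp th (- \sum_(i | i != o) v i * ev i)) Y).
Proof.
move=> uY hY.
pose c := \sum_(i | (i != o) && (i != i0)) v i * ev i.
have -> : (fun th => dapp th (- \sum_(i | i != o) v i * ev i)) =
    (fun th => - dapp th (v i0 * ev i0 + c)).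
  by apply/funext => th; rewrite dappN (bigD1 i0).
apply: indseq_opp.
pose Ae : E -> Prop := fun y => F y \/ exists w, y = dv eta w.
pose H := fgen (fun y => Ae y \/ exists u, u.2 <> i0 /\ y = dv v u).
pose H0 : E -> Prop := fun y => (F y \/ exists w, (mdeg w.1 < T + s)%N /\ y = dv eta w) \/
  exists u, (u.2 <> o /\ u.2 <> i0) /\ y = dv v u.
have hH : is_subfield H by apply: fgen_subfield.
have dH : dclosed H.
  apply: fgen_dclosed => i y [[Fy|[w ->]]|[u [hu ->]]].
  - by left; left; apply: dF.
  - by left; right; exists (shift (ucm i) w); rewrite dv_shift dapp_ucm.
  - by right; exists (shift (ucm i) u); rewrite dv_shift dapp_ucm.
have H0H y : H0 y -> H y.
  case=> [[Fy|[w [_ ->]]]|[u [[_ hu] ->]]]; apply: fgen_in.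
  - by left; left.
  - by left; right; exists w.
  - by right; exists u.
have Hev i : H (ev i).
  apply: fgen_mono (mon_eval_upto i) => y [Fy|[w [_ ->]]]; first by left; left.
  by left; right; exists w.
have Hc : H c.
  apply: (sf_sum hH) => i /andP[_ ii0]; apply: (sfM hH) => //; apply: fgen_in; right.
  by exists (mone, i); rewrite /dv dapp1; split=> //; apply/eqP.
have iv X : uniq X -> indseq H (map (fun th => dapp th (v i0)) X).
  move=> uX.
  have -> : map (fun th => dapp th (v i0)) X = map (dv v) [seq (th, i0) | th <- X].
    by rewrite -map_comp.
  apply: (@indseq_mono _ _ (fun y => Ae y \/ exists u, u.2 <> i0 /\ y = dv v u)).
    by move=> y; apply: fgen_acl.
  apply: (indseq_family_split (P := fun u => u.2 <> i0) hv).
    by rewrite map_inj_uniq // => a b [].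
  by move=> _ /mapP[th _ ->] /=; apply.
have ix X : uniq X -> (forall th, th \in X -> (T <= mdeg th)%N) ->
    indseq H0 (map (fun th => dapp th (ev i0)) X).
  move=> uX hX.
  have := indseq_monomial charE dF hj0 M1 Mj uX hX; rewrite Mo => h.
  apply: (indseq_over (B := Ae) (P := fun u => u.2 <> o /\ u.2 <> i0) _ _ h).
  - by move=> y [Fy|[w [_ ->]]]; apply: acl_in; [left|right; exists w].
  - move=> _ /mapP[th _ ->]; apply: fgen_acl.
    apply: fgen_mono (upto_dapp hF th (mon_eval_upto i0)) => y [Fy|[w [_ ->]]].
      by left.
    by right; exists w.
  - by move=> Z uZ _; apply: hv.
have lowx th : (mdeg th < T)%N -> fgen H0 (dapp th (ev i0)).
  move=> hth; apply: fgen_mono (upto_dapp hF th (mon_eval_upto i0)).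
  move=> y [Fy|[w [hw ->]]]; first by left; left.
  left; right; exists w; split=> //; apply: leq_ltn_trans hw _.
  by rewrite addnC ltn_add2r.
have := indseq_generic_line charE dH H0H (Hev i0) Hc iv ix lowx uY hY.
apply: indseq_mono => y [Fy|[u [hu ->]]|[w [hw ->]]]; apply: acl_in.
- by left; left; left.
- case: (eqVneq u.2 i0) => [e|/eqP ne].
    by right; exists u.1; rewrite /dv e.
  by left; right; exists u.
- by left; left; right; exists w.
Qed.

End QuasiGenericValue.

(** * The polynomial ring is a domain *)

Section MonoidAlgebra.
Variables (J : choiceType) (R : comNzRingType).

Lemma mkmalgE c (M : {cmonom J}) : << c *g M >> = c%:MP * << M >> :> {malg R[{cmonom J}]}.
Proof. by apply/malgP => k; rewrite [RHS]mcoeffCM [LHS]mcoeffU [in RHS]mcoeffU mulrnAr mulr1. Qed.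

Lemma mkmalgM (M N : {cmonom J}) :
  << mmul M N >> = << M >> * << N >> :> {malg R[{cmonom J}]}.
Proof. by rewrite [RHS]malgM_def fgmulUU mulr1. Qed.

Lemma malg_ind (P : {malg R[{cmonom J}]} -> Prop) :
  (forall c, P c%:MP) -> (forall v, P << ucm v >>) ->
  (forall p q, P p -> P q -> P (p + q)) ->
  (forall p q, P p -> P q -> P (p * q)) -> forall p, P p.
Proof.
move=> PC PV PD PM p; rewrite [p]monalgE.
apply: big_ind => [||M _]; [by rewrite -malgC0E; apply: PC | exact: PD|].
rewrite mkmalgE; apply: (PM _ _ (PC _)).
elim/cmonom_ind: M => [|v M IH]; first exact: (PC 1).
rewrite mkmalgM; exact: (PM _ _ (PV v) IH).
Qed.
End MonoidAlgebra.

Section Domain.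
Variables (E : fieldType) (J : choiceType) (charE : [pchar E] =i pred0).

(** Formal sums are as in [indseq_sum0]. The coordinates of the point are
    found one after the other, each avoiding the roots of a product of two
    polynomials. *)
Lemma nonvanish_at (X : seq J) (T1 T2 : Type) : uniq X ->
  forall (ts1 : seq T1) (ts2 : seq T2) (c1 : T1 -> E) (c2 : T2 -> E)
    (k1 : T1 -> J -> nat) (k2 : T2 -> J -> nat) (e1 e2 : J -> nat),
  \sum_(t <- ts1 | all (fun v => k1 t v == e1 v) X) c1 t != 0 ->
  \sum_(t <- ts2 | all (fun v => k2 t v == e2 v) X) c2 t != 0 ->
  exists g : J -> E, \sum_(t <- ts1) c1 t * \prod_(v <- X) g v ^+ k1 t v != 0 /\
    \sum_(t <- ts2) c2 t * \prod_(v <- X) g v ^+ k2 t v != 0.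
Proof.
elim: X => [|v X IH] /= uX ts1 ts2 c1 c2 k1 k2 e1 e2 h1 h2.
  exists (fun=> 0); split; [apply: contraNneq h1 | apply: contraNneq h2] => e;
    by rewrite -[X in _ == X]e; apply/eqP/eq_big => // t _; rewrite big_nil mulr1.
case/andP: uX => vX uX.
have [||g [g1 g2]] := IH uX [seq t <- ts1 | k1 t v == e1 v]
    [seq t <- ts2 | k2 t v == e2 v] c1 c2 k1 k2 e1 e2.
- by rewrite big_filter_cond.
- by rewrite big_filter_cond.
have key (T : Type) (ts : seq T) (c : T -> E) (k : T -> J -> nat) e :
    \sum_(t <- [seq t <- ts | k t v == e]) c t * \prod_(w <- X) g w ^+ k t w != 0 ->
    exists2 q : {poly E}, q != 0 & forall z, q.[z] =
      \sum_(t <- ts) c t * \prod_(w <- v :: X) (if w == v then z else g w) ^+ k t w.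
  move=> h; exists (\sum_(t <- ts) (c t * \prod_(w <- X) g w ^+ k t w) *: 'X^(k t v)).
    apply: contraNneq h => q0; rewrite big_filter big_mkcond.
    have := congr1 (fun q : {poly E} => q`_e) q0; rewrite coef0 coef_sum => h.
    rewrite -[X in _ == X]h; apply/eqP/eq_bigr => t _.
    by rewrite coefZ coefXn eq_sym; case: eqP; rewrite ?mulr1 ?mulr0.
  move=> z; rewrite horner_sum; apply: eq_bigr => t _.
  rewrite hornerZ hornerXn big_cons eqxx -mulrA [X in c t * X]mulrC; congr (_ * (_ * _)).
  apply: eq_big_seq => w wX; case: eqP => // wv; by rewrite -wv wX in vX.
have [q1 q1n e1'] := key _ _ _ _ _ g1; have [q2 q2n e2'] := key _ _ _ _ _ g2.
have [z hz] := poly_nonroot charE (mulf_neq0 q1n q2n).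
exists (fun w => if w == v then z else g w); rewrite -e1' -e2'.
by move: hz; rewrite hornerM mulf_eq0 negb_or => /andP.
Qed.

(** At a point where neither factor vanishes, the product does not vanish. *)
Lemma malg_domain (p q : {malg E[{cmonom J}]}) : p * q = 0 -> (p == 0) || (q == 0).
Proof.
move=> pq; apply: contraT; rewrite negb_or => /andP[p0 q0].
pose X := undup (flatten [seq (finsupp (cmonom_val M) : seq J) | M : {cmonom J} <-
  (msupp p : seq _) ++ msupp q]).
have uX : uniq X by apply: undup_uniq.
have sX M : M \in (msupp p : seq _) ++ msupp q -> {subset finsupp M <= X}.
  move=> hM v hv; rewrite mem_undup; apply/flatten_mapP; by exists M.
have ex (r : {malg E[{cmonom J}]}) : r != 0 ->
    {subset (msupp r : seq {cmonom J}) <= (msupp p : seq _) ++ msupp q} ->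
    (exists M0 : {cmonom J}, \sum_(M <- msupp r | all (fun v => M v == M0 v) X) r@_M != 0)
    /\ forall g, mmap idfun (mon_eval g) r =
      \sum_(M <- msupp r) r@_M * \prod_(v <- X) g v ^+ M v.
  move=> r0 sr; split; last first.
    by move=> g; apply: eq_big_seq => M hM; rewrite (mon_evalEw _ uX) //; apply/sX/sr.
  have [M0 hM0] : exists M0, M0 \in msupp r.
    apply: contrapT => h; case/negP: r0; apply/eqP/malgP => k; rewrite mcoeff0.
    by apply: mcoeff_outdom; apply/negP => hk; apply: h; exists k.
  exists M0; rewrite mcoeff_sum_vars ?mcoeff_neq0 // => M /sr; exact: sX.
have subp : {subset (msupp p : seq _) <= (msupp p : seq _) ++ msupp q}.
  by move=> x xp; rewrite mem_cat xp.
have subq : {subset (msupp q : seq _) <= (msupp p : seq _) ++ msupp q}.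
  by move=> x xq; rewrite mem_cat xq orbT.
have [[M1 h1] ep] : _ /\ _ := ex p p0 subp.
have [[M2 h2] eq] : _ /\ _ := ex q q0 subq.
have [g [g1 g2]] := nonvanish_at uX h1 h2.
have := @mevalM E E J idfun g p q; rewrite pq rmorph0 ep eq => /esym/eqP.
by rewrite mulf_eq0 (negPf g1) (negPf g2).
Qed.

(** A copy of the polynomial ring that depends on the proof of characteristic
    0, to carry the structure of an integral domain. *)
Definition poly_dom of [pchar E] =i pred0 := {malg E[{cmonom J}]}.
Local Notation R := (poly_dom charE).
HB.instance Definition _ := GRing.ComNzRing.on R.

Let unit : {pred R} := fun p => `[< exists q, q * p = 1 >].
Let inv (p : R) : R := if pselect (exists q : R, q * p = 1) is left h
  then projT1 (cid h) else p.

Fact poly_dom_mulVx : {in unit, left_inverse 1 inv *%R}.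
Proof.
by move=> p /asboolP h; rewrite /inv; case: pselect => // h'; apply: (projT2 (cid h')).
Qed.
Fact poly_dom_unitPl (p q : R) : q * p = 1 -> unit p.
Proof. by move=> h; apply/asboolP; exists q. Qed.
Fact poly_dom_invr_out : {in [predC unit], inv =1 id}.
Proof.
by move=> p; rewrite inE => /asboolP h; rewrite /inv; case: pselect.
Qed.
HB.instance Definition _ := GRing.ComNzRing_hasMulInverse.Build R
  poly_dom_mulVx poly_dom_unitPl poly_dom_invr_out.
HB.instance Definition _ := GRing.ComUnitRing_isIntegral.Build R malg_domain.

End Domain.

(** * Derivations of polynomials and of fractions *)

Section Dual.
Variable R : comNzRingType.

(** Dual numbers: a ring morphism into them whose first component is the
    identity has a derivation as second component. The derivation of a
    polynomial ring is obtained in this way from the universal property. *)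
Definition dual := (R * R)%type.
HB.instance Definition _ := GRing.Zmodule.on dual.

Definition dual_one : dual := (1, 0).
Definition dual_mul (x y : dual) : dual := (x.1 * y.1, x.1 * y.2 + x.2 * y.1).

Fact dual_mulA : associative dual_mul.
Proof. by move=> x y z; congr (_, _); rewrite /=; ring. Qed.
Fact dual_mulC : commutative dual_mul.
Proof. by move=> x y; congr (_, _); rewrite /=; ring. Qed.
Fact dual_mul1 : left_id dual_one dual_mul.
Proof. by move=> [x y]; congr (_, _); rewrite /=; ring. Qed.
Fact dual_mulDl : left_distributive dual_mul +%R.
Proof. by move=> x y z; congr (_, _); rewrite /=; ring. Qed.
Fact dual_one_neq0 : dual_one != 0.
Proof. by apply/eqP => /(congr1 fst) /eqP; rewrite oner_eq0. Qed.
HB.instance Definition _ := GRing.Zmodule_isComNzRing.Build dual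
  dual_mulA dual_mulC dual_mul1 dual_mulDl dual_one_neq0.

Lemma dualM1 (x y : dual) : (x * y).1 = x.1 * y.1. Proof. by []. Qed.
Lemma dualM2 (x y : dual) : (x * y).2 = x.1 * y.2 + x.2 * y.1. Proof. by []. Qed.
Lemma dualD1 (x y : dual) : (x + y).1 = x.1 + y.1. Proof. by []. Qed.
Lemma dualD2 (x y : dual) : (x + y).2 = x.2 + y.2. Proof. by []. Qed.
End Dual.

Section PolyDer.
Variables (E : fieldType) (J : choiceType) (d : E -> E) (sigma : J -> J).
Hypotheses (dD : forall x y, d (x + y) = d x + d y)
  (dM : forall x y, d (x * y) = d x * y + x * d y).
Let R := {malg E[{cmonom J}]}.

Let d0 : d 0 = 0.
Proof.
have := dD 0 0; rewrite addr0 => /(congr1 (fun z => z - d 0)).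
by rewrite subrr addrK => <-.
Qed.
Let d1 : d 1 = 0.
Proof.
have := dM 1 1; rewrite !mulr1 mul1r => /(congr1 (fun z => z - d 1)).
by rewrite subrr addrK => <-.
Qed.
Let dB x y : d (x - y) = d x - d y.
Proof. by apply/eqP; rewrite eq_sym subr_eq -dD subrK. Qed.

Definition to_dual (c : E) : dual R := (c%:MP, (d c)%:MP).

Fact to_dualB : zmod_morphism to_dual.
Proof. by move=> x y; congr (_, _); rewrite ?dB rmorphB. Qed.
Fact to_dualM : monoid_morphism to_dual.
Proof.
split; first by congr (_, _); rewrite d1 malgC0E.
move=> x y; congr (_, _); first exact: mpolyCM.
rewrite dM raddfD /= addrC; congr (_ + _); exact: mpolyCM.
Qed.
HB.instance Definition _ := GRing.isZmodMorphism.Build E (dual R) to_dual to_dualB.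
HB.instance Definition _ := GRing.isMonoidMorphism.Build E (dual R) to_dual to_dualM.

Let h (v : J) : dual R := (<< ucm v >>, << ucm (sigma v) >>).
Let Phi (p : R) : dual R := mmap to_dual (mon_eval h) p.

Let PhiC c : Phi c%:MP = to_dual c. Proof. by rewrite /Phi mevalC. Qed.
Let PhiV v : Phi << ucm v >> = h v. Proof. by rewrite /Phi mevalV. Qed.
Let PhiD p q : Phi (p + q) = Phi p + Phi q. Proof. by rewrite /Phi mevalD. Qed.
Let PhiM p q : Phi (p * q) = Phi p * Phi q. Proof. by rewrite /Phi mevalM. Qed.
Let Phi1 p : (Phi p).1 = p.
Proof.
elim/malg_ind: p => [c|v|p q hp hq|p q hp hq].
- by rewrite PhiC.
- by rewrite PhiV.
- exact: (etrans (congr1 fst (PhiD p q))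
    (etrans (dualD1 (Phi p) (Phi q)) (congr2 +%R hp hq))).
- exact: (etrans (congr1 fst (PhiM p q))
    (etrans (dualM1 (Phi p) (Phi q)) (congr2 *%R hp hq))).
Qed.

Definition pder (p : R) : R := (Phi p).2.

Lemma pderC c : pder c%:MP = (d c)%:MP. Proof. by rewrite /pder PhiC. Qed.
Lemma pderV v : pder << ucm v >> = << ucm (sigma v) >>. Proof. by rewrite /pder PhiV. Qed.
Lemma pderD p q : pder (p + q) = pder p + pder q.
Proof. exact: (etrans (congr1 snd (PhiD p q)) (dualD2 (Phi p) (Phi q))). Qed.
Lemma pderM p q : pder (p * q) = pder p * q + p * pder q.
Proof.
have e : pder (p * q) = (Phi p).1 * (Phi q).2 + (Phi p).2 * (Phi q).1.
  exact: (etrans (congr1 snd (PhiM p q)) (dualM2 (Phi p) (Phi q))).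
exact: (etrans e (etrans (addrC _ _) (congr2 +%R
  (congr2 *%R (erefl (pder p)) (Phi1 q)) (congr2 *%R (Phi1 p) (erefl (pder q)))))).
Qed.
End PolyDer.

Section FieldIdentities.
Variable K : fieldType.
Implicit Types n d a b : K.

Lemma quotient_rule n d a b n' d' a' b' : d != 0 -> b != 0 -> n / d = a / b ->
  n' * b + n * b' = a' * d + a * d' ->
  (a' * b - a * b') / b ^+ 2 = (n' * d - n * d') / d ^+ 2.
Proof.
move=> d0 b0 e e'; have e1 : n = a / b * d by rewrite -e divfK.
have e2 : n' = (a' * d + a * d' - n * b') / b by rewrite -e' addrK mulfK.
by rewrite e2 e1; field; rewrite d0 b0.
Qed.

Lemma quotient_cross n d a b : d != 0 -> b != 0 -> n / d = a / b -> n * b = a * d.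
Proof. by move=> d0 b0 /eqP; rewrite eqr_div // => /eqP. Qed.

Lemma quotient_der_add n1 d1 n2 d2 n1' d1' n2' d2' : d1 != 0 -> d2 != 0 ->
  ((n1' * d2 + n1 * d2' + (n2' * d1 + n2 * d1')) * (d1 * d2) -
     (n1 * d2 + n2 * d1) * (d1' * d2 + d1 * d2')) / (d1 * d2) ^+ 2 =
  (n1' * d1 - n1 * d1') / d1 ^+ 2 + (n2' * d2 - n2 * d2') / d2 ^+ 2.
Proof. by move=> h1 h2; field; rewrite h1 h2. Qed.

Lemma quotient_der_mul n1 d1 n2 d2 n1' d1' n2' d2' : d1 != 0 -> d2 != 0 ->
  ((n1' * n2 + n1 * n2') * (d1 * d2) -
     (n1 * n2) * (d1' * d2 + d1 * d2')) / (d1 * d2) ^+ 2 =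
  (n1' * d1 - n1 * d1') / d1 ^+ 2 * (n2 / d2) + n1 / d1 * ((n2' * d2 - n2 * d2') / d2 ^+ 2).
Proof. by move=> h1 h2; field; rewrite h1 h2. Qed.

Lemma quotient_add n1 d1 n2 d2 : d1 != 0 -> d2 != 0 ->
  n1 / d1 + n2 / d2 = (n1 * d2 + n2 * d1) / (d1 * d2).
Proof. by move=> h1 h2; field; rewrite h1 h2. Qed.

Lemma quotient_sub n1 d1 n2 d2 : d1 != 0 -> d2 != 0 ->
  n1 / d1 - n2 / d2 = (n1 * d2 + - (n2 * d1)) / (d1 * d2).
Proof. by move=> h1 h2; field; rewrite h1 h2. Qed.
End FieldIdentities.

Section CommutingDerivations.
Variables (R : comNzRingType) (d1 d2 : R -> R).
Hypotheses (dD1 : forall x y, d1 (x + y) = d1 x + d1 y)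
  (dM1 : forall x y, d1 (x * y) = d1 x * y + x * d1 y)
  (dD2 : forall x y, d2 (x + y) = d2 x + d2 y)
  (dM2 : forall x y, d2 (x * y) = d2 x * y + x * d2 y).

Lemma der_comm_add x y : d1 (d2 x) = d2 (d1 x) -> d1 (d2 y) = d2 (d1 y) ->
  d1 (d2 (x + y)) = d2 (d1 (x + y)).
Proof. by move=> hx hy; rewrite dD1 dD2 dD1 dD2 hx hy. Qed.

Lemma der_comm_mul x y : d1 (d2 x) = d2 (d1 x) -> d1 (d2 y) = d2 (d1 y) ->
  d1 (d2 (x * y)) = d2 (d1 (x * y)).
Proof. by move=> hx hy; rewrite dM1 dM2 dD1 dD2 !dM1 !dM2 hx hy; ring. Qed.
End CommutingDerivations.

Section FracDer.
Variables (R : idomainType) (D : R -> R).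
Hypotheses (DD : forall x y, D (x + y) = D x + D y)
  (DM : forall x y, D (x * y) = D x * y + x * D y).
Local Notation K := {fraction R}.
Local Notation "x %:F" := (@FracField.tofrac R x).

Lemma fraction_rep (x : K) : exists nd : R * R, nd.2 != 0 /\ x = nd.1%:F / nd.2%:F.
Proof.
elim/quotW: x => r; exists (frac r); split; first exact: denom_ratioP.
unlock FracField.tofrac; rewrite -[_^-1]FracField.pi_inv -[RHS]FracField.pi_mul.
rewrite /FracField.mulf /FracField.invf !numden_Ratio ?oner_neq0 ?denom_ratioP //.
by rewrite mulr1 mul1r FracField.Ratio_numden.
Qed.

Let num (x : K) := (projT1 (cid (fraction_rep x))).1.
Let den (x : K) := (projT1 (cid (fraction_rep x))).2.
Let den0 x : den x != 0. Proof. by case: (projT2 (cid (fraction_rep x))). Qed.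
Let numden x : x = (num x)%:F / (den x)%:F.
Proof. by case: (projT2 (cid (fraction_rep x))). Qed.

(** A representation as a fraction is chosen; by [fderE] the choice does not
    matter. *)
Definition fder (x : K) : K :=
  ((D (num x))%:F * (den x)%:F - (num x)%:F * (D (den x))%:F) / (den x)%:F ^+ 2.

Lemma fderE n d : d != 0 ->
  fder (n%:F / d%:F) = ((D n)%:F * d%:F - n%:F * (D d)%:F) / d%:F ^+ 2.
Proof.
move=> d0; set x := n%:F / d%:F; have e := numden x; have b0 := den0 x.
rewrite /fder; set a := num x in e *; set b := den x in e b0 *.
have d0' : d%:F != 0 by rewrite tofrac_eq0.
have b0' : b%:F != 0 by rewrite tofrac_eq0.
have e2 : n * b = a * d.
  apply/eqP; rewrite -tofrac_eq; apply/eqP; rewrite (tofracM n) (tofracM a).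
  exact: quotient_cross d0' b0' e.
have e3 : (D n)%:F * b%:F + n%:F * (D b)%:F = (D a)%:F * d%:F + a%:F * (D d)%:F.
  by rewrite -!tofracM -!tofracD -!DM e2.
exact: quotient_rule d0' b0' e e3.
Qed.

Lemma fderD x y : fder (x + y) = fder x + fder y.
Proof.
have [[n1 d1] /= [d10 ->]] := fraction_rep x; have [[n2 d2] /= [d20 ->]] := fraction_rep y.
have d10' : d1%:F != 0 by rewrite tofrac_eq0.
have d20' : d2%:F != 0 by rewrite tofrac_eq0.
rewrite (quotient_add _ _ d10' d20') -!tofracM -tofracD.
rewrite (fderE _ d10) (fderE _ d20) (fderE _ (mulf_neq0 d10 d20)).
rewrite DD !DM !tofracD !tofracM; exact: quotient_der_add.
Qed.

Lemma fderM x y : fder (x * y) = fder x * y + x * fder y.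
Proof.
have [[n1 d1] /= [d10 ->]] := fraction_rep x; have [[n2 d2] /= [d20 ->]] := fraction_rep y.
have d10' : d1%:F != 0 by rewrite tofrac_eq0.
have d20' : d2%:F != 0 by rewrite tofrac_eq0.
rewrite mulf_div -!tofracM.
rewrite (fderE _ d10) (fderE _ d20) (fderE _ (mulf_neq0 d10 d20)).
rewrite !DM !tofracD !tofracM; exact: quotient_der_mul.
Qed.

Lemma fder_tofrac p : fder p%:F = (D p)%:F.
Proof.
have D1 : D 1 = 0.
  have := DM 1 1; rewrite !mulr1 mul1r => /(congr1 (fun z => z - D 1)).
  by rewrite subrr addrK => <-.
rewrite -[p%:F]divr1 -tofrac1 fderE ?oner_neq0 // D1 tofrac1 tofrac0.
by rewrite mulr1 mulr0 subr0 expr1n divr1.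
Qed.
End FracDer.

(** The commutator of two derivations is a derivation. It vanishes on the
    ring, hence on fractions. *)
Lemma fder_comm (R : idomainType) (D1 D2 : R -> R)
  (DD1 : forall x y, D1 (x + y) = D1 x + D1 y)
  (DM1 : forall x y, D1 (x * y) = D1 x * y + x * D1 y)
  (DD2 : forall x y, D2 (x + y) = D2 x + D2 y)
  (DM2 : forall x y, D2 (x * y) = D2 x * y + x * D2 y) :
  (forall x, D1 (D2 x) = D2 (D1 x)) ->
  forall x : {fraction R}, fder D1 (fder D2 x) = fder D2 (fder D1 x).
Proof.
move=> DC x.
pose C (y : {fraction R}) := fder D1 (fder D2 y) - fder D2 (fder D1 y).
have CM y z : C (y * z) = C y * z + y * C z.
  rewrite /C (fderM DM1) (fderM DM2) (fderD DD1 DM1) (fderD DD2 DM2).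
  rewrite !(fderM DM1) !(fderM DM2).
  move: (fder D1 (fder D2 y)) (fder D1 (fder D2 z)) (fder D2 (fder D1 y))
    (fder D2 (fder D1 z)) (fder D1 y) (fder D1 z) (fder D2 y) (fder D2 z).
  by move=> a1 a2 a3 a4 a5 a6 a7 a8; ring.
have C0 p : C (FracField.tofrac p) = 0.
  by rewrite /C !(fder_tofrac DM1, fder_tofrac DM2) DC subrr.
have [[n d] /= [d0 ->]] := fraction_rep x.
have d0' : FracField.tofrac d != 0 by rewrite tofrac_eq0.
apply/eqP; rewrite -subr_eq0 -/(C _); apply/eqP.
apply: (mulIf d0'); rewrite mul0r.
have := CM (FracField.tofrac n / FracField.tofrac d) (FracField.tofrac d).
by rewrite divfK // !C0 mulr0 addr0 => <-.
Qed.

(** * Delta-rational functions *)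

Section RationalFunctions.
Variables (m : nat) (E : diffFieldType m) (I : choiceType) (charE : [pchar E] =i pred0).
Let Jv := deriv_var m I.
Let R := poly_dom Jv charE.

Let sg (i : 'I_m) (v : Jv) : Jv := (mmul (ucm i) v.1, v.2).
Let D i : R -> R := pder (der i) (sg i).
Let DD i x y : D i (x + y) = D i x + D i y.
Proof. exact: pderD (derD i) (derM i) x y. Qed.
Let DM i x y : D i (x * y) = D i x * y + x * D i y.
Proof. exact: pderM (derD i) (derM i) x y. Qed.
Let DCst i c : D i c%:MP = (der i c)%:MP.
Proof. exact: pderC (derD i) (derM i) c. Qed.
Let DVar i v : D i << ucm v >> = << ucm (sg i v) >>.
Proof. exact: pderV (derD i) (derM i) v. Qed.
Let DC i j x : D i (D j x) = D j (D i x).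
Proof.
elim/malg_ind: x => [c|v|p q hp hq|p q hp hq].
- exact: (etrans (congr1 (D i) (DCst j c)) (etrans (DCst i _)
    (etrans (congr1 (fun z => z%:MP) (derC i j c))
      (esym (etrans (congr1 (D j) (DCst i c)) (DCst j _)))))).
- have e : sg i (sg j v) = sg j (sg i v) by rewrite /sg /= !mulmA [mmul (ucm i) _]mulmC.
  exact: (etrans (congr1 (D i) (DVar j v)) (etrans (DVar i _)
    (etrans (congr1 (fun w => << ucm w >>) e)
      (esym (etrans (congr1 (D j) (DVar i v)) (DVar j _)))))).
- exact: (@der_comm_add R (D i) (D j) (DD i) (DD j) p q hp hq).
- exact: (@der_comm_mul R (D i) (D j) (DD i) (DM i) (DD j) (DM j) p q hp hq).
Qed.

(** The field of Delta-rational functions over E in Delta-indeterminates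
    indexed by [I]. *)
Definition rat_field : diffFieldType m :=
  @DiffField m {fraction R} (fun i => fder (D i)) (fun i => fderD (DD i) (DM i))
    (fun i => fderM (DM i)) (fun i j => fder_comm (DD i) (DM i) (DD j) (DM j) (DC i j)).

Definition rat_const (c : E) : rat_field := FracField.tofrac (c%:MP : R).
Definition rat_var (i : I) : rat_field := FracField.tofrac (<< ucm ((mone, i) : Jv) >> : R).

Lemma rat_const_hom : delta_hom_on (fun=> True) rat_const.
Proof.
split.
- exact: tofrac1.
- by move=> x y _ _; rewrite /rat_const rmorphD tofracD.
- by move=> x y _ _; rewrite /rat_const rmorphM tofracM.
- move=> i x _; rewrite /rat_const /= (fder_tofrac (DM i)).
  exact: (congr1 (@FracField.tofrac R) (esym (DCst i x))).
Qed.

Lemma dapp_rat_var th i :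
  dapp th (rat_var i) = FracField.tofrac (<< ucm ((th, i) : Jv) >> : R).
Proof.
elim/cmonom_ind: th => [|k th IH]; first by rewrite dapp1.
rewrite dappU IH /= (fder_tofrac (DM k)).
exact: (congr1 (@FracField.tofrac R) (DVar k (th, i))).
Qed.

Lemma rat_char : [pchar rat_field] =i pred0.
Proof.
apply/(pcharf0P rat_field) => n.
have -> : (n%:R : rat_field) = rat_const n%:R.
  by rewrite /rat_const !rmorph_nat.
rewrite /rat_const tofrac_eq0 -((pcharf0P E).1 charE n).
by rewrite -malgC0E malgC_eq.
Qed.

Lemma rat_var_indep :
  alg_indep (img rat_const (fun=> True)) (fun v : Jv => dapp v.1 (rat_var v.2)).
Proof.
move=> p hp p0.
have /choice[c hc] : forall k, exists c, p@_k = rat_const c.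
  by move=> k; have [c _ e] := hp k; exists c.
pose q : R := \sum_(k <- msupp p) << c k *g k >>.
have q0 : q = 0.
  apply/eqP; rewrite -tofrac_eq0; apply/eqP; rewrite -[RHS]p0.
  rewrite /q rmorph_sum; apply: eq_bigr => k _.
  have -> : << c k *g k >> = (c k)%:MP * << k >> :> R by apply: mkmalgE.
  rewrite rmorphM hc; congr (_ * _).
  elim/cmonom_ind: k => [|v k IH].
    rewrite mmorph1; exact: tofrac1.
  rewrite mmorphM /= mon_evalU -IH dapp_rat_var -surjective_pairing -tofracM.
  congr FracField.tofrac; exact: mkmalgM.
apply/malgP => k; rewrite mcoeff0; case: (boolP (k \in msupp p)) => [hk|/mcoeff_outdom//].
have : q@_k = 0 by rewrite q0 mcoeff0.
rewrite /q mcoeff_sum_formal ?fset_uniq // hk hc => ->.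
by rewrite /rat_const malgC0E tofrac0.
Qed.

End RationalFunctions.

Lemma alg_indep_rmorph (S E : fieldType) (f : {rmorphism S -> E}) (K : E -> Prop)
  (J : choiceType) (g : J -> E) : (forall s, K (f s)) -> alg_indep K g ->
  forall p : {malg S[{cmonom J}]}, mmap f (mon_eval g) p = 0 -> p = 0.
Proof.
move=> Kf hg p p0.
pose q : {malg E[{cmonom J}]} := \sum_(k <- msupp p) << f p@_k *g k >>.
have cq k : q@_k = f p@_k.
  rewrite /q mcoeff_sum_formal ?fset_uniq //; case: ifPn => // hk.
  by rewrite (mcoeff_outdom hk) rmorph0.
have q0 : q = 0.
  apply: hg; first by move=> k; rewrite cq.
  rewrite -[RHS]p0 /q rmorph_sum; apply: eq_bigr => k _; exact: mmapU.
apply/malgP => k; rewrite mcoeff0; apply/eqP.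
by rewrite -(fmorph_eq0 f) -cq q0 mcoeff0.
Qed.

(** * Extension of Delta-homomorphisms *)

Lemma dhom_is_hom m (E G : diffFieldType m) (D : E -> Prop) (f : E -> G) :
  delta_hom_on D f -> is_hom D f.
Proof. by case. Qed.

Section DeltaExtension.
Variables (m : nat) (E G : diffFieldType m) (F : E -> Prop) (hF : delta_subfield F).
Variables (iota : E -> G) (hi : delta_hom_on F iota) (I : finType).
Variables (u : I -> E) (z : I -> G).
Hypotheses (hu : alg_indep F (J := deriv_var m I) (dv u))
  (hz : alg_indep (img iota F) (J := deriv_var m I) (dv z)).
Let sF : is_subfield F := delta_subfield_sf hF.
Let dF : dclosed F := proj2 ((delta_subfieldP F).1 hF).
Let S := sf_type sF.

Definition base_hom (x : S) : G := iota (val x).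
Fact base_homB : zmod_morphism base_hom.
Proof. by move=> x y; apply: (homB sF (dhom_is_hom hi)); apply: sf_typeP. Qed.
Fact base_homM : monoid_morphism base_hom.
Proof.
split; first exact: (dhom1 hi).
by move=> x y; apply: (dhomM hi); apply: sf_typeP.
Qed.
HB.instance Definition _ := GRing.isZmodMorphism.Build S G base_hom base_homB.
HB.instance Definition _ := GRing.isMonoidMorphism.Build S G base_hom base_homM.

Let P := {malg S[{cmonom (deriv_var m I)}]}.
Let eu (p : P) : E := mmap (val : S -> E) (mon_eval (dv u)) p.
Let ez (p : P) : G := mmap base_hom (mon_eval (dv z)) p.
Let euD p q : eu (p + q) = eu p + eu q. Proof. exact: mevalD. Qed.
Let euM p q : eu (p * q) = eu p * eu q. Proof. exact: mevalM. Qed.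
Let euN p : eu (- p) = - eu p. Proof. exact: rmorphN. Qed.
Let ezD p q : ez (p + q) = ez p + ez q. Proof. exact: mevalD. Qed.
Let ezM p q : ez (p * q) = ez p * ez q. Proof. exact: mevalM. Qed.
Let ezN p : ez (- p) = - ez p. Proof. exact: rmorphN. Qed.
Let eu0 p : eu p = 0 -> p = 0.
Proof. by apply: (alg_indep_rmorph _ hu) => s; apply: sf_typeP. Qed.
Let ez0 p : ez p = 0 -> p = 0.
Proof.
apply: (alg_indep_rmorph (f := base_hom) _ hz) => s.
by exists (val s) => //; apply: sf_typeP.
Qed.

(** The graph of the extension of [iota] that maps [u] to [z]. It is
    functional because neither family satisfies a relation ([graph_fun]). *)
Inductive graph : E -> G -> Prop :=
| graph_base x : F x -> graph x (iota x)
| graph_var w : graph (dv u w) (dv z w)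
| graphB x y x' y' : graph x y -> graph x' y' -> graph (x - x') (y - y')
| graphM x y x' y' : graph x y -> graph x' y' -> graph (x * x') (y * y')
| graphV x y : graph x y -> graph x^-1 y^-1.

Let rep (x : E) (y : G) := exists p q : P,
  [/\ eu q != 0, ez q != 0, x = eu p / eu q & y = ez p / ez q].

Let mk_rep p q a b c d : eu p = a -> eu q = b -> ez p = c -> ez q = d ->
  b != 0 -> d != 0 -> rep (a / b) (c / d).
Proof. by move=> <- <- <- <- h1 h2; exists p, q. Qed.

Let nz q : q <> 0 -> eu q != 0 /\ ez q != 0.
Proof. by move=> q0; split; apply/eqP => e; apply: q0; [apply: eu0|apply: ez0]. Qed.

Let rep_poly p : rep (eu p) (ez p).
Proof.
have e1 : eu 1 = 1 by exact: rmorph1.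
have z1 : ez 1 = 1 by exact: rmorph1.
by exists p, 1; split; rewrite ?e1 ?z1 ?oner_eq0 ?divr1.
Qed.

Let graph_rep x y : graph x y -> rep x y.
Proof.
elim=> {x y} [x Fx|w|x y x' y' _ [p [q [q1 q2 -> ->]]] _ [p' [q' [q1' q2' -> ->]]]
  |x y x' y' _ [p [q [q1 q2 -> ->]]] _ [p' [q' [q1' q2' -> ->]]]
  |x y _ [p [q [q1 q2 -> ->]]]].
- have := rep_poly ((sf_of sF Fx)%:MP).
  have -> : eu (sf_of sF Fx)%:MP = x by exact: mevalC.
  by have -> : ez (sf_of sF Fx)%:MP = iota x by exact: mevalC.
- have := rep_poly << ucm w >>.
  have -> : eu << ucm w >> = dv u w by exact: mevalV.
  by have -> : ez << ucm w >> = dv z w by exact: mevalV.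
- rewrite (quotient_sub _ _ q1 q1') (quotient_sub _ _ q2 q2').
  apply: (@mk_rep (p * q' + - (p' * q)) (q * q')); try exact: mulf_neq0.
  + exact: etrans (euD _ _) (congr2 +%R (euM _ _) (etrans (euN _) (congr1 -%R (euM _ _)))).
  + exact: euM.
  + exact: etrans (ezD _ _) (congr2 +%R (ezM _ _) (etrans (ezN _) (congr1 -%R (ezM _ _)))).
  + exact: ezM.
- rewrite !mulf_div.
  by apply: (@mk_rep (p * p') (q * q')); try exact: mulf_neq0;
    try exact: euM; try exact: ezM.
- case: (pselect (p = 0)) => [->|/nz[p1 p2]].
    have u0 : eu 0 = 0 by exact: rmorph0.
    have z0 : ez 0 = 0 by exact: rmorph0.
    have := rep_poly 0; rewrite u0 z0 !mul0r !invr0; exact.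
  by exists q, p; rewrite !invf_div.
Qed.

Let graph_fun x y y' : graph x y -> graph x y' -> y = y'.
Proof.
move=> h h'; apply/eqP; rewrite -subr_eq0; have /graph_rep := graphB h h'.
case=> p [q [q1 q2 e ->]]; move: e; rewrite subrr => /esym/eqP.
rewrite mulf_eq0 invr_eq0 (negPf q1) orbF => /eqP/eu0->.
have -> : ez 0 = 0 by exact: rmorph0.
by rewrite mul0r.
Qed.

Let graph1 : graph 1 1.
Proof. by rewrite -(dhom1 hi); apply: graph_base; apply: sf1 sF. Qed.

Let graphN x y : graph x y -> graph (- x) (- y).
Proof.
move=> h; have := graphB (graphB h h) h; by rewrite !subrr !sub0r.
Qed.

Let graphD x y x' y' : graph x y -> graph x' y' -> graph (x + x') (y + y').
Proof. by move=> h /graphN /(graphB h); rewrite !opprK. Qed.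

Let graph_total x : delta_adjoin F (range_of u) x -> exists y, graph x y.
Proof.
rewrite delta_adjoinE // => h.
elim: h => {x} [x [Fx|[th [_ [[i ->] ->]]]]||x x' _ [y hy] _ [y' hy']|x x' _ [y hy] _ [y' hy']
  |x _ [y hy]].
- by exists (iota x); apply: graph_base.
- by exists (dv z (th, i)); apply: (graph_var (th, i)).
- by exists 1.
- by exists (y - y'); apply: graphB.
- by exists (y * y'); apply: graphM.
- by exists y^-1; apply: graphV.
Qed.

Let graph_der i x y : graph x y -> graph (der i x) (der i y).
Proof.
elim=> {x y} [x Fx|w|x y x' y' h ih h' ih'|x y x' y' h ih h' ih'|x y h ih].
- by rewrite -(dhom_der hi i Fx); apply: graph_base; apply: dF.
- rewrite -!dapp_ucm -!dv_shift; exact: graph_var.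
- by rewrite !derB; apply: graphB.
- by rewrite !derM; apply: graphD; apply: graphM.
- rewrite !derV; apply: graphM; first exact: graphN.
  by apply: graphV; rewrite !expr2; apply: graphM.
Qed.

(** F<u> is the field of rational functions in the derivatives of [u], so that
    [u] can be mapped to any Delta-independent family. *)
Lemma delta_hom_extend : exists j : E -> G,
  [/\ delta_hom_on (delta_adjoin F (range_of u)) j,
      forall x, F x -> j x = iota x & forall i, j (u i) = z i].
Proof.
have /choice[j hj] : forall x, exists y, delta_adjoin F (range_of u) x -> graph x y.
  move=> x; case: (pselect (delta_adjoin F (range_of u) x)) => [/graph_total[y hy]|n].
    by exists y.
  by exists 0.
have hU := delta_adjoin_subfield F (range_of u).
have jE x y : delta_adjoin F (range_of u) x -> graph x y -> j x = y.
  by move=> hx; apply: graph_fun; apply: hj.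
have FU x : F x -> delta_adjoin F (range_of u) x by apply: delta_adjoin_in.
have uU i : delta_adjoin F (range_of u) (u i) by apply: delta_adjoin_gen; exists i.
exists j; split.
- split.
  + by apply: jE => //; apply: dsub1 hU.
  + move=> x y hx hy; apply: jE; last by apply: graphD; apply: hj.
    exact: (sfD (delta_subfield_sf hU)).
  + move=> x y hx hy; apply: jE; last by apply: graphM; apply: hj.
    exact: (dsubM hU).
  + move=> i x hx; apply: jE; last by apply: graph_der; apply: hj.
    exact: (dsub_der hU).
- by move=> x Fx; apply: jE; [apply: FU | apply: graph_base].
- move=> i; apply: jE => //.
  by have := graph_var (mone, i); rewrite /dv !dapp1.
Qed.
End DeltaExtension.

Section SubDiffField.
Variables (m : nat) (E : diffFieldType m) (D : E -> Prop) (hD : delta_subfield D).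
Let sD : is_subfield D := delta_subfield_sf hD.
Let S := sf_type sD.
Let sder (i : 'I_m) (x : S) : S := sf_of sD (dsub_der hD i (sf_typeP x)).

Definition sub_diff : diffFieldType m.
Proof.
refine (@DiffField m S sder _ _ _).
- by move=> i x y; apply: val_inj; rewrite /= derD.
- by move=> i x y; apply: val_inj; rewrite /= derM.
- by move=> i j x; apply: val_inj; rewrite /= derC.
Defined.

Definition sub_val (x : sub_diff) : E := val (x : S).
Definition sub_in x (Dx : D x) : sub_diff := sf_of sD Dx.

Lemma sub_val_inj : injective sub_val. Proof. exact: val_inj. Qed.
Lemma sub_valP x : D (sub_val x). Proof. exact: sf_typeP. Qed.
Lemma sub_val_hom : delta_hom_on (fun=> True) sub_val.
Proof. by []. Qed.
End SubDiffField.

(** Universality speaks of fields that are finitely generated over F<a>; G is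
    replaced by its Delta-subfield generated by the image of [j] and by [b]. *)
Lemma universal_extend m (E G : diffFieldType m) (F : E -> Prop)
    (k l : nat) (a : 'I_k -> E) (j : E -> G) (b : 'I_l -> G) :
  universal_over F -> delta_hom_on (delta_adjoin F (range_of a)) j ->
  exists2 chi : G -> E,
    delta_hom_on (delta_adjoin (img j (delta_adjoin F (range_of a))) (range_of b)) chi &
    forall x, delta_adjoin F (range_of a) x -> chi (j x) = x.
Proof.
move=> univ hj; set F1 := delta_adjoin F (range_of a) in hj *.
set D := delta_adjoin _ _.
have hD : delta_subfield D := delta_adjoin_subfield _ _.
pose G' := sub_diff hD.
have jD x : F1 x -> D (j x) by move=> Fx L _ h _; apply: h; apply: imgP.
have bD i : D (b i) by move=> L _ _ h; apply: h; exists i.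
pose sec (y : G) : G' := if pselect (D y) is left Dy then sub_in hD Dy else 0.
have secK y : D y -> sub_val (sec y) = y.
  by move=> Dy; rewrite /sec; case: pselect.
have [v1 vD vM vd] := sub_val_hom hD.
have hF1 : delta_subfield F1 := delta_adjoin_subfield _ _.
have hj' : delta_hom_on F1 (sec \o j).
  split.
  - by apply: sub_val_inj; rewrite /= (dhom1 hj) secK ?v1 //; apply: dsub1 hD.
  - move=> x y Fx Fy; have Fxy := sfD (delta_subfield_sf hF1) Fx Fy.
    apply: sub_val_inj.
    by rewrite vD //= (secK _ (jD _ Fxy)) (secK _ (jD _ Fx)) (secK _ (jD _ Fy)) (dhomD hj).
  - move=> x y Fx Fy; have Fxy := dsubM hF1 Fx Fy.
    apply: sub_val_inj.
    by rewrite vM //= (secK _ (jD _ Fxy)) (secK _ (jD _ Fx)) (secK _ (jD _ Fy)) (dhomM hj).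
  - move=> i x Fx; have Fdx := dsub_der hF1 i Fx.
    apply: sub_val_inj.
    by rewrite vd //= (secK _ (jD _ Fdx)) (secK _ (jD _ Fx)) (dhom_der hj).
have gen : exists (l : nat) (b : 'I_l -> G'), forall x : G',
    delta_adjoin (fun y => exists2 z, F1 z & y = (sec \o j) z) (range_of b) x.
  exists l, (sec \o b) => x L hL FL bL.
  have hL' : delta_subfield (fun y => exists2 t : G', L t & y = sub_val t).
    split.
    - by exists 1; [apply: dsub1 hL | rewrite v1].
    - move=> _ _ [s Ls ->] [t Lt ->]; exists (s - t); first exact: (dsubB hL).
      by rewrite (homB (D := fun=> True) (f := @sub_val _ _ _ hD)) //; split.
    - by move=> _ _ [s Ls ->] [t Lt ->]; exists (s * t); [apply: (dsubM hL)|rewrite vM].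
    - move=> _ [s Ls ->]; exists s^-1; first exact: (dsubV hL).
      by rewrite (homV (D := fun=> True) (f := @sub_val _ _ _ hD)) //; split.
    - by move=> i _ [s Ls ->]; exists (der i s); [apply: (dsub_der hL)|rewrite vd].
  have [||t Lt /sub_val_inj-> //] := sub_valP x _ hL'.
  - move=> _ [z Fz ->]; exists (sec (j z)); last by rewrite secK //; apply: jD.
    by apply: FL; exists z.
  - move=> _ [i ->]; exists (sec (b i)); last by rewrite secK.
    by apply: bL; exists i.
have [phi [p1 pD pM pd] hphi] := univ k a G' (sec \o j) hj' gen.
have hsD := delta_subfield_sf hD.
have secE y (t : G') : D y -> sub_val t = y -> sec y = t.
  by move=> Dy e; apply: sub_val_inj; rewrite secK.
exists (phi \o sec); last by move=> x Fx; apply: hphi.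
split.
- by rewrite /= (secE 1 1) ?p1 ?v1 //; apply: dsub1 hD.
- move=> x y Dx Dy; rewrite /= -pD //; congr phi; apply: secE; last by rewrite vD // !secK.
  exact: (sfD hsD).
- move=> x y Dx Dy; rewrite /= -pM //; congr phi; apply: secE; last by rewrite vM // !secK.
  exact: (dsubM hD).
- move=> i x Dx; rewrite /= -pd //; congr phi; apply: secE; last by rewrite vd // secK.
  exact: (dsub_der hD).
Qed.

Section HomEval.
Variables (E E' : fieldType) (D : E -> Prop) (f : E -> E').
Hypotheses (hD : is_subfield D) (hf : is_hom D f).

Lemma hom_mon_eval (J : choiceType) (g : J -> E) (M : {cmonom J}) :
  (forall v, D (g v)) -> D (mon_eval g M) /\ f (mon_eval g M) = mon_eval (f \o g) M.
Proof.
move=> Dg; have h v : D (g v ^+ M v) by apply: sfX.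
split; first by apply: sf_prod.
rewrite /mon_eval (hom_prod hD hf) //; apply: eq_bigr => v _; exact: (homX hD hf).
Qed.

Lemma hom_eval (J : choiceType) (g : J -> E) (p : {malg E[{cmonom J}]}) :
  (forall v, D (g v)) -> (forall k, D p@_k) ->
  f (mmap idfun (mon_eval g) p) = \sum_(k <- msupp p) f p@_k * mon_eval (f \o g) k.
Proof.
move=> Dg Dp; rewrite /mmap (hom_sum hD hf); last first.
  by move=> k _; apply: (sfM hD); [exact: Dp | case: (hom_mon_eval k Dg)].
apply: eq_bigr => k _; have [h1 h2] := hom_mon_eval k Dg.
by rewrite (homM hf (Dp k) h1) h2.
Qed.
End HomEval.

Section DeltaHom.
Variables (m : nat) (E G : diffFieldType m) (D : E -> Prop) (f : E -> G).
Hypotheses (hD : delta_subfield D) (hf : delta_hom_on D f).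
Let sD : is_subfield D := delta_subfield_sf hD.
Let dD : dclosed D := proj2 ((delta_subfieldP D).1 hD).

Lemma dhom_dapp th x : D x -> f (dapp th x) = dapp th (f x).
Proof.
move=> Dx; elim/cmonom_ind: th => [|i th IH]; first by rewrite !dapp1.
by rewrite !dappU (dhom_der hf) ?IH //; apply: dapp_closed.
Qed.

Variables (J : finType) (eta : J -> E) (A : E -> Prop).
Hypotheses (AD : forall x, A x -> D x) (De : forall j, D (eta j)).

Lemma dhom_dv v : D (dv eta v) /\ f (dv eta v) = dv (f \o eta) v.
Proof. by split; [apply: dapp_closed | apply: dhom_dapp]. Qed.

Lemma dhom_basic v : basic A eta v <-> basic (img f A) (f \o eta) v.
Proof.
rewrite /basic; have [D1 e] := dhom_dv v.
have lD x : low A eta v x -> D x.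
  by case=> [/AD//|[w [_ ->]]]; have [] := dhom_dv w.
rewrite (acl_homE sD (dhom_is_hom hf) lD D1) e.
suff -> : img f (low A eta v) = low (img f A) (f \o eta) v by [].
apply/funext => y; apply/propext; split.
  case=> x [Ax|[w [wv ->]]] ->; first by left; apply: imgP.
  by right; exists w; have [_ ->] := dhom_dv w.
case=> [[x Ax ->]|[w [wv ->]]]; first by exists x => //; left.
have [_ <-] := dhom_dv w; apply: imgP; right; by exists w.
Qed.

Lemma dhom_cols : cols A eta = cols (img f A) (f \o eta).
Proof.
apply/setP => j; apply/idP/idP => /colsP h; apply/colsP => th.
  by apply/dhom_basic/h.
by apply/(dhom_basic (th, j))/h.
Qed.
End DeltaHom.

Lemma img_delta_subfield m (E G : diffFieldType m) (D A : E -> Prop) (f : E -> G) :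
  delta_subfield A -> delta_subfield D -> (forall x, A x -> D x) ->
  delta_hom_on D f -> delta_subfield (img f A).
Proof.
move=> hA hD AD hf; have [f1 fD fM fd] := hf.
have hfA : is_hom A f by split=> // x y Ax Ay; [apply: fD|apply: fM]; apply: AD.
apply/delta_subfieldP; split; first exact: (img_subfield (delta_subfield_sf hA) hfA).
move=> i _ [x Ax ->]; exists (der i x); first exact: (dsub_der hA).
by rewrite fd //; apply: AD.
Qed.

Lemma range_of_enum (E : Type) m (G : diffFieldType m) (I : finType) (a : I -> G) :
  range_of (a \o (fun i : 'I_#|I| => enum_val i)) = range_of a.
Proof.
apply/funext => x; apply/propext; split=> [[i ->]|[i ->]]; first by exists (enum_val i).
by exists (enum_rank i); rewrite /= enum_rankK.
Qed.

Lemma delta_hom_sub m (E G : diffFieldType m) (D A : E -> Prop) (f : E -> G) :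
  (forall x, A x -> D x) -> delta_hom_on D f -> delta_hom_on A f.
Proof.
move=> AD [f1 fD fM fd]; split=> // [x y Ax Ay|x y Ax Ay|i x Ax].
- by apply: fD; apply: AD.
- by apply: fM; apply: AD.
- by apply: fd; apply: AD.
Qed.

Lemma indeterminates_exist m (E : diffFieldType m) (I : finType) :
  [pchar E] =i pred0 -> exists (G : diffFieldType m) (iota : E -> G) (U : I -> G),
  [/\ [pchar G] =i pred0, delta_hom_on (fun=> True) iota &
    alg_indep (img iota (fun=> True)) (J := deriv_var m I) (dv U)].
Proof.
move=> charE; exists (rat_field I charE), (@rat_const m E I charE), (@rat_var m E I charE).
split; [exact: rat_char | exact: rat_const_hom | exact: rat_var_indep].
Qed.

(** * A generic point on the section *)

Section GenericPosition.
Variables (m n : nat) (E : diffFieldType m) (charE : [pchar E] =i pred0).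
Variables (F : E -> Prop) (hF : delta_subfield F) (hE : universal_over F).
Variables (I : finType) (o i0 : I) (i0o : i0 != o) (M : I -> dmonom m 'I_n) (s : nat).
Variables (Ms : forall i, (dmon_order (M i) <= s)%N) (j0 : 'I_n) (M1 : M i0 != mone).
Variables (Mj : forall v, v \in finsupp (M i0) -> v.2 = j0) (Mo : dmon_order (M i0) = s).
Variables (u : I -> E) (hu : delta_indep F u) (eta0 : 'I_n -> E) (hj0 : j0 \in cols F eta0).

Let ev (G : diffFieldType m) (a : 'I_n -> G) i := mon_eval (fun w => dv a w) (M i).

(** In the field of Delta-rational functions with indeterminates U_i over E,
    let zeta = - sum_(i != o) U_i M_i(eta0). By [indseq_quasi_generic] with T
    = 0, zeta and the U_i with i != o are Delta-independent over F, so that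
    F<u> embeds with [u o] mapped to zeta and [u i] to U_i. By universality
    eta0 and the U_i return to E in a way that inverts this embedding: [psi]
    is the resulting map on F<eta0>, and [v i] is the image of U_i. *)
Lemma generic_position : exists (eta : 'I_n -> E) (v psi : _),
  [/\ delta_hom_on (delta_adjoin F (range_of eta0)) psi,
      forall x, F x -> psi x = x,
      eta = psi \o eta0,
      forall X, uniq X ->
        indseq (fun y => F y \/ exists w, y = dv eta w) (map (dv v) X) &
      (forall i, i != o -> v i = u i) /\
      u o = - \sum_(i | i != o) u i * mon_eval (fun w => dv eta w) (M i)].
Proof.
have sF := delta_subfield_sf hF.
have [G [iota [U [charG hi iU]]]] := indeterminates_exist I charE.
have hT : delta_subfield (fun _ : E => True) by [].
have hiF : delta_hom_on F iota.
  exact: delta_hom_sub hi.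
pose Fh := img iota F; have hFh : delta_subfield Fh.
  exact: (img_delta_subfield hF hT).
pose eh := iota \o eta0.
have ehE w : dv eh w = iota (dv eta0 w).
  by have [_ ->] := @dhom_dv _ _ _ _ _ hT hi _ eta0 (fun=> Logic.I) w.
have hj : full Fh eh j0.
  apply/colsP; rewrite /Fh /eh -(dhom_cols hT hi) //.
have hU X : uniq X -> indseq (fun y => Fh y \/ exists w, y = dv eh w) (map (dv U) X).
  move=> uX; have hIT : is_subfield (img iota (fun=> True)).
    exact: (img_subfield (delta_subfield_sf hT) (dhom_is_hom hi)).
  have := (alg_indepP charG hIT _).1 iU X uX.
  apply: indseq_mono => y [[x _ ->]|[w ->]]; apply: acl_in; first by exists x.
  by rewrite ehE; exists (dv eta0 w).
pose zeta : G := - \sum_(i | i != o) U i * ev eh i.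
pose z i := if i == o then zeta else U i.
have hz : alg_indep Fh (J := deriv_var m I) (dv z).
  apply/(alg_indepP charG (delta_subfield_sf hFh)) => X uX.
  pose Xo := [seq w <- X | w.2 == o]; pose Xr := [seq w <- X | w.2 != o].
  have pX : perm_eq (Xo ++ Xr) X by rewrite perm_filterC.
  apply: (indseq_perm (perm_map (dv z) pX)); rewrite map_cat.
  have er : map (dv z) Xr = map (dv U) Xr.
    by apply/eq_in_map => w; rewrite mem_filter => /andP[wo _]; rewrite /dv /z (negPf wo).
  have eo : map (dv z) Xo = map (fun th => dapp th zeta) [seq w.1 | w <- Xo].
    rewrite -map_comp; apply/eq_in_map => w; rewrite mem_filter => /andP[wo _].
    by rewrite /dv /z wo.
  rewrite er eo; apply/indseq_cat; split; last first.
    apply: indseq_mono (hU Xr (filter_uniq _ uX)) => y Fy; apply: acl_in; by left.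
  have uo : uniq [seq w.1 | w <- Xo].
    rewrite map_inj_in_uniq ?filter_uniq // => -[t1 i1] [t2 i2].
    by rewrite !mem_filter /= => /andP[/eqP-> _] /andP[/eqP-> _] ->.
  have := indseq_quasi_generic charG hFh i0o Ms hj M1 Mj Mo hU (T := 0) uo (fun _ _ => isT).
  apply: indseq_mono => y [Fy|/mapP[w]]; first by apply: acl_in; apply: Or31.
  rewrite mem_filter => /andP[wo _] ->; apply: acl_in; apply: Or32; exists w.
  by split=> //; apply/eqP.
have [j [hj1 hj2 hj3]] := delta_hom_extend hF hiF hu hz.
pose b0 (k : 'I_n + I) := match k with inl k => eh k | inr i => U i end.
pose a := u \o (fun i : 'I_#|I| => enum_val i).
pose b := b0 \o (fun i : 'I_#|{: 'I_n + I}| => enum_val i).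
have ra : range_of a = range_of u := range_of_enum E u.
have rb : range_of b = range_of b0 := range_of_enum E b0.
have hj1' : delta_hom_on (delta_adjoin F (range_of a)) j by rewrite ra.
have [chi hchi chij] := universal_extend b hE hj1'.
rewrite ra rb in hchi chij.
set D2 := delta_adjoin _ _ in hchi.
have hD2 : delta_subfield D2 := delta_adjoin_subfield _ _.
have FU x : F x -> delta_adjoin F (range_of u) x by apply: delta_adjoin_in.
have uU i : delta_adjoin F (range_of u) (u i) by apply: delta_adjoin_gen; exists i.
have D2j x : delta_adjoin F (range_of u) x -> D2 (j x).
  by move=> hx L _ h _; apply: h; apply: imgP.
have D2F x : F x -> D2 (iota x) by move=> Fx; rewrite -hj2 //; exact: (D2j _ (FU _ Fx)).
have D2b k : D2 (b0 k) by move=> L _ _; apply; exists k.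
have D2e k : D2 (eh k) := D2b (inl k).
have D2U i : D2 (U i) := D2b (inr i).
have chiF x : F x -> chi (iota x) = x by move=> Fx; rewrite -hj2 // chij //; apply: FU.
have D2K x : delta_adjoin F (range_of eta0) x -> D2 (iota x).
  move=> hx; apply: (hx (fun x => D2 (iota x))).
  - have [i1 iD iM id] := hi; have hh := dhom_is_hom hi; have sT := delta_subfield_sf hT.
    split.
    + by rewrite i1; apply: dsub1 hD2.
    + by move=> x1 y1 h1 h2; rewrite (homB sT hh) //; apply: (dsubB hD2).
    + by move=> x1 y1 h1 h2; rewrite iM //; apply: (dsubM hD2).
    + by move=> x1 h1; rewrite (homV sT hh) //; apply: (dsubV hD2).
    + by move=> i x1 h1; rewrite id //; apply: (dsub_der hD2).
  - exact: D2F.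
  - by move=> _ [k ->]; apply: D2e.
pose psi := chi \o iota.
have hpsi : delta_hom_on (delta_adjoin F (range_of eta0)) psi.
  have [i1 iD iM id] := hi; have [c1 cD cM cd] := hchi.
  split.
  - by rewrite /psi /= i1 c1.
  - by move=> x y /D2K hx /D2K hy; rewrite /psi /= iD // cD.
  - by move=> x y /D2K hx /D2K hy; rewrite /psi /= iM // cM.
  - by move=> i x /D2K hx; rewrite /psi /= id // cd.
have vE w : D2 (dv U w) /\ chi (dv U w) = dv (chi \o U) w := dhom_dv hD2 hchi D2U w.
have eE w : D2 (dv eh w) /\ chi (dv eh w) = dv (chi \o eh) w := dhom_dv hD2 hchi D2e w.
have vu i : i != o -> chi (U i) = u i.
  by move=> io; rewrite -[RHS](chij _ (uU i)) hj3 /z (negPf io).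
have hh2 := dhom_is_hom hchi; have sD2 := delta_subfield_sf hD2.
exists (psi \o eta0), (chi \o U), psi; split=> //.
- move=> X uX.
  have AD y : (Fh y \/ exists w, y = dv eh w) -> D2 y.
    by case=> [[x Fx ->]|[w ->]]; [apply: D2F | have [] := eE w].
  have sDX y : y \in map (dv U) X -> D2 y by move=> /mapP[w _ ->]; have [] := vE w.
  have := (indseq_hom sD2 hh2 AD sDX).1 (hU X uX).
  have -> : map chi (map (dv U) X) = map (dv (chi \o U)) X.
    by rewrite -map_comp; apply: eq_map => w /=; have [_ ->] := vE w.
  apply: indseq_mono => y [Fy|[w ->]]; apply: acl_in.
    by exists (iota y); [left; apply: imgP | rewrite chiF].
  by exists (dv eh w); [right; exists w | have [_ ->] := eE w].
split; first exact: vu.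
rewrite -[LHS](chij _ (uU o)) hj3 /z eqxx /zeta.
have Dt i : D2 (U i * ev eh i) /\ chi (U i * ev eh i) = chi (U i) * ev (chi \o eh) i.
  have [h1 h2] := hom_mon_eval sD2 hh2 (M i) (fun w => (eE w).1).
  split; first by apply: (sfM sD2).
  rewrite (homM hh2) // h2; congr (_ * _); apply: mon_eval_ext => w _ /=.
  by have [_ ->] := eE w.
rewrite (homN sD2 hh2); last by apply: (sf_sum sD2) => i _; have [] := Dt i.
congr (- _); rewrite -big_filter (hom_sum sD2 hh2); last by move=> i _; have [] := Dt i.
rewrite big_filter; apply: eq_bigr => i io; have [_ ->] := Dt i.
by rewrite vu.
Qed.
End GenericPosition.

(** * Relations at the generic point hold on the section *)

Section VanishingFunctions.
Variables (m n : nat) (E : diffFieldType m) (charE : [pchar E] =i pred0).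
Variables (F : E -> Prop) (hF : delta_subfield F) (V : ('I_n -> E) -> Prop).
Variables (eta : 'I_n -> E) (heta : generic_point F V eta).
Variables (I : finType) (v : I -> E).
Hypothesis hv : forall X, uniq X ->
  indseq (fun y => F y \/ exists w, y = dv eta w) (map (dv v) X).
Let sF : is_subfield F := delta_subfield_sf hF.
Let dF : dclosed F := proj2 ((delta_subfieldP F).1 hF).

(** The functions of a point that are given by Delta-polynomials with
    coefficients in the Delta-ring generated by F and [v]. The [v i] are
    parameters, while the point varies. *)
Inductive dfun : (('I_n -> E) -> E) -> Prop :=
| dfun_const c : F c -> dfun (fun=> c)
| dfun_var w : dfun (fun a => dv a w)
| dfun_par w : dfun (fun=> dv v w)
| dfunD f g : dfun f -> dfun g -> dfun (fun a => f a + g a)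
| dfunM f g : dfun f -> dfun g -> dfun (fun a => f a * g a).

Lemma dfunN f : dfun f -> dfun (fun a => - f a).
Proof.
move=> hf; have -> : (fun a => - f a) = (fun a => -1 * f a).
  by apply/funext => a; rewrite mulN1r.
exact: (dfunM (dfun_const (sfN sF (sf1 sF))) hf).
Qed.

Lemma dfunX f k : dfun f -> dfun (fun a => f a ^+ k).
Proof.
move=> hf; elim: k => [|k IH].
  have -> : (fun a => f a ^+ 0) = (fun=> 1) by [].
  by exact: (dfun_const (sf1 sF)).
have -> : (fun a => f a ^+ k.+1) = (fun a => f a * f a ^+ k).
  by apply/funext => a; rewrite exprS.
exact: dfunM.
Qed.

Lemma dfun_sum (T : Type) (r : seq T) (P : pred T) (f : T -> ('I_n -> E) -> E) :
  (forall t, dfun (f t)) -> dfun (fun a => \sum_(t <- r | P t) f t a).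
Proof.
move=> hf; elim: r => [|t r IH].
  have -> : (fun a => \sum_(t <- [::] | P t) f t a) = (fun=> 0).
    by apply/funext => a; rewrite big_nil.
  by exact: (dfun_const (sf0 sF)).
have -> : (fun a => \sum_(t <- t :: r | P t) f t a) =
   (fun a => (if P t then f t a else 0) + \sum_(t <- r | P t) f t a).
  by apply/funext => a; rewrite big_cons; case: ifP => _; rewrite ?add0r.
apply: dfunD IH; case: (P t); [exact: hf | exact: (dfun_const (sf0 sF))].
Qed.

Lemma dfun_prod (T : Type) (r : seq T) (f : T -> ('I_n -> E) -> E) :
  (forall t, dfun (f t)) -> dfun (fun a => \prod_(t <- r) f t a).
Proof.
move=> hf; elim: r => [|t r IH].
  have -> : (fun a => \prod_(t <- [::]) f t a) = (fun=> 1).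
    by apply/funext => a; rewrite big_nil.
  by exact: (dfun_const (sf1 sF)).
have -> : (fun a => \prod_(t <- t :: r) f t a) =
   (fun a => f t a * \prod_(t <- r) f t a).
  by apply/funext => a; rewrite big_cons.
exact: dfunM.
Qed.

Lemma dfun_mon (M : dmonom m 'I_n) : dfun (fun a => mon_eval (fun w => dv a w) M).
Proof. by apply: dfun_prod => w; apply: dfunX; apply: dfun_var. Qed.

Lemma dfun_der f i : dfun f -> dfun (fun a => der i (f a)).
Proof.
elim=> {f} [c Fc|w|w|f g hf ihf hg ihg|f g hf ihf hg ihg].
- exact: (dfun_const (dF i Fc)).
- have -> : (fun a : 'I_n -> E => der i (dv a w)) = (fun a => dv a (shift (ucm i) w)).
    by apply/funext => a; rewrite dv_shift dapp_ucm.
  exact: dfun_var.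
- rewrite -dapp_ucm -dv_shift; exact: dfun_par.
- have -> : (fun a => der i (f a + g a)) = (fun a => der i (f a) + der i (g a)).
    by apply/funext => a; rewrite derD.
  exact: dfunD.
- have -> : (fun a => der i (f a * g a)) =
      (fun a => der i (f a) * g a + f a * der i (g a)).
    by apply/funext => a; rewrite derM.
  by apply: dfunD; apply: dfunM.
Qed.

Lemma dfun_dapp f th : dfun f -> dfun (fun a => dapp th (f a)).
Proof.
move=> hf; elim/cmonom_ind: th => [|i th IH].
  have -> : (fun a => dapp mone (f a)) = f by apply/funext => a; rewrite dapp1.
  exact: hf.
have -> : (fun a => dapp (mmul (ucm i) th) (f a)) = (fun a => der i (dapp th (f a))).
  by apply/funext => a; rewrite dappU.
exact: dfun_der.
Qed.

Let dfun_rep f : dfun f -> exists ts : seq (dpoly E 'I_n * {cmonom (deriv_var m I)}),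
  (forall t, t \in ts -> coefs_in F t.1) /\
  forall a, f a = \sum_(t <- ts) dp_eval t.1 a * mon_eval (dv v) t.2.
Proof.
have m1 : mon_eval (dv v) (mone : {cmonom (deriv_var m I)}) = 1.
  by rewrite /mon_eval mdom1 big_seq_fset0.
elim=> {f} [c Fc|w|w|f g _ [ts [h1 e1]] _ [ts' [h2 e2]]|f g _ [ts [h1 e1]] _ [ts' [h2 e2]]].
- exists [:: (c%:MP, mone)]; split; first by move=> t; rewrite inE => /eqP->; apply: coefs_in_C.
  by move=> a; rewrite big_seq1 /= m1 mulr1 /dp_eval mevalC.
- exists [:: (<< ucm w >>, mone)]; split.
    by move=> t; rewrite inE => /eqP->; apply: coefs_in_U.
  by move=> a; rewrite big_seq1 /= m1 mulr1 /dp_eval mevalV.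
- exists [:: (1%:MP, ucm w)]; split.
    by move=> t; rewrite inE => /eqP->; apply: coefs_in_C => //; apply: sf1 sF.
  by move=> a; rewrite big_seq1 /= mon_evalU /dp_eval mevalC mul1r.
- exists (ts ++ ts'); split; first by move=> t; rewrite mem_cat => /orP[/h1|/h2].
  by move=> a; rewrite big_cat /= e1 e2.
- exists [seq (t.1 * t'.1, mmul t.2 t'.2) | t <- ts, t' <- ts']; split.
    by move=> _ /allpairsP[[t t'] /= [/h1 ht /h2 ht' ->]]; apply: coefs_inM.
  move=> a; rewrite big_allpairs_dep e1 e2 big_distrlr /=.
  apply: eq_bigr => t _; apply: eq_bigr => t' _.
  have -> : mon_eval (dv v) (mmul t.2 t'.2) = mon_eval (dv v) t.2 * mon_eval (dv v) t'.2.
    exact: mmorphM.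
  have -> : dp_eval (t.1 * t'.1) a = dp_eval t.1 a * dp_eval t'.1 a by exact: mevalM.
  by rewrite mulrACA.
Qed.

(** As [v] is Delta-independent over F<eta>, each coefficient of f, as a
    polynomial in the derivatives of [v], vanishes at [eta]; being a Delta-
    polynomial over F, it vanishes on V. *)
Lemma dfun_vanish f : dfun f -> f eta = 0 -> forall a, V a -> f a = 0.
Proof.
move=> /dfun_rep[ts [hts e]] f0 a Va.
have iv : alg_indep (fgen (fun y => F y \/ exists w, y = dv eta w))
    (J := deriv_var m I) (dv v).
  apply/(alg_indepP charE (fgen_subfield _)) => X uX.
  by apply: indseq_mono (hv uX) => y; apply: fgen_acl.
pose Q b : {malg E[{cmonom (deriv_var m I)}]} := \sum_(t <- ts) << dp_eval t.1 b *g t.2 >>.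
have eQ b : mmap idfun (mon_eval (dv v)) (Q b) = f b.
  by rewrite /Q rmorph_sum e; apply: eq_bigr => t _; exact: mmapU.
have cQ b k : (Q b)@_k = \sum_(t <- ts | t.2 == k) dp_eval t.1 b.
  rewrite /Q raddf_sum /= [RHS]big_mkcond; apply: eq_bigr => t _.
  by rewrite mcoeffU; case: eqP => _; rewrite ?mulr1n ?mulr0n.
have Q0 : Q eta = 0.
  apply: iv; last by rewrite eQ.
  have hB := fgen_subfield (fun y => F y \/ exists w, y = dv eta w).
  move=> k; rewrite cQ big_seq_cond; apply: (sf_sum hB) => t /andP[/hts ht _].
  rewrite /dp_eval; apply: (sf_sum hB) => M _; apply: (sfM hB).
    by apply: fgen_in; left; apply: ht.
  apply: (sf_prod hB) => w _; apply: (sfX hB).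
  by apply: fgen_in; right; exists w.
rewrite -eQ; have -> : Q a = 0; last by rewrite rmorph0.
apply/malgP => k; rewrite mcoeff0 cQ.
pose p : dpoly E 'I_n := \sum_(t <- ts | t.2 == k) t.1.
have ep b : dp_eval p b = \sum_(t <- ts | t.2 == k) dp_eval t.1 b.
  by rewrite /dp_eval rmorph_sum.
have hp : coefs_in F p.
  rewrite /p big_seq_cond; apply: coefs_in_sum => // t /andP[/hts]; exact.
have [_ ge] := heta; have p0 : dp_eval p eta = 0 by rewrite ep -cQ Q0 mcoeff0.
by rewrite -ep; have [_] := ge p hp p0; apply.
Qed.

Variables (o : I) (u : I -> E) (M : I -> dmonom m 'I_n).
Hypothesis vu : forall i, i != o -> v i = u i.
Let W (a : 'I_n -> E) := V a /\ u o = - \sum_(i | i != o) u i * mon_eval (fun w => dv a w) (M i).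
Hypothesis We : W eta.

Let const x := exists2 f, dfun f & forall a, W a -> f a = x.

(** On the section also [u o] is the value of a function of the point, one
    that involves only the [v i]. So F<u> consists of quotients of functions
    that are constant on the section. *)
Let const_u x : F x \/ derivs (range_of u) x -> const x.
Proof.
case=> [Fx|[th [_ [[i ->] ->]]]]; first by exists (fun=> x) => //; apply: dfun_const.
case: (eqVneq i o) => [->|io]; last first.
  exists (fun=> dv v (th, i)); first exact: dfun_par.
  by move=> a _; rewrite /dv /= vu.
exists (fun a => dapp th (- \sum_(i | i != o) v i * mon_eval (fun w => dv a w) (M i))).
  apply/dfun_dapp/dfunN/dfun_sum => k; apply: dfunM; last exact: dfun_mon.
  by have := dfun_par (mone, k); rewrite /dv /= dapp1.
by move=> a [_ ->]; congr (dapp _ (- _)); apply: eq_bigr => k ko; rewrite vu.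
Qed.

Let frac_u x : delta_adjoin F (range_of u) x ->
  exists A B, [/\ const A, const B, B != 0 & x = A / B].
Proof.
rewrite delta_adjoinE //; apply: fgen_fractions const_u x.
- by exists (fun=> 1) => //; exact: (dfun_const (sf1 sF)).
- move=> x y [f hf ef] [g hg eg]; exists (fun a => f a - g a).
    by apply: dfunD; [|apply: dfunN].
  by move=> a Wa; rewrite ef // eg.
- move=> x y [f hf ef] [g hg eg]; exists (fun a => f a * g a); first exact: dfunM.
  by move=> a Wa; rewrite ef // eg.
Qed.

(** After multiplication by a common denominator, the Delta-polynomial agrees
    on the section with a function to which [dfun_vanish] applies. *)
Lemma generic_vanish_section p : coefs_in (delta_adjoin F (range_of u)) p ->
  dp_eval p eta = 0 -> forall a, W a -> dp_eval p a = 0.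
Proof.
move=> hp p0.
have [f [B [hf B0 e]]] : exists f B, [/\ dfun f, B != 0 &
    forall a, W a -> f a = B * dp_eval p a].
  have key (s : seq (dmonom m 'I_n)) : exists f g B, [/\ dfun f, dfun g, B != 0 &
     forall a, W a -> g a = B /\
       f a = B * \sum_(k <- s) p@_k * mon_eval (fun w => dv a w) k].
    elim: s => [|k s [f [g [B [hf hg B0 h]]]]].
      exists (fun=> 0), (fun=> 1), 1; split; rewrite ?oner_eq0 //.
      - exact: (dfun_const (sf0 sF)).
      - exact: (dfun_const (sf1 sF)).
      - by move=> a _; rewrite big_nil mulr0.
    have [A' [B' [[f' hf' ef'] [g' hg' eg'] B0' e']]] := frac_u (hp k).
    exists (fun a => g a * (f' a * mon_eval (fun w => dv a w) k) + g' a * f a),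
      (fun a => g a * g' a), (B * B'); split.
    - apply: dfunD; last exact: dfunM.
      by apply: dfunM => //; apply: dfunM => //; apply: dfun_mon.
    - exact: dfunM.
    - exact: mulf_neq0.
    - move=> a Wa; have [-> ->] := h a Wa; rewrite ef' // eg' //; split=> //.
      by rewrite big_cons e'; field.
  have [f [g [B [hf hg B0 h]]]] := key (msupp p).
  by exists f, B; split=> // a /h[_ ->].
move=> a Wa; have f0 : f eta = 0 by rewrite e // p0 mulr0.
have := dfun_vanish hf f0 (proj1 Wa); rewrite e // => /eqP.
by rewrite mulf_eq0 (negPf B0) => /eqP.
Qed.
End VanishingFunctions.

(** * Rank over the field of the coefficients *)

Section SectionRank.
Variables (m n : nat) (hm : (0 < m)%N) (E : diffFieldType m) (charE : [pchar E] =i pred0).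
Variables (F : E -> Prop) (hF : delta_subfield F).
Variables (I : finType) (o i0 : I) (i0o : i0 != o) (M : I -> dmonom m 'I_n) (s : nat).
Variables (Ms : forall i, (dmon_order (M i) <= s)%N) (j0 : 'I_n) (M1 : M i0 != mone).
Variables (Mj : forall v, v \in finsupp (M i0) -> v.2 = j0) (Mo : dmon_order (M i0) = s).
Variables (u v : I -> E) (eta : 'I_n -> E) (hj0 : full F eta j0).
Hypothesis hv : forall X, uniq X ->
  indseq (fun y => F y \/ exists w, y = dv eta w) (map (dv v) X).
Hypothesis vu : forall i, i != o -> v i = u i.
Hypothesis uo : u o = - \sum_(i | i != o) u i * mon_eval (fun w => dv eta w) (M i).
Let Fu := delta_adjoin F (range_of u).
Let sF : is_subfield F := delta_subfield_sf hF.
Let dF : dclosed F := proj2 ((delta_subfieldP F).1 hF).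
Let hFu : delta_subfield Fu := delta_adjoin_subfield _ _.
Let dFu : dclosed Fu := proj2 ((delta_subfieldP Fu).1 hFu).

Let uoE : u o = - \sum_(i | i != o) v i * mon_eval (fun w => dv eta w) (M i).
Proof. by rewrite uo; congr (- _); apply: eq_bigr => i /vu ->. Qed.

Let A : E -> Prop := fun y => F y \/ exists w, w.2 <> o /\ y = dv v w.

Let dA : dclosed A.
Proof.
move=> i y [Fy|[w [wo ->]]]; first by left; apply: dF.
by right; exists (shift (ucm i) w); rewrite dv_shift dapp_ucm.
Qed.

Let dvu w : w.2 <> o -> dv v w = dv u w.
Proof. by move=> /eqP wo; rewrite /dv vu. Qed.

Let A_Fu y : A y -> Fu y.
Proof.
case=> [Fy|[w [wo ->]]]; first exact: delta_adjoin_in.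
rewrite dvu // /dv; apply: (dapp_closed dFu).
by apply: delta_adjoin_gen; exists w.2.
Qed.

Let tail T (Y : seq {cmonom 'I_m}) : uniq Y ->
  (forall th, th \in Y -> (T <= mdeg th)%N) ->
  indseq (fun y => A y \/ exists w, (mdeg w.1 < T + s)%N /\ y = dv eta w)
    (map (fun th => dapp th (u o)) Y).
Proof.
move=> uY hY; rewrite uoE.
have := indseq_quasi_generic charE hF i0o Ms hj0 M1 Mj Mo hv uY hY.
apply: indseq_mono => y [[Fy|[w [wo ->]]]|[w [hw ->]]]; apply: acl_in.
- exact: Or31.
- by apply: Or32; exists w.
- by apply: Or33; exists w.
Qed.

Let uo_upto th t : (mdeg th + s <= t)%N ->
  fgen (fun y => A y \/ exists w, (mdeg w.1 <= t)%N /\ y = dv eta w) (dapp th (u o)).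
Proof.
move=> ht.
pose P k : E -> Prop := fun y => A y \/ exists w, (mdeg w.1 <= k)%N /\ y = dv eta w.
have base : fgen (P s) (u o).
  have hB := fgen_subfield (P s).
  rewrite uoE; apply: (sfN hB); apply: (sf_sum hB) => i /eqP io; apply: (sfM hB).
    by apply: fgen_in; left; right; exists (mone, i); rewrite /dv dapp1.
  apply: fgen_mono (mon_eval_upto F eta Ms i) => y [Fy|]; last by right.
  by left; left.
have : fgen (P (mdeg th + s)%N) (dapp th (u o)).
  apply: fgen_dapp base => [k y|k i y] [Ay|[w [hw ->]]].
  - by left.
  - by right; exists w; split=> //; apply: leqW.
  - by left; apply: dA.
  - by right; exists (shift (ucm i) w); rewrite dv_shift dapp_ucm /= mdegM mdegU; split.
apply: fgen_mono => y [Ay|[w [hw ->]]]; first by left.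
by right; exists w; split=> //; apply: leq_trans ht.
Qed.

(** Let Z be the derivatives of [u o] of order at most t - s. Over A, the
    field of the other coefficients, Z is independent and algebraic over the
    derivatives of [eta] of order at most t; so the rank of these drops by the
    size of Z when Z is added to A. The remaining derivatives of [u o] are
    independent over all of them, by [indseq_quasi_generic] with T = t - s +
    1, so that the rank over F<u> is the same as over A and Z. *)
Lemma rank_section t : (s <= t)%N ->
  (size (basics Fu eta t) + nmono m (t - s) = size (basics F eta t))%N.
Proof.
move=> st; pose Z := map (fun th => dapp th (u o)) (monos m (t - s)).
pose b := map (dv eta) (basics F eta t); pose b' := map (dv eta) (basics Fu eta t).
have iZ : indseq A Z.
  have := tail (T := 0) (monos_uniq m (t - s)) (fun _ _ => isT).
  by apply: indseq_mono => y Ay; apply: acl_in; left.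
have ib : indseq A b.
  apply: (indseq_over (B := fun y => F y \/ exists w, y = dv eta w) (P := fun w => w.2 <> o)
     _ _ (basics_indseq F eta t)).
  - by move=> y Fy; apply: acl_in; left.
  - by move=> _ /mapP[w _ ->]; apply: acl_in; right; exists w.
  - by move=> X uX _; apply: hv.
have spanb w : (mdeg w.1 <= t)%N -> acl (adj A b) (dv eta w).
  move=> wt; apply: acl_mono (basics_span F eta wt) => y [Fy|yb]; last by right.
  by left; left.
have [c [ic cb bc]] := basis_exists (adj A Z) b.
have icZ : indseq A (c ++ Z) by apply/indseq_cat.
have Zb y : y \in Z -> acl (adj A b) y.
  move=> /mapP[th]; rewrite mem_monos => hth ->.
  have ht : (mdeg th + s <= t)%N by rewrite -(subnK st) leq_add2r.
  apply: acl_trans (fgen_acl (uo_upto ht)) => z [Az|[w [hw ->]]]; last exact: spanb.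
  by apply: acl_in; left.
have sz : (size (c ++ Z) = size b)%N.
  apply/eqP; rewrite eqn_leq; apply/andP; split.
    apply: steinitz icZ _ => y; rewrite mem_cat => /orP[/cb yb|/Zb//].
    exact: acl_adj_self.
  by apply: steinitz ib _ => y /bc; apply: acl_mono => z /adj_cat.
have icFu : indseq Fu c.
  (* the derivatives of u o of order at least T are those outside of Z *)
  pose T := (t - s).+1.
  pose D : E -> Prop := fun y => A y \/ exists w, (mdeg w.1 < T + s)%N /\ y = dv eta w.
  have Ts : (T + s = t.+1)%N by rewrite /T addSn subnK.
  have AZD x : adj A Z x -> acl D x.
    case=> [Ax|/mapP[th]]; first by apply: acl_in; left.
    rewrite mem_monos => hth ->; apply: fgen_acl.
    have ht : (mdeg th + s <= t)%N by rewrite -(subnK st) leq_add2r.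
    apply: fgen_mono (uo_upto ht) => y [Ay|[w [hw ->]]]; [by left | right].
    by exists w; rewrite Ts.
  have cD x : x \in c -> acl D x.
    move=> /cb /mapP[w]; rewrite mem_filter mem_allv => /andP[_ hw] ->.
    by apply: acl_in; right; exists w; rewrite Ts.
  have := indseq_over (u := fun th => dapp th (u o)) (P := fun th => (T <= mdeg th)%N)
    AZD cD ic (fun X uX hX => tail uX hX).
  apply: indseq_mono => x; rewrite /Fu delta_adjoinE // => hx.
  apply: fgen_acl; apply: fgen_mono hx => y [Fy|[th [_ [[i ->] ->]]]].
    by left; left; left.
  case: (eqVneq i o) => [->|io].
    case: (leqP T (mdeg th)) => hth; first by right; exists th.
    by left; right; apply: map_f; rewrite mem_monos -ltnS.
  have io' : (th, i).2 <> o by apply/eqP.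
  by left; left; right; exists (th, i); rewrite (dvu io').
have cspan w : (mdeg w.1 <= t)%N -> acl (adj Fu c) (dv eta w).
  move=> /spanb; apply: acl_trans => y [Ay|/bc].
    by apply: acl_in; left; apply: A_Fu.
  apply: acl_mono => z [[Az|/mapP[th _ ->]]|zc]; [|left|by right].
    by left; apply: A_Fu.
  by apply: (dapp_closed dFu); apply: delta_adjoin_gen; exists o.
have szc : size c = size b'.
  apply/eqP; rewrite eqn_leq; apply/andP; split.
    apply: steinitz icFu _ => y /cb /mapP[w].
    by rewrite mem_filter mem_allv => /andP[_ hw] ->; exact: (basics_span Fu eta hw).
  apply: (steinitz (basics_indseq Fu eta t)) => y /mapP[w].
  by rewrite mem_filter mem_allv => /andP[_ hw] ->; apply: cspan.
by move: sz; rewrite size_cat szc /b' /b /Z !(size_map (dv eta)) size_map size_monos.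
Qed.

(** The two sides are the leading coefficients of the ranks in [rank_section],
    with respect to [nmono m t]. *)
Lemma cols_section : #|cols F eta| = #|cols Fu eta|.+1.
Proof.
apply/eqP; rewrite eqn_leq; apply/andP; split.
  have [e he] := size_basics_le charE dFu eta.
  apply: (@growth_le m hm (fun t => size (basics F eta t)) _ _ #|'I_n| (e + s) 0 0).
    move=> t; rewrite -rank_section ?leq_addl //; last by lia.
    have := he (t + s)%N; have -> : (t + s + e = t + (e + s))%N by lia.
    have m1 : (nmono m (t + (e + s) - s) <= nmono m (t + (e + s)))%N.
      by apply: nmono_le; lia.
    have m2 : (nmono m t <= nmono m (t + s))%N by apply: nmono_le; lia.
    have m3 : (#|'I_n| * (nmono m (t + (e + s)) - nmono m (t + s)) <=
               #|'I_n| * (nmono m (t + (e + s)) - nmono m t))%N.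
      by rewrite leq_mul2l leq_sub2l ?orbT.
    move=> h; rewrite mulSn; apply: leq_trans (leq_add h m1) _.
    by rewrite addnC addnA leq_add2l.
  by move=> t _; rewrite addn0; apply: size_basics_ge.
have [e he] := size_basics_le charE dF eta.
apply: (@growth_le m hm (fun t => size (basics F eta t)) _ _ _ _ s 0 he) => t _ /=.
rewrite -rank_section ?leq_addl // addnK mulSn addnC leq_add2r.
apply: leq_trans (size_basics_ge Fu eta (t + s)); rewrite leq_mul2l nmono_le ?orbT //.
exact: leq_addr.
Qed.
End SectionRank.

(** * Varieties of Delta-dimension zero *)

Section EmptySection.
Variables (m n : nat) (hm : (0 < m)%N) (E : diffFieldType m) (charE : [pchar E] =i pred0).
Variables (F : E -> Prop) (hF : delta_subfield F).
Let sF : is_subfield F := delta_subfield_sf hF.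

(** A relation for a coordinate of the generic point holds at all points of V. *)
Lemma coordinate_algebraic (V : ('I_n -> E) -> Prop) (eta : 'I_n -> E) a j :
  generic_point F V eta -> delta_trdeg F (delta_adjoin F (range_of eta)) 0 ->
  V a -> ~ delta_indep F (fun _ : 'I_1 => a j).
Proof.
move=> [_ ge] [_ hd] Va ia.
apply: (hd (fun _ : 'I_1 => eta j)); first by move=> _; apply: delta_adjoin_gen; exists j.
move=> p hp p0; apply: (ia p hp).
pose g (w : deriv_var m 'I_1) : dpoly E 'I_n := << ucm ((w.1, j) : deriv_var m 'I_n) >>.
pose q := mmap (@malgC _ _) (mon_eval g) p.
have eg b : (fun w => dp_eval (g w) b) = (fun w : deriv_var m 'I_1 => dapp w.1 (b j)).
  by apply/funext => w; rewrite /g /dp_eval mevalV.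
have eq b : dp_eval q b = dp_eval p (fun _ : 'I_1 => b j).
  by rewrite /q dp_eval_subst eg.
have hq : coefs_in F q by apply: coefs_in_subst => // w; apply: coefs_in_U.
have q0 : dp_eval q eta = 0 by rewrite eq.
by rewrite -[LHS](eq a); have [_ h] := ge q hq q0; apply: h.
Qed.

Variables (I : finType) (o : I) (u : I -> E) (hu : delta_indep F u).
Variables (M : I -> dmonom m 'I_n).

(** The equation would put all of [u] into the Delta-field generated by the
    coordinates of [a] and the [u i] with i != o. The columns of the
    coordinates are not full, so its Delta-transcendence degree is at most the
    number of the latter. *)
Lemma no_algebraic_solution (a : 'I_n -> E) :
  (forall j, ~ delta_indep F (fun _ : 'I_1 => a j)) ->
  u o <> - \sum_(i | i != o) u i * mon_eval (fun w => dv a w) (M i).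
Proof.
move=> ha uo.
(* 0 in place of the coefficient o gives a column that is not full *)
pose y (k : 'I_n + I) := match k with inl j => a j | inr i => if i == o then 0 else u i end.
have hy k : delta_adjoin F (range_of y) (y k) by apply: delta_adjoin_gen; exists k.
have hY : delta_subfield (delta_adjoin F (range_of y)) := delta_adjoin_subfield _ _.
have sY := delta_subfield_sf hY; have dY := proj2 ((delta_subfieldP _).1 hY).
have hui i : i != o -> delta_adjoin F (range_of y) (u i).
  by move=> io; have := hy (inr i); rewrite /= (negPf io).
have huo i : delta_adjoin F (range_of y) (u i).
  case: (eqVneq i o) => [->|/hui//]; rewrite uo; apply: (sfN sY).
  apply: (sf_sum sY) => k ko; apply: (sfM sY); first exact: hui.
  apply: (sf_prod sY) => w _; apply: (sfX sY); apply: (dapp_closed dY).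
  exact: (hy (inl w.2)).
have nfull_l j : ~ full F y (inl j).
  move=> fj; apply: (ha j); apply/(delta_indepP charE hF) => X uX.
  have -> : map (dv (fun _ : 'I_1 => a j)) X = map (dv y) [seq (w.1, inl j) | w <- X].
    by rewrite -map_comp.
  apply: cols_indseq; last by move=> _ /mapP[w _ ->]; apply/colsP.
  by rewrite map_inj_uniq // => -[t1 i1] [t2 i2] [->]; rewrite [i1]ord1 [i2]ord1.
have nfull_o : ~ full F y (inr o).
  move=> /(_ mone); apply; rewrite /dv /= eqxx dapp1.
  exact: (fgen_acl (sf0 (fgen_subfield _))).
have sub : cols F y \subset [set inr i | i in [set~ o]].
  apply/subsetP => -[j|i] /colsP fj; first by case: (nfull_l j).
  apply: imset_f; rewrite !inE; apply/eqP => io; by rewrite io in fj.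
have : (#|I| <= #|cols F y|)%N.
  pose c := u \o (fun i : 'I_#|I| => enum_val i).
  apply: (@indep_le_cols m hm E charE F hF _ y _ c); first by move=> i; apply: huo.
  apply/(delta_indepP charE hF) => X uX.
  have -> : map (dv c) X = map (dv u) [seq (w.1, enum_val w.2) | w <- X] by rewrite -map_comp.
  move/(delta_indepP charE hF): hu; apply.
  by rewrite map_inj_uniq // => -[t1 i1] [t2 i2] [-> /enum_val_inj ->].
rewrite leqNgt => /negP; apply; apply: leq_ltn_trans (subset_leq_card sub) _.
rewrite card_imset; last by move=> x1 x2 [].
by rewrite cardsC1; have : (0 < #|I|)%N by [apply/card_gt0P; exists o]; case: #|I|.
Qed.
End EmptySection.

(** * The intersection theorem *)

Lemma binom_eval m s t : (s <= t)%N ->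
  (poly_binom ('X + m%:R%:P - s%:R%:P) m).[t%:R] = (nmono m (t - s))%:R.
Proof.
move=> st; rewrite /poly_binom hornerZ horner_prod.
have f0 : (m`!%:R : rat) != 0 by rewrite Num.Theory.pnatr_eq0 -lt0n fact_gt0.
apply: (mulfI f0); rewrite mulrA mulfV // mul1r -natrM mulnC /nmono bin_ffact ffact_prod.
rewrite natr_prod; apply: eq_bigr => i _; rewrite !hornerE natrB; last first.
  by apply: leq_trans (ltnW (ltn_ord i)) _; apply: leq_addl.
by rewrite natrD natrB //; ring.
Qed.

Lemma dim_prime_basics m n (E : diffFieldType m) (charE : [pchar E] =i pred0) (K : E -> Prop)
    (hK : delta_subfield K) V (eta : 'I_n -> E) (gen : generic_point K V eta) t d :
  is_dim_prime K (trunc_ring K t)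
    (fun p => vanishing_ideal K V p /\ (dp_order p <= t)%N) d <->
  d = size (basics K eta t).
Proof.
rewrite -(size_map (dv eta)); apply: (dim_primeP charE hK gen (basics_indseq K eta t)).
  by move=> _ /mapP[x /mem_basics[_ hx] ->]; exists x.
by move=> x hx; apply: basics_span.
Qed.

Theorem theorem3p2 (m n s : nat) (hm : (2 <= m)%N) (E : diffFieldType m)
    (charE : [pchar E] =i pred0)
    (F : E -> Prop) (hF : delta_subfield F) (hE : universal_over F)
    (V : ('I_n -> E) -> Prop) (hV : irreducible_variety F V)
    (L : dpoly E 'I_n) (hL : quasi_generic F s L)
    (d : nat) (hd : is_delta_dim F V d) :
  let Fu := delta_adjoin F (coef_set L) in
  let W := fun a : 'I_n -> E => V a /\ dp_eval L a = 0 in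
  ((exists a, W a) <-> (0 < d)%N) /\
  ((0 < d)%N ->
    [/\ irreducible_variety Fu W,
        (forall w : {poly rat}, is_kolchin_poly F V w ->
           is_kolchin_poly Fu W
             (w - poly_binom ('X + m%:R%:P - s%:R%:P) m))
      & is_delta_dim Fu W (d - 1)]).
Proof.
move=> Fu W; have m0 : (0 < m)%N by apply: leq_trans hm.
case: hL => [oL L1 LM iL].
pose I : finType := msupp L; pose u (i : I) : E := L@_(val i).
pose M (i : I) : dmonom m 'I_n := val i; pose o : I := [` L1]%fset.
pose ev (a : 'I_n -> E) i := mon_eval (fun w => dv a w) (M i).
have iu : delta_indep F u by exact: iL.
have LE a : dp_eval L a = u o + \sum_(i | i != o) u i * ev a i.
  rewrite /dp_eval /mmap big_seq_fsetE /= (bigD1 o) //=; congr (_ + _).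
  have -> : mon_eval (fun v : deriv_var m 'I_n => dapp v.1 (a v.2)) mone = 1.
    by rewrite /mon_eval mdom1 big_seq_fset0.
  by rewrite mulr1.
have L0 a : dp_eval L a = 0 <-> u o = - \sum_(i | i != o) u i * ev a i.
  by rewrite LE; split=> [/eqP|->]; rewrite ?addNr // addr_eq0 => /eqP.
have FuE : Fu = delta_adjoin F (range_of u).
  rewrite /Fu; suff -> : coef_set L = range_of u by [].
  apply/funext => x; apply/propext; split=> [[k hk ->]|[i ->]].
    by exists [` hk]%fset.
  by exists (val i) => //; apply: (valP i).
have sF := delta_subfield_sf hF.
have [eta0 gen0 tr0] := hd.
have dE : d = #|cols F eta0| by apply/(delta_trdegP m0 charE hF).
have pos a : W a -> (0 < d)%N.
  case=> Va /L0 La; rewrite lt0n; apply/eqP => d0.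
  have tr00 : delta_trdeg F (delta_adjoin F (range_of eta0)) 0 by rewrite -d0.
  exact: (no_algebraic_solution m0 charE hF iu
    (fun j => coordinate_algebraic hF gen0 tr00 Va) La).
have [hVv _] := hV; have [Sig SF VS] := hVv.
suff main : (0 < d)%N -> exists eta, W eta /\ [/\ irreducible_variety Fu W,
    (forall w : {poly rat}, is_kolchin_poly F V w ->
       is_kolchin_poly Fu W (w - poly_binom ('X + m%:R%:P - s%:R%:P) m))
  & is_delta_dim Fu W (d - 1)].
  split; last by move=> /main[eta []].
  by split=> [[a]|/main[eta [We _]]]; [apply: pos | exists eta].
rewrite {1}dE card_gt0 => /set0Pn[j0 hj0].
have [M0 [M01 M0j M0s M0L]] := LM j0; pose i0 : I := [` M0L]%fset.
have i0o : i0 != o.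
  by apply: contraNneq M01 => e; rewrite -[M0]/(val i0) e.
have Ms i : (dmon_order (M i) <= s)%N.
  by rewrite -oL /dp_order (big_rem (val i)) ?(valP i) //= leq_maxl.
have [eta [v [psi [hpsi psiF etaE hv [vu uo]]]]] :=
  generic_position charE hF hE i0o Ms M01 M0j M0s iu hj0.
(* psi carries eta0 to eta and fixes F, so eta is a generic point as well *)
pose K0 := delta_adjoin F (range_of eta0).
have hK0 : delta_subfield K0 := delta_adjoin_subfield _ _.
have sK0 := delta_subfield_sf hK0; have psih := dhom_is_hom hpsi.
have FK0 x : F x -> K0 x by apply: delta_adjoin_in.
have De j : K0 (eta0 j) by apply: delta_adjoin_gen; exists j.
have dvK w : K0 (dv eta0 w) /\ psi (dv eta0 w) = dv eta w.
  by rewrite etaE; exact: (@dhom_dv _ _ _ _ _ hK0 hpsi _ eta0 De w).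
have psiE p : coefs_in F p -> psi (dp_eval p eta0) = dp_eval p eta.
  move=> hp; rewrite (hom_eval sK0 psih) => [|w|k]; last 2 first.
  - by have [] := dvK w.
  - by apply: FK0; apply: hp.
  apply: eq_bigr => k _; rewrite psiF; last exact: hp.
  congr (_ * _); apply: mon_eval_ext => w _ /=; by have [] := dvK w.
have K0p p : coefs_in F p -> K0 (dp_eval p eta0).
  move=> hp; apply: (sf_sum sK0) => k _; apply: (sfM sK0); first exact: (FK0 _ (hp k)).
  by apply: (sf_prod sK0) => w _; apply: (sfX sK0); have [] := dvK w.
have [Ve0 ge0] := gen0.
have gen : generic_point F V eta.
  split=> [|p hp]; last first.
    rewrite -psiE // => /(hom_eq0 sK0 psih (K0p p hp)); exact: ge0.
  apply/VS => p Sp; rewrite -psiE; last exact: SF.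
  by rewrite (VS eta0).1 // (hom0 sK0 psih).
have imgF : img psi F = F.
  apply/funext => y; apply/propext; split=> [[x Fx ->]|Fy]; first by rewrite psiF.
  by exists y => //; rewrite psiF.
have colsE : cols F eta = cols F eta0.
  by rewrite (dhom_cols hK0 hpsi FK0 De) imgF etaE.
have fj0 : full F eta j0 by apply/colsP; rewrite colsE.
have [Ve _] := gen.
have We : W eta by split=> //; apply/L0.
have hFu : delta_subfield Fu := delta_adjoin_subfield _ _.
have sFu := delta_subfield_sf hFu.
have FFu x : F x -> Fu x by apply: delta_adjoin_in.
have genW : generic_point Fu W eta.
  split=> // p hp p0; split=> // a [Va /L0 La].
  have hp' : coefs_in (delta_adjoin F (range_of u)) p by rewrite -FuE.
  exact: (generic_vanish_section charE hF gen hv vu (conj Ve uo) hp' p0 (conj Va La)).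
have vanE p : coefs_in Fu p -> vanishing_ideal Fu W p <-> dp_eval p eta = 0.
  exact: generic_vanish.
exists eta; split=> //; split.
- split.
    exists (fun p => Sig p \/ p = L).
      move=> p [/SF hp k|->]; first exact: (FFu _ (hp k)).
      move=> k; case: (boolP (k \in msupp L)) => hk.
        by apply: delta_adjoin_gen; exists k.
      by rewrite (mcoeff_outdom hk); apply: sf0.
    move=> a; split=> [[Va La] p [Sp|->] //|h]; first exact: (VS a).1.
    by split; [apply/VS => p Sp; apply: h; left | apply: h; right].
  have ev1 : dp_eval (1 : dpoly E 'I_n) eta = 1 by exact: rmorph1.
  have ev0 : dp_eval (0 : dpoly E 'I_n) eta = 0 by exact: rmorph0.
  have evD (p q : dpoly E 'I_n) : dp_eval (p + q) eta = dp_eval p eta + dp_eval q eta.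
    exact: mevalD.
  have evM (p q : dpoly E 'I_n) : dp_eval (p * q) eta = dp_eval p eta * dp_eval q eta.
    exact: mevalM.
  split.
  + by move=> p [].
  + by apply/vanE => //; apply: coefs_in0.
  + move=> p q hp hq; have [cp _] := hp; have [cq _] := hq.
    apply/vanE; first exact: coefs_inD.
    by rewrite evD (vanE p cp).1 // (vanE q cq).1 // addr0.
  + move=> p q cp hq; have [cq _] := hq; apply/vanE; first exact: coefs_inM.
    by rewrite evM (vanE q cq).1 // mulr0.
  + move=> h1; have c1 : coefs_in Fu (1 : dpoly E 'I_n) by exact: coefs_in1.
    have := (vanE 1 c1).1 h1 => /eqP.
    by rewrite ev1 oner_eq0.
  + move=> p q cp cq h; have := (vanE _ (coefs_inM sFu cp cq)).1 h => /eqP.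
    rewrite evM mulf_eq0 => /orP[] /eqP e.
      by left; exact: (vanE p cp).2 e.
    by right; exact: (vanE q cq).2 e.
- move=> w [t0 h]; exists (maxn t0 s) => t; rewrite geq_max => /andP[tt0 ts].
  have [dt dim wt] := h t tt0; exists (size (basics Fu eta t)).
    exact: (dim_prime_basics charE hFu genW t _).2 erefl.
  have dtE := (dim_prime_basics charE hF gen t dt).1 dim.
  rewrite hornerD hornerN wt binom_eval // dtE.
  have r := rank_section charE hF i0o Ms M01 M0j M0s fj0 hv vu uo ts.
  by rewrite -r -FuE natrD addrK.
- exists eta => //; apply/(delta_trdegP m0 charE hFu).
  have c := cols_section m0 charE hF i0o Ms M01 M0j M0s fj0 hv vu uo.
  by rewrite dE -colsE c -FuE subn1.
Qed.
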